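(* Let $\mathcal M$ be a countable MDP with bounded real-valued rewards and initial state $s_0$. Consider the objective of maximizing the expectation $\mathcal E_{\mathcal M,s_0,\sigma}\big(\limsup_{n} r_n\big)$ of the $\limsup$ of the sequence of rewards $r_0r_1r_2\cdots$ seen along the run. If an optimal strategy for this objective from $s_0$ exists, then there also exist an optimal memoryless randomized (MR) strategy from $s_0$ and an optimal deterministic Markov (Det(SC)) strategy from $s_0$.
   Context: An MDP $\mathcal M$ consists of a countable set $S$ of states partitioned into controlled states $S_C$ and random states $S_R$; a transition relation $\longrightarrow\subseteq S\times S$ such that every state has at least one successor (the set $\mathrm{Succ}(s)$ of successors of $s$ may be infinite); a function $P$ assigning to each random state $s$ a probability distribution on $\mathrm{Succ}(s)$; and a reward function $r$ assigning a real number to each transition. A run is an infinite sequence $s_0e_0s_1e_1\cdots$ with $e_i=(s_i,s_{i+1})\in\longrightarrow$, and $r_n=r(e_n)$. A history is a finite prefix of a run ending in a controlled state. A (general) strategy $\sigma$ maps each history ending in $s$ to a probability distribution on $\mathrm{Succ}(s)$. It is deterministic if all these distributions are Dirac; memoryless if they depend only on the current state (memoryless randomized: possibly non-Dirac distributions); Markov if they depend only on the current state and the number of steps taken so far. A strategy and a start state $s$ induce a probability measure on (countably additive, on the Borel $\sigma$-algebra of) runs from $s$, with expectation $\mathcal E_{\mathcal M,s,\sigma}$. A strategy is optimal from $s_0$ if it attains the supremum of $\mathcal E_{\mathcal M,s_0,\sigma}(\limsup_n r_n)$ over all strategies $\sigma$. *)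

(* Defs.v *)
From HB Require Import structures.
From mathcomp Require Import all_boot all_order all_algebra.
From mathcomp Require Import all_classical all_reals all_analysis.

Set Implicit Arguments.
Unset Strict Implicit.
Unset Printing Implicit Defensive.

Import Order.TTheory GRing.Theory Num.Theory.
Import numFieldNormedType.Exports.

Local Open Scope classical_set_scope.
Local Open Scope ring_scope.

Definition is_dist (R : realType) (S : countType) (A : pred S) (d : S -> R) :=
  [/\ forall t, 0 <= d t,
      forall t, ~~ A t -> d t = 0 &
      (\esum_(t in [set: S]) (d t)%:E = 1)%E].

(* [prob s] is only meaningful at random (i.e. not controlled) states, and
   [reward s t] only when [edge s t]. *)
Record mdp (R : realType) (S : countType) := MDP {
  controlled : pred S;
  edge : rel S;
  edge_succ : forall s, exists t, edge s t;
  prob : S -> S -> R;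
  prob_dist : forall s, ~~ controlled s -> is_dist (edge s) (prob s);
  reward : S -> S -> R }.

Definition bounded_rewards (R : realType) (S : countType) (M : mdp R S) :=
  exists B : R, forall s t, edge M s t -> `|reward M s t| <= B.

(* A history is determined by its states [rcons h s]; [h] lists the states
   before the current state [s], so [size h] steps have been taken. *)
Definition history (R : realType) (S : countType) (M : mdp R S)
    (h : seq S) (s : S) : bool :=
  sorted (edge M) (rcons h s) && controlled M s.

(* [sigma h s t] is the probability of moving to [t] after the history
   [rcons h s]; the values at other sequences are irrelevant. *)
Record strategy (R : realType) (S : countType) (M : mdp R S) := Strategy {
  choice_prob :> seq S -> S -> S -> R;
  choice_dist : forall h s, history M h s ->
    is_dist (edge M s) (choice_prob h s) }.

Section strategy_classes.
Context (R : realType) (S : countType) (M : mdp R S) (sigma : strategy M).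

Definition is_deterministic := forall h s, history M h s ->
  exists t, forall u, sigma h s u = (u == t)%:R.

Definition is_memoryless := forall h h' s, history M h s -> history M h' s ->
  sigma h s =1 sigma h' s.

Definition is_markov := forall h h' s, history M h s -> history M h' s ->
  size h = size h' -> sigma h s =1 sigma h' s.

Definition step (h : seq S) (s t : S) : R :=
  if controlled M s then sigma h s t else prob M s t.

(* Probability that, after [rcons h s], the next states are those of [u]. *)
Fixpoint path_prob (h : seq S) (s : S) (u : seq S) : R :=
  if u is t :: u' then step h s t * path_prob (rcons h s) t u' else 1.

End strategy_classes.

Definition cylinder (S : Type) (u : seq S) : set (nat -> S) :=
  [set w | mkseq w (size u) = u].

(* A run is given by its sequence of states, and the sample space is the set of
   all sequences of states with the product (Borel) sigma-algebra; the measures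
   [run_measure] below are concentrated on the runs from [s0], see
   [run_measure_runs]. The index [s0] only provides the default point that
   [measurableType] requires. *)
Definition state_seq (S : countType) (s0 : S) := nat -> S.

HB.instance Definition _ (S : countType) (s0 : S) :=
  gen_eqMixin (state_seq s0).
HB.instance Definition _ (S : countType) (s0 : S) :=
  gen_choiceMixin (state_seq s0).
HB.instance Definition _ (S : countType) (s0 : S) :=
  isPointed.Build (state_seq s0) (fun=> s0).

Notation runs s0 :=
  (g_sigma_algebraType (range (@cylinder _) : set (set (state_seq s0)))).

Section inverse_cdf.
Context (R : realType) (q : nat -> R).
Hypothesis q0 : forall k, 0 <= q k.
Hypothesis q1 : (\sum_(k <oo) (q k)%:E = 1)%E.

Let F k := \sum_(0 <= j < k) q j.

Lemma cumul_nd k l : (k <= l)%N -> F k <= F l.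
Proof.
move=> kl; rewrite /F [leRHS](@big_cat_nat _ _ _ k)//= lerDl.
exact: sumr_ge0.
Qed.

Lemma cumul_le1 k : F k <= 1.
Proof.
rewrite -lee_fin -[leRHS]q1 /F -sumEFin.
by apply: nneseries_lim_ge => j _ _; rewrite lee_fin.
Qed.

Lemma cumul_ex x : 0 <= x < 1 -> exists k, F k <= x < F k.+1.
Proof.
move=> /andP[x0 x1].
have exK : exists K, x < F K.
  apply: contrapT => /forallNP nK; move: x1; apply/negP; rewrite -leNgt.
  rewrite -lee_fin -[leLHS]q1; apply: lime_le.
    by apply: is_cvg_nneseries => k _ _; rewrite lee_fin.
  by apply: nearW => n; rewrite sumEFin lee_fin leNgt; apply/negP/nK.
case: (ex_minnP exK) => -[|k].
  by rewrite /F big_geq// ltNge x0.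
move=> xk mink; exists k; rewrite xk andbT leNgt; apply/negP => /mink.
by rewrite ltnn.
Qed.

Definition inverse_cdf x := xget 0%N [set k | F k <= x < F k.+1].

Lemma inverse_cdfE x k : 0 <= x < 1 ->
  inverse_cdf x = k <-> F k <= x < F k.+1.
Proof.
move=> x01; have [l lP] := cumul_ex x01.
have uniq i j : F i <= x < F i.+1 -> F j <= x < F j.+1 -> (i <= j)%N.
  move=> /andP[ix _] /andP[_ xj]; rewrite leqNgt; apply/negP => ji.
  by have := le_lt_trans (le_trans (cumul_nd ji) ix) xj; rewrite ltxx.
have := @xgetPex _ 0%N [set k | F k <= x < F k.+1] (ex_intro _ l lP).
rewrite -/(inverse_cdf x) /= => iP; split => [<-//|kP].
by apply/eqP; rewrite eqn_leq !uniq.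
Qed.

End inverse_cdf.

Section run_measure.
Context (R : realType) (S : countType) (M : mdp R S) (sigma : strategy M).
Variable s0 : S.

Lemma step_dist (h : seq S) s : sorted (edge M) (rcons h s) ->
  is_dist (edge M s) (step sigma h s).
Proof.
move=> hs; rewrite /step; have [cs|ncs] := boolP (controlled M s).
  by apply: choice_dist; rewrite /history hs.
exact: prob_dist.
Qed.

Let q h s k := if pickle_inv k is Some t then step sigma h s t else 0.

Let q0 (h : seq S) s k : sorted (edge M) (rcons h s) -> 0 <= q h s k.
Proof.
by move=> /step_dist[d0 _ _]; rewrite /q; case: pickle_inv.
Qed.

Let q1 (h : seq S) s : sorted (edge M) (rcons h s) ->
  (\sum_(k <oo) (q h s k)%:E = 1)%E.
Proof.
move=> hs; have [_ _ <-] := step_dist hs.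
rewrite nneseries_esumT; last by move=> k; rewrite lee_fin q0.
have -> : (\esum_(t in [set: S]) (step sigma h s t)%:E =
    \esum_(t in [set: S]) (q h s (pickle t))%:E)%E.
  by apply: eq_esum => t _; rewrite /q pickleK_inv.
rewrite -(esum_image [set: S] pickle (fun k => (q h s k)%:E)); last first.
  by move=> x y _ _; exact: (pcan_inj pickleK_inv).
rewrite [RHS]esum_mkcond; apply: eq_esum => k _.
case: ifPn => // /negP; rewrite inE => nk; rewrite /q.
case E : (pickle_inv k) => [t|//].
by exfalso; apply: nk; exists t => //; have := @pickle_invK S k; rewrite E.
Qed.

Let cumul h s k : R := \sum_(0 <= j < k) q h s j.

Let idx h s x := inverse_cdf (q h s) x.

(* The uniform variable [x] in [0, 1[ is used to draw the next state by
   inversion of the cumulative distribution, then rescaled to be reused. *)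
Fixpoint trace h s (x : R) n : S :=
  if n is n'.+1 then
    trace (rcons h s) (odflt s (pickle_inv (idx h s x)))
      ((x - cumul h s (idx h s x)) / q h s (idx h s x)) n'
  else s.

Let history_rcons (h : seq S) s t : sorted (edge M) (rcons h s) ->
  edge M s t -> sorted (edge M) (rcons (rcons h s) t).
Proof.
case: h => [|a h] /=; first by move=> _ ->.
by move=> hs st; rewrite rcons_path hs last_rcons st.
Qed.

Lemma path_prob_ge0 (h : seq S) s u : sorted (edge M) (rcons h s) ->
  0 <= path_prob sigma h s u.
Proof.
elim: u h s => [|t u IH] h s hs //=; have [d0 dN _] := step_dist hs.
have [est|nest] := boolP (edge M s t); last by rewrite dN// mul0r.
by rewrite mulr_ge0// IH// history_rcons.
Qed.

Let mkseq_cons (T : Type) (f : nat -> T) n :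
  mkseq f n.+1 = f 0%N :: mkseq (fun k => f k.+1) n.
Proof. by rewrite /mkseq /= -(addn0 1%N) iotaDl -map_comp. Qed.

Let trace_itv u (h : seq S) s : sorted (edge M) (rcons h s) ->
  exists a, [/\ 0 <= a, a + path_prob sigma h s u <= 1 & forall x, 0 <= x < 1 ->
    mkseq (trace h s x) (size u).+1 = s :: u <->
    a <= x < a + path_prob sigma h s u].
Proof.
elim: u h s => [|t u IH] h s hs.
  by exists 0; split; rewrite /= ?add0r// => x x01; split.
have [d0 dN _] := step_dist hs.
have qk : q h s (pickle t) = step sigma h s t by rewrite /q pickleK_inv.
have cumS k : cumul h s k.+1 = cumul h s k + q h s k.
  by rewrite /cumul big_nat_recr.
have cum0 k : 0 <= cumul h s k by apply: sumr_ge0 => j _; exact: q0.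
have idxP x k : 0 <= x < 1 ->
    idx h s x = k <-> cumul h s k <= x < cumul h s k + q h s k.
  move=> x01; rewrite -cumS; apply: inverse_cdfE => // [j|]; first exact: q0.
  exact: q1.
have hdP x : 0 <= x < 1 ->
    odflt s (pickle_inv (idx h s x)) = t -> idx h s x = pickle t.
  move=> x01; have /(idxP _ _ x01)/andP[Fx xF] := erefl (idx h s x).
  have : 0 < q h s (idx h s x).
    by rewrite -(ltrDl (cumul h s (idx h s x))) (le_lt_trans Fx).
  rewrite {1}/q; have := @pickle_invK S (idx h s x).
  by case: pickle_inv => [t' /= <- _ ->//|]; rewrite ltxx.
have [est|nest] := boolP (edge M s t); last first.
  exists 0; rewrite /= dN// mul0r addr0; split => // x x01; split; last first.
    by move=> /andP[x0]; rewrite ltNge x0.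
  rewrite mkseq_cons /= => -[+ _]; move=> /(hdP _ x01)/(idxP _ _ x01).
  by rewrite qk dN// addr0 => /andP[Fx]; rewrite ltNge Fx.
have hst := history_rcons hs est.
have [a [a0 a1 aP]] := IH _ _ hst.
have p0 := path_prob_ge0 u hst.
rewrite /=; move: (path_prob _ _ _ u) p0 a1 aP => p p0 a1 aP.
have F1 : cumul h s (pickle t) + step sigma h s t <= 1.
  by rewrite -qk -cumS; apply: cumul_le1 => [j|]; [exact: q0|exact: q1].
have := cum0 (pickle t).
have dd := d0 t.
move: (idxP^~ (pickle t)); rewrite qk => {}idxP F0.
exists (cumul h s (pickle t) + step sigma h s t * a).
split; first by rewrite addr_ge0// mulr_ge0.
  by rewrite -addrA -mulrDr (le_trans _ F1)// lerD2l ler_piMr.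
move=> x x01; rewrite mkseq_cons /=.
have in01 :
    cumul h s (pickle t) <= x < cumul h s (pickle t) + step sigma h s t ->
    0 < step sigma h s t /\
    0 <= (x - cumul h s (pickle t)) / step sigma h s t < 1.
  move=> /andP[Fx xF].
  have dp : 0 < step sigma h s t.
    by rewrite -(ltrDl (cumul h s (pickle t))) (le_lt_trans Fx).
  by rewrite divr_ge0 ?subr_ge0//= ltr_pdivrMr// mul1r ltrBlDl.
have rescale : 0 < step sigma h s t ->
    (a <= (x - cumul h s (pickle t)) / step sigma h s t < a + p) =
    (cumul h s (pickle t) + step sigma h s t * a <= x <
     cumul h s (pickle t) + step sigma h s t * a + step sigma h s t * p).
  move=> dp; rewrite ler_pdivlMr// ltr_pdivrMr// lerBrDl ltrBlDl.
  by rewrite -addrA -mulrDr ![step _ _ _ _ * _]mulrC.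
split.
  move=> /eqP; rewrite eqseq_cons => /andP[_ /eqP tl].
  have /(hdP _ x01) ik : odflt s (pickle_inv (idx h s x)) = t.
    by move: tl; rewrite mkseq_cons => -[].
  have [dp y01] := in01 (proj1 (idxP _ x01) ik).
  by rewrite -rescale//; apply/(aP _ y01); move: tl; rewrite ik qk pickleK_inv.
move=> xI.
have Fx : cumul h s (pickle t) <= x < cumul h s (pickle t) + step sigma h s t.
  case/andP: xI => ax xb; rewrite (le_trans _ ax) ?lerDl ?mulr_ge0//=.
  by rewrite (lt_le_trans xb)// -addrA -mulrDr lerD2l ler_piMr.
have [dp y01] := in01 Fx.
have ik := proj2 (idxP _ x01) Fx.
rewrite ik qk pickleK_inv /=; congr (_ :: _); apply/(aP _ y01).
by rewrite rescale.
Qed.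

Let unit_itv_measurable : measurable (`[0, 1[%classic : set R) :=
  measurable_itv _.

Let unif : {measure set (measurableTypeR R) -> \bar R} :=
  mrestr (@lebesgue_measure R) unit_itv_measurable.

Let draw (x : measurableTypeR R) : runs s0 :=
  if 0 <= x < 1 then trace [::] s0 x else fun=> s0.

Let draw_measurable : measurable_fun [set: measurableTypeR R] draw.
Proof.
apply: (@measurability _ _ _ (runs s0) setT draw _ erefl) => _ [_ [u _ <-] <-].
rewrite setTI; pose D : set (measurableTypeR R) := `[0, 1[%classic.
have DE x : D x <-> 0 <= x < 1 by rewrite /D /= in_itv.
have mD : measurable D := unit_itv_measurable.
rewrite -(setUIDK (draw @^-1` cylinder u) D) setDE; apply: measurableU.
  case: u => [|t u].
    by rewrite [X in measurable X](_ : _ = D)//; apply/seteqP; split => x// [].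
  have [->|ts] := eqVneq t s0; last first.
    rewrite [X in measurable X](_ : _ = set0)//; apply/seteqP; split => x //=.
    move=> [] + /DE x01; rewrite /draw x01 /cylinder /= => -[s0t].
    by rewrite s0t eqxx in ts.
  have [a [_ _ aP]] := @trace_itv u [::] s0 isT.
  rewrite [X in measurable X](_ : _ =
     D `&` `[a, a + path_prob sigma [::] s0 u[%classic).
    by apply: measurableI => //; exact: measurable_itv.
  apply/seteqP; split => x /=; rewrite in_itv /= => -[].
    by move=> + /[dup] Dx /DE x01; rewrite /draw x01 => /(aP _ x01).
  by move=> /[dup] Dx /DE x01 /(aP _ x01); rewrite /draw x01.
have [cu|ncu] := pselect (cylinder u (fun=> s0)).
  rewrite [X in measurable X](_ : _ = ~` D); first exact: measurableC.
  apply/seteqP; split => [x []//|x nx]; split => //.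
  by rewrite /= /draw; case: ifPn => // /DE.
rewrite [X in measurable X](_ : _ = set0)//; apply/seteqP; split => x //=.
by move=> -[+ nx]; rewrite /draw; case: ifPn => // /DE.
Qed.

Lemma run_measure_exists : exists P : probability (runs s0) R,
  forall u, P (cylinder (s0 :: u)) = (path_prob sigma [::] s0 u)%:E.
Proof.
have mu u : pushforward unif draw (cylinder (s0 :: u)) =
    (path_prob sigma [::] s0 u)%:E.
  have [a [a0 a1 aP]] := @trace_itv u [::] s0 isT.
  have p0 : 0 <= path_prob sigma [::] s0 u by exact: path_prob_ge0.
  rewrite /pushforward /unif /= /mrestr.
  rewrite (_ : _ `&` _ = `[a, a + path_prob sigma [::] s0 u[%classic).
    rewrite lebesgue_measure_itv/= lte_fin ltrDl.
    case: ltP => [_|pN]; first by rewrite -EFinB addrAC subrr add0r.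
    by congr (_%:E); apply/eqP; rewrite eq_le p0.
  apply/seteqP; split => x /=; rewrite !in_itv /=.
    by move=> [] + x01; rewrite /draw x01 => /(aP _ x01).
  move=> xI; have x01 : 0 <= x < 1.
    by case/andP: xI => ax xa; rewrite (le_trans a0)// (lt_le_trans xa).
  by split => //; rewrite /draw x01; apply/(aP _ x01).
have unif1 : unif setT = 1%E.
  by rewrite /unif /= /mrestr setTI lebesgue_measure_itv/= lte_fin ltr01 sube0.
pose U : probability (measurableTypeR R) R :=
  HB.pack (mrestr (@lebesgue_measure R) unit_itv_measurable)
    (Measure_isProbability.Build _ _ _ unif unif1).
pose X : {mfun measurableTypeR R >-> runs s0} :=
  mfun_Sub (mem_set draw_measurable).
by exists (distribution U X).
Qed.

(* The measure on runs induced by [s0] and [sigma], the only one that satisfies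
   [run_measure_cylinder]. *)
Definition run_measure : probability (runs s0) R :=
  sval (cid run_measure_exists).

Lemma run_measure_cylinder u :
  run_measure (cylinder (s0 :: u)) = (path_prob sigma [::] s0 u)%:E.
Proof. exact: (svalP (cid run_measure_exists)). Qed.

Lemma measurable_cylinder u : measurable (cylinder u : set (runs s0)).
Proof. by apply: sub_sigma_algebra; exists u. Qed.

Lemma run_measure_start : run_measure (~` cylinder [:: s0]) = 0%E.
Proof.
have := probability_setC run_measure (measurable_cylinder [:: s0]).
by rewrite run_measure_cylinder /= subee.
Qed.

Lemma run_measure_unique (P : probability (runs s0) R) :
  (forall u, P (cylinder (s0 :: u)) = (path_prob sigma [::] s0 u)%:E) ->
  forall A, measurable A -> P A = run_measure A.
Proof.
move=> PE; pose G : set (set (runs s0)) :=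
  [set A | A = set0 \/ range (@cylinder S) A].
have Gm : G `<=` measurable.
  by move=> _ [->|[u _ <-]]; [exact: measurable0|exact: measurable_cylinder].
have P0 : P (~` cylinder [:: s0]) = 0%E.
  have := probability_setC P (measurable_cylinder [:: s0]).
  by rewrite PE /= subee.
move=> A mA; apply: (g_sigma_algebra_measure_unique G Gm (fun=> setT)).
- by move=> _; right; exists [::] => //; apply/seteqP; split.
- by rewrite bigcup_const.
- move=> B C [->|[u _ <-]]; first by left; rewrite set0I.
  move=> [->|[v _ <-]]; first by left; rewrite setI0.
  have cylE n w : (n <= size w)%N -> forall x : nat -> S,
      cylinder w x -> mkseq x n = take n w.
    move=> nw x xw; rewrite -[in RHS]xw /mkseq -map_take take_iota.
    by rewrite (minn_idPl nw).
  wlog uv : u v / (size u <= size v)%N.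
    move=> H; have [|/ltnW] := leqP (size u) (size v); first exact: H.
    by rewrite setIC; exact: H.
  have [E|E] := eqVneq u (take (size u) v).
    right; exists v => //; apply/seteqP; split => [x xv|x []//]; split => //.
    by rewrite /cylinder /= (cylE _ _ uv _ xv) -E.
  left; apply/seteqP; split => x // -[xu xv].
  by move: E; rewrite -(cylE _ _ uv _ xv) -{1}xu eqxx.
- move=> B [->|[u _ <-]]; first by rewrite !measure0.
  case: u => [|t u].
    have -> : cylinder [::] = [set: runs s0] by apply/seteqP; split.
    by transitivity (1%E : \bar R); [|apply/esym]; exact: probability_setT.
  have [->|ts] := eqVneq t s0.
    exact: etrans (PE u) (esym (run_measure_cylinder u)).
  have sub : cylinder (t :: u) `<=` (~` cylinder [:: s0] : set (runs s0)).
    move=> x xt xs; case: xt xs => [xt _] [xs].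
    by rewrite -xt xs eqxx in ts.
  have mC : measurable (~` cylinder [:: s0] : set (runs s0)).
    by apply: measurableC; exact: measurable_cylinder.
  have null (Q : probability (runs s0) R) :
      Q (~` cylinder [:: s0]) = 0%E -> Q (cylinder (t :: u)) = 0%E.
    by apply: subset_measure0 => //; exact: measurable_cylinder.
  transitivity (0%E : \bar R); first exact: null.
  by apply/esym/null; exact: run_measure_start.
- by move=> _; rewrite [X in (X < _)%E]probability_setT ltry.
- by apply: (sub_sigma_algebra2 _ mA) => B [u _ <-]; right; exists u.
Qed.

Lemma path_prob_eq0 (h : seq S) s u : sorted (edge M) (rcons h s) ->
  ~~ path (edge M) s u -> path_prob sigma h s u = 0.
Proof.
elim: u h s => [//|t u IH] h s hs /=; have [_ dN _] := step_dist hs.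
have [est|nest] /= := boolP (edge M s t); last by rewrite dN// mul0r.
by move=> nu; rewrite IH ?mulr0// history_rcons.
Qed.

Lemma run_measure_runs : {ae run_measure, forall w : runs s0,
  w 0%N = s0 /\ forall n, edge M (w n) (w n.+1)}.
Proof.
pose bad k : set (runs s0) := if (unpickle k : option (seq S)) is Some u then
  if path (edge M) s0 u then set0 else cylinder (s0 :: u) else set0.
have badN k : run_measure.-negligible (bad k).
  rewrite /bad; case: unpickle => [u|]; last exact: negligible_set0.
  case: ifPn => [_|nu]; first exact: negligible_set0.
  apply/negligibleP; first exact: measurable_cylinder.
  apply: etrans (run_measure_cylinder u) _.
  by rewrite path_prob_eq0.
have startN : run_measure.-negligible (~` cylinder [:: s0]).
  apply/negligibleP; last exact: run_measure_start.
  by apply: measurableC; exact: measurable_cylinder.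
apply: negligibleS (negligibleU startN (negligible_bigcup badN)).
move=> w /= /not_andP[w0|]; first by left => -[].
have [w0|w0 _] := eqVneq (w 0%N) s0; last by left => -[/eqP]; apply/negP.
move=> /existsNP[n nw]; right.
pose u := mkseq (fun k => w k.+1) n.+1.
exists (pickle u) => //; rewrite /bad pickleK ifN.
  change (mkseq w (size u).+1 = s0 :: u).
  by rewrite size_mkseq mkseq_cons w0.
apply/negP => /(pathP s0)/(_ n); rewrite size_mkseq => /(_ (ltnSn n)).
rewrite nth_mkseq// => H; apply: nw; move: H.
case: n @u => [|n] u /=; first by rewrite -w0.
by rewrite nth_mkseq.
Qed.

(* [limn_esup] is taken in the extended reals because [reward] may be unbounded
   along sequences that are not runs. *)
Definition payoff : \bar R :=
  (\int[run_measure]_w limn_esup (fun n => (reward M (w n) (w n.+1))%:E))%E.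

End run_measure.

Definition mdp_value (R : realType) (S : countType) (M : mdp R S) (s0 : S) :
  \bar R := ereal_sup [set payoff sigma s0 | sigma in [set: strategy M]].

Definition is_optimal (R : realType) (S : countType) (M : mdp R S)
    (sigma : strategy M) (s0 : S) := payoff sigma s0 = mdp_value M s0.

(* Main.v *)
(* Let v be the optimal value. Along an optimal strategy v is a martingale and the
   limsup of the rewards has conditional expectation v(s) at the current state s;
   since this limsup is close in L^1 to a maximum of finitely many rewards, a
   maximal inequality shows that, for every e > 0, a transition (s, t) with
   r(s, t) >= v(t) - e is taken almost surely. Conversely, by optional stopping, a
   strategy along which v is a martingale and such transitions recur for every e is
   optimal.

   Memoryless strategy: the choices are fixed little by little. At each stage, for
   one state x and one e, almost all of the still free probability is fixed on a
   finite set of states, so as to hit the e-target from x with high probability. As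
   some freedom is left everywhere, every target remains almost surely reachable
   from every state, so all pairs (x, e) can be treated in turn.

   Deterministic Markov strategy: in consecutive finite phases, the memoryless
   strategy is derandomised by always picking a successor whose probability of
   hitting the current target before the end of the phase is at least the average. *)
From HB Require Import structures.
Require Import Defs.
From mathcomp Require Import all_boot all_order all_algebra.
From mathcomp Require Import all_classical all_reals all_analysis.
From mathcomp Require Import measurable_realfun.
From mathcomp Require Import zify ring lra.

Set Implicit Arguments.
Unset Strict Implicit.
Unset Printing Implicit Defensive.

Import Order.TTheory GRing.Theory Num.Theory.
Import numFieldNormedType.Exports.

Local Open Scope classical_set_scope.
Local Open Scope ring_scope.

(** * Weighted sums over a countable type *)

(** Nearly every step conditions on the past, which is awkward for a measure on runs. Expectations
    are therefore iterated weighted sums over successors, conditioning is the passage to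
    [after k t], and the value of a policy is a double limit of such sums. Integrals over runs
    return only at the end, to identify this limit with the payoff.

    The supremum need not be attained from every state, and hitting probabilities are controlled
    only from states where it is. Choices are restricted to transitions that never leave these
    [attained] states once inside. This alone is not enough: a play may preserve the value forever
    while postponing every near-value transition, so hitting probabilities must be built into the
    choices.

    A memoryless choice that is good for one target may be bad for another. What a stage has
    achieved survives all later stages because [hit] is computed from the committed mass alone and
    grows with it. In the deterministic case, an infinite branching rules out a phase length that
    suits all states at once; only an average over the law of the current state can be made
    small. *)

Section weighted_sums.
Context {R : realType} {S : countType}.
Implicit Types (d f g : S -> R).

Definition bdd f := exists C, forall t, `|f t| <= C.

Definition weight d :=
  (forall t, 0 <= d t) /\ (\esum_(t in [set: S]) (d t)%:E < +oo)%E.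

Definition natext f (k : nat) : R := oapp f 0 (pickle_inv k : option S).

(** Summation is an integral against the counting measure on codes, so that linearity and dominated
    convergence come from integration theory, for signed [f] and without a measurable structure on
    [S]. *)
Definition wsum d f : R :=
  \int[counting]_k (natext (fun t => d t * f t) k).

Lemma esum_natext f : (forall t, 0 <= f t) ->
  (\esum_(t in [set: S]) (f t)%:E = \sum_(k <oo) (natext f k)%:E)%E.
Proof.
move=> f0; have n0 k : 0 <= natext f k by rewrite /natext; case: pickle_inv.
rewrite nneseries_esumT; last by move=> k; rewrite lee_fin.
transitivity (\esum_(t in [set: S]) (natext f (pickle t))%:E)%E.
  by apply: eq_esum => t _; rewrite /natext pickleK_inv.
rewrite -(esum_image [set: S] pickle (fun k => (natext f k)%:E)); last first.
  by move=> x y _ _; exact: (pcan_inj pickleK_inv).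
rewrite [LHS]esum_mkcond; apply: eq_esum => k _.
case: ifPn => // /negP; rewrite inE => nk; rewrite /natext.
case E : (pickle_inv k) => [t|//].
by exfalso; apply: nk; exists t => //; have := @pickle_invK S k; rewrite E.
Qed.

Lemma natext_integrable d f : weight d -> bdd f ->
  (@counting nat R).-integrable setT
    (EFin \o natext (fun t => d t * f t)).
Proof.
move=> [d0 dfin] [C fC]; have C0 t : 0 <= C := le_trans (normr_ge0 _) (fC t).
apply/integrableP; split; first by move=> _ Y _.
rewrite ge0_integral_count; last by move=> k; exact: abse_ge0.
have le k : (`|(natext (fun t => d t * f t) k)%:E| <=
    C%:E * (natext d k)%:E)%E.
  rewrite -EFinM lee_fin /natext; case: pickle_inv => [t|] /=.
    by rewrite normrM (ger0_norm (d0 t)) mulrC ler_wpM2r.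
  by rewrite normr0 mulr0.
have nd0 k : 0 <= natext d k by rewrite /natext; case: pickle_inv => //=.
apply: (@le_lt_trans _ _ (\sum_(k <oo) C%:E * (natext d k)%:E)%E).
  by apply: lee_nneseries => // k _; exact: le.
rewrite nneseriesZl; last by move=> k _; rewrite lee_fin.
rewrite -esum_natext //.
have : (0 <= \esum_(t in [set: S]) (d t)%:E)%E.
  by apply: esum_ge0 => t _; rewrite lee_fin.
by move: dfin; case: esum => //= r _ r0; rewrite -EFinM ltry.
Qed.

Lemma wsum_esum d f : weight d -> bdd f -> (forall t, 0 <= f t) ->
  (wsum d f)%:E = (\esum_(t in [set: S]) (d t * f t)%:E)%E.
Proof.
move=> wd bf f0; have [d0 _] := wd.
have df0 t : 0 <= d t * f t by rewrite mulr_ge0.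
rewrite esum_natext // /wsum /Rintegral fineK.
  rewrite ge0_integral_count // => k; rewrite lee_fin /natext.
  by case: pickle_inv => /=.
by have := integrable_fin_num measurableT (natext_integrable wd bf).
Qed.

Lemma bddD f g : bdd f -> bdd g -> bdd (fun t => f t + g t).
Proof.
move=> [C fC] [D gD]; exists (C + D) => t.
by rewrite (le_trans (ler_normD _ _))// lerD.
Qed.

Lemma bddZ c f : bdd f -> bdd (fun t => c * f t).
Proof.
by move=> [C fC]; exists (`|c| * C) => t; rewrite normrM ler_wpM2l.
Qed.

Lemma bddB f g : bdd f -> bdd g -> bdd (fun t => f t - g t).
Proof.
move=> [C fC] [D gD]; exists (C + D) => t.
by rewrite (le_trans (ler_normB _ _))// lerD.
Qed.

Lemma bdd_cst c : bdd (fun=> c). Proof. by exists `|c|. Qed.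

Lemma bdd_itv a b f : (forall t, a <= f t <= b) -> bdd f.
Proof.
move=> fab; exists (`|a| + `|b|) => t; have /andP[af fb] := fab t.
have := ler_norm b; have := ler_norm (- a); rewrite normrN => ? ?.
by have := normr_ge0 a; have := normr_ge0 b; rewrite ler_norml; lra.
Qed.

Lemma wsumD d f g : weight d -> bdd f -> bdd g ->
  wsum d (fun t => f t + g t) = wsum d f + wsum d g.
Proof.
move=> wd bf bg; rewrite /wsum -RintegralD //; try exact: natext_integrable.
apply: eq_Rintegral => k _; rewrite /natext.
by case: pickle_inv => [t|] /=; rewrite ?mulrDr ?addr0.
Qed.

Lemma wsumZ d c f : weight d -> bdd f ->
  wsum d (fun t => c * f t) = c * wsum d f.
Proof.
move=> wd bf; rewrite /wsum -RintegralZl //; try exact: natext_integrable.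
apply: eq_Rintegral => k _; rewrite /natext.
by case: pickle_inv => [t|] /=; rewrite ?mulr0 // mulrCA.
Qed.

Lemma wsumB d f g : weight d -> bdd f -> bdd g ->
  wsum d (fun t => f t - g t) = wsum d f - wsum d g.
Proof.
move=> wd bf bg; rewrite /wsum -RintegralB //; try exact: natext_integrable.
apply: eq_Rintegral => k _; rewrite /natext.
by case: pickle_inv => [t|] /=; rewrite ?mulrBr ?subr0.
Qed.

Lemma le_wsum_in d f g : weight d -> bdd f -> bdd g ->
  (forall t, 0 < d t -> f t <= g t) -> wsum d f <= wsum d g.
Proof.
move=> wd bf bg fg; apply: le_Rintegral => //; try exact: natext_integrable.
move=> k _; rewrite /natext; case: pickle_inv => [t|] //=.
have [d0 _] := wd; move: (d0 t); rewrite le_eqVlt => /predU1P[<-|dt].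
  by rewrite !mul0r.
by rewrite ler_wpM2l ?fg // ltW.
Qed.

Lemma eq_wsum_in d f g : (forall t, d t != 0 -> f t = g t) ->
  wsum d f = wsum d g.
Proof.
move=> fg; apply: eq_Rintegral => k _; rewrite /natext.
case: pickle_inv => [t|] //=.
by have [->|/fg ->//] := eqVneq (d t) 0; rewrite !mul0r.
Qed.

Lemma wsum_cvg d (F : nat -> S -> R) f C : weight d ->
  (forall n t, `|F n t| <= C) -> (forall t, F n t @[n --> \oo] --> f t) ->
  wsum d (F n) @[n --> \oo] --> wsum d f.
Proof.
move=> wd FC Ff.
have [d0 _] := wd; have fC t : `|f t| <= C.
  have cN : `|F n t| @[n --> \oo] --> `|f t| by apply: cvg_norm; exact: Ff.
  rewrite -(cvg_lim (@norm_hausdorff _ _) cN).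
  by apply: limr_le; [apply/cvg_ex; eexists; exact: cN|exact: nearW].
have bf : bdd f by exists C.
have acc_bounded n : bdd (F n) by exists C.
have nF k : (EFin \o natext (fun t => d t * F n t)) k @[n --> \oo] -->
    (EFin \o natext (fun t => d t * f t)) k.
  rewrite /natext /=; case: pickle_inv => [t|] /=; last exact: cvg_cst.
  apply: cvg_EFin; first exact: nearW.
  rewrite /comp /=; exact: cvgMr.
have dom k n : (`|(natext (fun t => d t * F n t)%R k)%:E| <=
    (natext (fun t => d t * C)%R k)%:E)%E.
  rewrite /natext /= lee_fin; case: pickle_inv => [t|] /=; last first.
    by rewrite normr0.
  by rewrite normrM (ger0_norm (d0 t)) ler_wpM2l.
have iC : (@counting nat R).-integrable setT
    (EFin \o natext (fun t => d t * C)).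
  by apply: (@natext_integrable d (fun=> C)) => //; exact: bdd_cst.
have iF n := natext_integrable wd (acc_bounded n);
  have iF' := natext_integrable wd bf.
have mF n := measurable_int _ (iF n).
have [] := @dominated_convergence _ _ _ (@counting nat R) setT measurableT
  (fun n => EFin \o natext (fun t => d t * F n t))
  (EFin \o natext (fun t => d t * f t)) (EFin \o natext (fun t => d t * C)) mF.
- exact: measurable_int iF'.
- by apply: aeW => k _; exact: nF.
- exact: iC.
- by apply: aeW => k n _; exact: dom.
move=> _ _ H; apply: fine_cvg.
rewrite /wsum /Rintegral fineK //.
exact: integrable_fin_num.
Qed.

(** Hitting probabilities are known to converge to [1] only at attained states, which carry the
    weight but need not exhaust [S]. *)
Lemma wsum_cvg_in d (F : nat -> S -> R) f C : weight d ->
  (forall n t, `|F n t| <= C) ->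
  (forall t, 0 < d t -> F n t @[n --> \oo] --> f t) ->
  wsum d (F n) @[n --> \oo] --> wsum d f.
Proof.
move=> wd FC Ff; have [d0 _] := wd.
pose r (h : S -> R) t := if 0 < d t then h t else 0.
have rE h : wsum d h = wsum d (r h).
  by apply: eq_wsum_in => t dt; rewrite /r lt_def dt d0.
rewrite rE; under eq_cvg do rewrite rE.
apply: (@wsum_cvg _ _ _ C) => // [n t|t]; rewrite /r; case: ifPn => // dt.
- by rewrite normr0 (le_trans _ (FC n t)).
- exact: Ff.
- exact: cvg_cst.
Qed.

Lemma wsum_dl c d f : (forall t, 0 <= d t) -> weight d -> bdd f ->
  wsum (fun t => c * d t) f = c * wsum d f.
Proof.
move=> d0 wd bf; rewrite -wsumZ //; apply: eq_Rintegral => k _.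
by rewrite /natext; case: pickle_inv => //= t; rewrite mulrCA mulrA.
Qed.

Lemma weightD d e : weight d -> weight e -> weight (fun t => d t + e t).
Proof.
move=> [d0 dfin] [e0 efin]; split; first by move=> t; rewrite addr_ge0.
under eq_esum do rewrite EFinD.
rewrite esumD; [|by move=> *; rewrite lee_fin..].
exact: lte_add_pinfty.
Qed.

Lemma weightZ c d : 0 <= c -> weight d -> weight (fun t => c * d t).
Proof.
move=> c0 wd; have [d0 dfin] := wd; split; first by move=> t; rewrite mulr_ge0.
have := wsum_esum wd (bdd_cst c) (fun=> c0).
under [in X in _ = X -> _]eq_esum do rewrite mulrC.
by move=> <-; rewrite ltry.
Qed.

Lemma weight_le d e : (forall t, 0 <= d t <= e t) -> weight e -> weight d.
Proof.
move=> de [e0 efin]; split; first by move=> t; case/andP: (de t).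
apply: le_lt_trans efin; apply: le_esum => t _.
by rewrite lee_fin; case/andP: (de t).
Qed.

Lemma wsumDd d e f : weight d -> weight e -> bdd f ->
  wsum (fun t => d t + e t) f = wsum d f + wsum e f.
Proof.
move=> wd we bf; rewrite /wsum -RintegralD //; try exact: natext_integrable.
apply: eq_Rintegral => k _; rewrite /natext.
by case: pickle_inv => [t|] /=; rewrite ?mulrDl ?addr0.
Qed.

Lemma le_wsum_weight d e f : (forall t, 0 <= d t <= e t) -> weight e ->
  bdd f -> (forall t, 0 <= f t) -> wsum d f <= wsum e f.
Proof.
move=> de we bf f0; have wd := weight_le de we.
apply: le_Rintegral => //; try exact: natext_integrable.
move=> k _; rewrite /natext; case: pickle_inv => [t|] //=.
by rewrite ler_wpM2r //; case/andP: (de t).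
Qed.

Definition dirac_dist (t u : S) : R := (u == t)%:R.

Lemma esum_dirac_dist t : (\esum_(u in [set: S]) (dirac_dist t u)%:E = 1)%E.
Proof.
transitivity (\esum_(u in [set t]) (1 : \bar R))%E; last exact: esum_set1.
rewrite [RHS]esum_mkcond; apply: eq_esum => u _; rewrite /dirac_dist.
have [->|ut] := eqVneq u t; first by rewrite mem_set.
by rewrite memNset //=; apply/eqP.
Qed.

Implicit Types A : pred S.

Lemma dist_weight A d : is_dist A d -> weight d.
Proof. by move=> [d0 _ d1]; split=> //; rewrite d1 ltry. Qed.

Lemma dist_supp A d t : is_dist A d -> 0 < d t -> A t.
Proof. by move=> [_ dA _]; apply: contraTT => /dA ->; rewrite ltxx. Qed.

Lemma wsum_cst A d c : is_dist A d -> wsum d (fun=> c) = c.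
Proof.
move=> dd; have wd := dist_weight dd.
have w1 : wsum d (fun=> 1) = 1.
  apply: EFin_inj; rewrite wsum_esum //; last exact: bdd_cst.
  by have [_ _ <-] := dd; apply: eq_esum => t _; rewrite mulr1.
rewrite -[in LHS](mulr1 c) (@wsumZ d c (fun=> 1)) ?w1 ?mulr1 //.
exact: bdd_cst.
Qed.

Lemma dist_dirac A t : A t -> is_dist A (dirac_dist t).
Proof.
move=> At; split; last exact: esum_dirac_dist.
  by move=> u; rewrite ler0n.
by move=> u; rewrite /dirac_dist; case: eqP => // -> /negP.
Qed.

Lemma wsum_dirac t f : wsum (dirac_dist t) f = f t.
Proof.
rewrite -(@wsum_cst predT (dirac_dist t) (f t)); last exact: dist_dirac.
by apply: eq_wsum_in => u; rewrite /dirac_dist; have [->|] := eqVneq u t;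
  rewrite ?eqxx.
Qed.

Lemma wsum_indic d t c : wsum d (fun u => (u == t)%:R * c) = d t * c.
Proof.
rewrite -(wsum_dirac t (fun u => d u * c)); apply: eq_Rintegral => k _.
by rewrite /natext; case: pickle_inv => //= u; rewrite mulrCA.
Qed.

Lemma wsum_ge0 d f : weight d -> bdd f -> (forall t, 0 < d t -> 0 <= f t) ->
  0 <= wsum d f.
Proof.
move=> wd bf f0; rewrite [leLHS](_ : 0 = wsum d (fun=> 0)).
  by apply: le_wsum_in => //; exact: bdd_cst.
rewrite -[LHS](mul0r (wsum d (fun=> 0))) -wsumZ //; last exact: bdd_cst.
by apply: eq_wsum_in => t _; rewrite mul0r.
Qed.

Lemma wsum_le A d f c : is_dist A d -> bdd f ->
  (forall t, 0 < d t -> f t <= c) -> wsum d f <= c.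
Proof.
move=> dd bf fc; rewrite -(wsum_cst c dd); apply: le_wsum_in => //.
  exact: dist_weight dd.
exact: bdd_cst.
Qed.

Lemma wsum_ge A d f c : is_dist A d -> bdd f ->
  (forall t, 0 < d t -> c <= f t) -> c <= wsum d f.
Proof.
move=> dd bf fc; rewrite -(wsum_cst c dd); apply: le_wsum_in => //.
  exact: dist_weight dd.
exact: bdd_cst.
Qed.

(** One atom decides: [d t * (c - f t)] is at most the average of [c - f], which is nonpositive.
    This turns equality of averages into equality on the support. *)
Lemma wsum_eq_max A d f c : is_dist A d -> bdd f ->
  (forall t, 0 < d t -> f t <= c) -> c <= wsum d f ->
  forall t, 0 < d t -> f t = c.
Proof.
move=> dd bf fc cf t dt; apply/eqP; rewrite eq_le fc //= -subr_le0.
rewrite -(pmulr_rle0 _ dt) -(wsum_indic d t).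
have wd := dist_weight dd; have bc := bdd_cst c.
rewrite (@le_trans _ _ (wsum d (fun t => c - f t))) //; last first.
  by rewrite wsumB // (wsum_cst c dd) subr_le0.
apply: le_wsum_in => //; last 1 first.
- move=> u du; case: eqP => [->|_]; first by rewrite mul1r.
  by rewrite mul0r subr_ge0 fc.
- exists `|c - f t| => u; case: eqP => _; first by rewrite mul1r.
  by rewrite mul0r normr0.
- exact: bddB.
Qed.

Lemma dist_supp_ex A d : is_dist A d -> exists t, 0 < d t.
Proof.
move=> dd; apply: contrapT => /forallNP d0; have := wsum_cst 1 dd.
rewrite (@eq_wsum_in d (fun=> 1) (fun=> 0)).
  by rewrite (wsum_cst 0 dd) => /eqP; rewrite eq_sym oner_eq0.
move=> t dt; exfalso; apply: (d0 t); rewrite lt_def dt.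
by have [dge0 _ _] := dd; exact: dge0.
Qed.

(** If all values on the support were below their average, the average would be an upper bound that
    is reached, hence one of these values. This is the source of derandomisation. *)
Lemma wsum_ex_ge A d f : is_dist A d -> bdd f ->
  exists t, 0 < d t /\ wsum d f <= f t.
Proof.
move=> dd bf; apply: contrapT => /forallNP nf.
have fc t : 0 < d t -> f t < wsum d f.
  by move=> dt; rewrite ltNge; apply/negP => ft; apply: (nf t).
have [t dt] := dist_supp_ex dd.
have := wsum_eq_max dd bf (fun t dt => ltW (fc t dt)) (lexx _) dt.
by move=> E; have := fc t dt; rewrite E ltxx.
Qed.

End weighted_sums.

(** * Policies and expectations of maxima of rewards *)

Section policies.
Context {R : realType} {S : countType} (M : mdp R S).
Implicit Types (s t : S) (d : S -> R).

(* A policy from a start state [s]: [k u] is the choice made when the states [u]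
   have been visited after [s]. *)
Definition policy := seq S -> S -> R.

Definition valid_dist s d :=
  is_dist (edge M s) d /\ (~~ controlled M s -> d = prob M s).

(** Validity is required after every word [u], even one that follows no edges, so that inductions
    carry no path hypothesis. *)
Definition valid_policy (k : policy) s := forall u, valid_dist (last s u) (k u).

Definition after (k : policy) t : policy := fun u => k (t :: u).

(* Off the edges [reward] is arbitrary and may be unbounded. *)
Definition clip_reward s t := if edge M s t then reward M s t else 0.

(** [F] sees the residual policy, the current state and the running maximum of the rewards.
    Conditioning on the first steps is then mere composition, see [acc_expect_add]. *)
Fixpoint acc_expect n (F : policy -> S -> R -> R) (k : policy) s y : R :=
  if n is n'.+1 then
    wsum (k [::]) (fun t => acc_expect n' F (after k t) t
      (Num.max y (clip_reward s t)))
  else F k s y.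

Definition delay_expect n (F : policy -> S -> R) (k : policy) s : R :=
  acc_expect n (fun k s _ => F k s) k s 0.

Lemma valid_policy_after k s t : valid_policy k s -> valid_policy (after k t) t.
Proof. by move=> kP u; exact: (kP (t :: u)). Qed.

Lemma valid_policy_dist k s : valid_policy k s -> is_dist (edge M s) (k [::]).
Proof. by move=> /(_ [::])[]. Qed.

Lemma valid_policy_weight k s : valid_policy k s -> weight (k [::]).
Proof. by move=> /valid_policy_dist /dist_weight. Qed.

Lemma acc_expect_add n m F k s y : acc_expect (n + m) F k s y =
  acc_expect n (acc_expect m F) k s y.
Proof.
elim: n k s y => [//|n IH] k s y /=.
by apply: eq_wsum_in => t _; exact: IH.
Qed.

Lemma acc_expect_noacc n F k s y y' :
  acc_expect n (fun k s _ => F k s) k s y =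
    acc_expect n (fun k s _ => F k s) k s y' :> R.
Proof.
elim: n k s y y' => [//|n IH] k s y y' /=.
by apply: eq_wsum_in => t _; exact: IH.
Qed.

Lemma delay_expectS n F k s :
  delay_expect n.+1 F k s =
    wsum (k [::]) (fun t => delay_expect n F (after k t) t).
Proof. by apply: eq_wsum_in => t _; exact: acc_expect_noacc. Qed.

Lemma delay_expect_add n m F k s : delay_expect (n + m) F k s =
  delay_expect n (delay_expect m F) k s.
Proof.
elim: n k s => [//|n IH] k s; rewrite addSn !delay_expectS.
by apply: eq_wsum_in => t _; exact: IH.
Qed.

Section bounded.
(* The slack of [1] makes [1 - B] a neutral start for maxima of rewards, with room
   below it for the start [- B] used in [opt_miss]. *)
Variable B : R.
Hypothesis rewardB : forall s t, `|clip_reward s t| <= B - 1.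

Lemma bound_ge1 s : 1 <= B.
Proof. by rewrite -subr_ge0 (le_trans _ (rewardB s s)). Qed.

Lemma acc_norm_le y s t : `|y| <= B -> `|Num.max y (clip_reward s t)| <= B.
Proof.
move=> yB; case: (leP y (clip_reward s t)) => // _.
by rewrite (le_trans (rewardB s t)) // gerBl.
Qed.

Definition acc_bounded C (F : policy -> S -> R -> R) :=
  forall k s y, valid_policy k s -> `|y| <= B -> `|F k s y| <= C.

Lemma wsum_norm_le s d f C : is_dist (edge M s) d ->
  (forall t, `|f t| <= C) -> `|wsum d f| <= C.
Proof.
move=> dd fC; have bf : bdd f by exists C.
rewrite ler_norml (wsum_ge dd bf) ?(wsum_le dd bf) // => t _.
  by have := fC t; rewrite ler_norml => /andP[].
by have := fC t; rewrite ler_norml => /andP[].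
Qed.

Lemma acc_expect_bounded n C F : acc_bounded C F ->
  acc_bounded C (acc_expect n F).
Proof.
move=> FC; elim: n => [//|n IH] k s y kP yB /=.
apply: (wsum_norm_le (valid_policy_dist kP)) => t.
by apply: IH; [exact: valid_policy_after kP|exact: acc_norm_le].
Qed.

Lemma acc_expect_bdd n C F k s y : acc_bounded C F -> valid_policy k s ->
  `|y| <= B ->
  bdd (fun t => acc_expect n F (after k t) t (Num.max y (clip_reward s t))).
Proof.
move=> FC kP yB; exists C => t.
by apply: (acc_expect_bounded n FC);
  [exact: valid_policy_after kP|exact: acc_norm_le].
Qed.

(** The comparison is only available where steps of positive probability lead: [Inv] will say that
    the residual policy is optimal and that the accumulator lies in a prescribed range. *)
Lemma acc_expect_le_inv (Inv : policy -> S -> R -> Prop) n C D F G k s y :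
  acc_bounded C F -> acc_bounded D G ->
  (forall k s y t, Inv k s y -> 0 < k [::] t ->
     Inv (after k t) t (Num.max y (clip_reward s t))) ->
  (forall k s y, Inv k s y -> valid_policy k s /\ `|y| <= B) ->
  (forall k s y, Inv k s y -> F k s y <= G k s y) ->
  Inv k s y -> acc_expect n F k s y <= acc_expect n G k s y.
Proof.
move=> FC GD InvS InvP FG; elim: n k s y => [|n IH] k s y I /=; first exact: FG.
have [kP yB] := InvP _ _ _ I.
apply: le_wsum_in; first exact: valid_policy_weight kP.
- exact: acc_expect_bdd FC _ _.
- exact: acc_expect_bdd GD _ _.
- by move=> t kt; apply: IH; exact: InvS.
Qed.

Lemma acc_expect_le n C D F G k s y : acc_bounded C F -> acc_bounded D G ->
  (forall k s y, valid_policy k s -> `|y| <= B -> F k s y <= G k s y) ->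
  valid_policy k s -> `|y| <= B -> acc_expect n F k s y <= acc_expect n G k s y.
Proof.
move=> FC GD FG kP yB.
apply: (@acc_expect_le_inv (fun k s y => valid_policy k s /\ `|y| <= B) n C D)
  => //.
- by move=> {}k {}s {}y t [{}kP {}yB] _; split;
  [exact: valid_policy_after kP|exact: acc_norm_le].
- by move=> ? ? ? [? ?]; exact: FG.
Qed.

Lemma acc_expectD n C D F G k s y : acc_bounded C F -> acc_bounded D G ->
  valid_policy k s -> `|y| <= B ->
  acc_expect n (fun k s y => F k s y + G k s y) k s y = acc_expect n F k s y +
    acc_expect n G k s y.
Proof.
move=> FC GD; elim: n k s y => [//|n IH] k s y kP yB /=.
rewrite -wsumD; [|exact: valid_policy_weight kP|exact: acc_expect_bdd FC _
  _|exact: acc_expect_bdd GD _ _].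
by apply: eq_wsum_in => t _; rewrite IH //;
  [exact: valid_policy_after kP|exact: acc_norm_le].
Qed.

Lemma acc_expectZ n C c F k s y : acc_bounded C F -> valid_policy k s ->
  `|y| <= B ->
  acc_expect n (fun k s y => c * F k s y) k s y = c * acc_expect n F k s y.
Proof.
move=> FC; elim: n k s y => [//|n IH] k s y kP yB /=.
rewrite -wsumZ; [|exact: valid_policy_weight kP|exact: acc_expect_bdd FC _ _].
by apply: eq_wsum_in => t _; rewrite IH //;
  [exact: valid_policy_after kP|exact: acc_norm_le].
Qed.

Lemma acc_expect_cst n c k s y : valid_policy k s ->
  acc_expect n (fun _ _ _ => c) k s y = c.
Proof.
elim: n k s y => [//|n IH] k s y kP /=.
rewrite -[RHS](wsum_cst c (valid_policy_dist kP)).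
by apply: eq_wsum_in => t _; rewrite IH //; exact: valid_policy_after kP.
Qed.

Lemma acc_expect_cvg n C (F_ : nat -> policy -> S -> R -> R) F k s y :
  (forall i, acc_bounded C (F_ i)) ->
  (forall k s y, valid_policy k s -> `|y| <= B -> F_ i k s y @[i --> \oo] -->
    F k s y) ->
  valid_policy k s -> `|y| <= B -> acc_expect n (F_ i) k s y @[i --> \oo] -->
    acc_expect n F k s y.
Proof.
move=> FC FF; elim: n k s y => [|n IH] k s y kP yB /=; first exact: FF.
apply: (@wsum_cvg _ _ _ _ _ C); first exact: valid_policy_weight kP.
  move=> i t; apply: (acc_expect_bounded n (FC i));
    first exact: valid_policy_after kP.
  exact: acc_norm_le.
by move=> t; apply: IH; [exact: valid_policy_after kP|exact: acc_norm_le].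
Qed.

Definition max_reward N := acc_expect N (fun _ _ y => y).

Let acc_bounded_id : acc_bounded B (fun _ _ y => y). Proof. by []. Qed.

Lemma max_reward_bounded N : acc_bounded B (max_reward N). Proof.
  exact: acc_expect_bounded. Qed.

Lemma max_reward_le_acc N k s y y' : valid_policy k s -> `|y| <= B ->
  `|y'| <= B -> y <= y' ->
  max_reward N k s y <= max_reward N k s y'.
Proof.
elim: N k s y y' => [//|N IH] k s y y' kP yB y'B yy'; rewrite /max_reward /=.
apply: le_wsum_in; [exact: valid_policy_weight kP|exact: acc_expect_bdd
  acc_bounded_id _ _..|].
move=> t _; apply: IH; [exact: valid_policy_after
  kP|exact: acc_norm_le|exact: acc_norm_le|].
by rewrite ge_max !le_max yy' lexx orbT.
Qed.

Lemma max_reward_ge_acc N k s y : valid_policy k s -> `|y| <= B ->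
  y <= max_reward N k s y.
Proof.
elim: N k s y => [//|N IH] k s y kP yB; rewrite /max_reward /=.
apply: (wsum_ge (valid_policy_dist kP));
  first exact: acc_expect_bdd acc_bounded_id _ _.
move=> t _; apply: (@le_trans _ _ (Num.max y (clip_reward s t))); first
  by rewrite le_max lexx.
by apply: IH; [exact: valid_policy_after kP|exact: acc_norm_le].
Qed.

Lemma max_reward_nd k s y : valid_policy k s -> `|y| <= B ->
  nondecreasing_seq (fun N => max_reward N k s y).
Proof.
move=> kP yB; apply/nondecreasing_seqP => N;
  rewrite -addn1 /max_reward acc_expect_add.
apply: (@acc_expect_le N B B) => //; first exact: max_reward_bounded.
by move=> ? ? ? ? ?; exact: (max_reward_ge_acc 1).
Qed.

Definition sup_reward k s y := limn (fun N => max_reward N k s y).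

Lemma max_reward_cvg k s y : valid_policy k s -> `|y| <= B ->
  max_reward N k s y @[N --> \oo] --> sup_reward k s y.
Proof.
move=> kP yB; apply: nondecreasing_is_cvgn; first exact: max_reward_nd.
by exists B => _ [N _ <-]; have := max_reward_bounded N kP yB;
  rewrite ler_norml => /andP[].
Qed.

Lemma max_reward_le_sup N k s y : valid_policy k s -> `|y| <= B ->
  max_reward N k s y <= sup_reward k s y.
Proof.
move=> kP yB; apply: (@nondecreasing_cvgn_le _ (fun N => max_reward N k s y)).
  exact: max_reward_nd.
by apply/cvg_ex; eexists; exact: max_reward_cvg.
Qed.

Lemma cvg_norm_le (u : nat -> R) (l C : R) :
  (forall n, `|u n| <= C) -> u n @[n --> \oo] --> l -> `|l| <= C.
Proof.
move=> uC ul; have cN : `|u n| @[n --> \oo] --> `|l| by exact: cvg_norm.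
rewrite -(cvg_lim (@norm_hausdorff _ _) cN).
by apply: limr_le; [apply/cvg_ex; eexists; exact: cN|exact: nearW].
Qed.

Lemma cvg_le (u v : nat -> R) (l l' : R) : (forall n, u n <= v n) ->
  u n @[n --> \oo] --> l -> v n @[n --> \oo] --> l' -> l <= l'.
Proof.
move=> uv ul vl.
rewrite -(cvg_lim (@norm_hausdorff _ _) ul) -(cvg_lim (@norm_hausdorff _ _) vl).
apply: ler_lim; [by apply/cvg_ex; eexists; exact: ul|
  by apply/cvg_ex; eexists; exact: vl|exact: nearW].
Qed.

Lemma cvg_uniq (u : nat -> R) (l l' : R) :
  u n @[n --> \oo] --> l -> u n @[n --> \oo] --> l' -> l = l'.
Proof. by move=> ul ul'; apply/eqP;
  rewrite eq_le !(cvg_le (fun n => lexx (u n))). Qed.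

Lemma sup_reward_bounded : acc_bounded B sup_reward.
Proof.
move=> k s y kP yB; apply: cvg_norm_le (max_reward_cvg kP yB) => n;
  exact: max_reward_bounded.
Qed.

Lemma sup_reward_ge_acc k s y : valid_policy k s -> `|y| <= B ->
  y <= sup_reward k s y.
Proof. by move=> kP yB; exact: (max_reward_le_sup 0 kP yB). Qed.

Lemma sup_reward_le_acc k s y y' : valid_policy k s -> `|y| <= B ->
  `|y'| <= B -> y <= y' ->
  sup_reward k s y <= sup_reward k s y'.
Proof.
move=> kP yB y'B yy'; apply: cvg_le (max_reward_cvg kP yB)
  (max_reward_cvg kP y'B) => n.
exact: max_reward_le_acc.
Qed.

Lemma sup_reward_step k s y : valid_policy k s -> `|y| <= B ->
  sup_reward k s y = wsum (k [::])
    (fun t => sup_reward (after k t) t (Num.max y (clip_reward s t))).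
Proof.
move=> kP yB; have qS : max_reward n.+1 k s y @[n --> \oo] --> sup_reward k s y.
  by rewrite (cvg_shiftS (fun n => max_reward n k s y)); exact: max_reward_cvg.
apply: cvg_uniq qS _; rewrite /max_reward /=.
apply: (@wsum_cvg _ _ _ _ _ B); first exact: valid_policy_weight kP.
  by move=> n t; apply: max_reward_bounded;
    [exact: valid_policy_after kP|exact: acc_norm_le].
by move=> t; apply: max_reward_cvg;
  [exact: valid_policy_after kP|exact: acc_norm_le].
Qed.

Lemma acc_expect_sup_reward n k s y : valid_policy k s -> `|y| <= B ->
  acc_expect n sup_reward k s y = sup_reward k s y.
Proof.
elim: n k s y => [//|n IH] k s y kP yB /=; rewrite [RHS]sup_reward_step //.
by apply: eq_wsum_in => t _; apply: IH;
  [exact: valid_policy_after kP|exact: acc_norm_le].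
Qed.

Lemma sup_reward_bdd k s y : valid_policy k s -> `|y| <= B ->
  bdd (fun t => sup_reward (after k t) t (Num.max y (clip_reward s t))).
Proof.
by move=> kP yB; exists B => t; apply: sup_reward_bounded;
  [exact: valid_policy_after kP|exact: acc_norm_le].
Qed.

(** Forgetting the reward of the first transition can only lower the supremum; this is what makes
    [tail_value] nonincreasing. *)
Lemma sup_reward_super k s y : valid_policy k s -> `|y| <= B ->
  wsum (k [::]) (fun t => sup_reward (after k t) t y) <= sup_reward k s y.
Proof.
move=> kP yB; rewrite sup_reward_step //; apply: le_wsum_in;
  first exact: valid_policy_weight kP.
- by exists B => t; apply: sup_reward_bounded => //;
  exact: valid_policy_after kP.
- exact: sup_reward_bdd.
- move=> t _; apply: sup_reward_le_acc => //;
  first exact: valid_policy_after kP.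
    exact: acc_norm_le.
  by rewrite le_max lexx.
Qed.

Lemma base_norm_le s : `|1 - B| <= B.
Proof.
by have := bound_ge1 s => ?; rewrite ler_norml; lra.
Qed.

(** Every clipped reward is at least [1 - B], so the first transition erases either start. *)
Lemma sup_reward_base k s : valid_policy k s ->
  sup_reward k s (- B) = sup_reward k s (1 - B).
Proof.
move=> kP; have B1 := bound_ge1 s; have BB : `|- B| <= B.
  by rewrite normrN ger0_norm //; lra.
rewrite !sup_reward_step //; last exact: base_norm_le s.
apply: eq_wsum_in => t _; congr sup_reward.
by have := rewardB s t; rewrite ler_norml => ?; rewrite !max_r //; lra.
Qed.

Definition tail_value n := delay_expect n (fun k s => sup_reward k s (1 - B)).

Lemma delay_expect_norm_le n C F :
  (forall k s, valid_policy k s -> `|F k s| <= C) ->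
  forall k s, valid_policy k s -> `|delay_expect n F k s| <= C.
Proof.
move=> FC k s kP; apply: (@acc_expect_bounded n C (fun k s _ => F k s)) => //.
  by move=> ? ? ? ? _; exact: FC.
by rewrite normr0 (le_trans ler01) // (bound_ge1 s).
Qed.

Lemma delay_expect_le_inv (Inv : policy -> S -> Prop) n C D F G k s :
  (forall k s, valid_policy k s -> `|F k s| <= C) ->
  (forall k s, valid_policy k s -> `|G k s| <= D) ->
  (forall k s t, Inv k s -> 0 < k [::] t -> Inv (after k t) t) ->
  (forall k s, Inv k s -> valid_policy k s) ->
  (forall k s, Inv k s -> F k s <= G k s) ->
  Inv k s -> delay_expect n F k s <= delay_expect n G k s.
Proof.
move=> FC GD InvS InvP FG I; have bound_ge0 : 0 <= B.
  by rewrite (le_trans ler01) // (bound_ge1 s).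
apply: (@acc_expect_le_inv (fun k s y => Inv k s /\ `|y| <= B) n C D).
- by move=> ? ? ? ? _; exact: FC.
- by move=> ? ? ? ? _; exact: GD.
- by move=> {}k {}s y t [{}I yB] kt; split;
  [exact: InvS I kt|exact: acc_norm_le].
- by move=> ? ? ? [/InvP ? ?].
- by move=> ? ? ? [? _]; exact: FG.
- by rewrite normr0.
Qed.

Lemma delay_expect_le n C D F G k s :
  (forall k s, valid_policy k s -> `|F k s| <= C) ->
  (forall k s, valid_policy k s -> `|G k s| <= D) ->
  (forall k s, valid_policy k s -> F k s <= G k s) ->
  valid_policy k s -> delay_expect n F k s <= delay_expect n G k s.
Proof.
move=> FC GD FG kP; apply: (@delay_expect_le_inv valid_policy n C D) =>
  // k' s' t k'P _.
exact: valid_policy_after k'P.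
Qed.

Lemma delay_expect_cvg n C (F_ : nat -> policy -> S -> R) F k s :
  (forall i k s, valid_policy k s -> `|F_ i k s| <= C) ->
  (forall k s, valid_policy k s -> F_ i k s @[i --> \oo] --> F k s) ->
  valid_policy k s -> delay_expect n (F_ i) k s @[i --> \oo] -->
    delay_expect n F k s.
Proof.
move=> FC FF kP.
apply: (@acc_expect_cvg n C (fun i k s _ => F_ i k s) (fun k s _ => F k s)) =>
  //.
- by move=> i ? ? ? ? _; exact: FC.
- by move=> ? ? ? ? _; exact: FF.
- by rewrite normr0 (le_trans ler01) // (bound_ge1 s).
Qed.

Let sup_reward_norm_le k s : valid_policy k s -> `|sup_reward k s (1 - B)| <= B.
Proof. by move=> kP; apply: sup_reward_bounded => //; exact: base_norm_le s.
  Qed.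

Lemma tail_value_norm_le n k s : valid_policy k s -> `|tail_value n k s| <= B.
Proof. exact: delay_expect_norm_le. Qed.

Lemma tail_value_ni k s : valid_policy k s ->
  nonincreasing_seq (fun n => tail_value n k s).
Proof.
move=> kP; apply/nonincreasing_seqP => n;
  rewrite -addn1 /tail_value delay_expect_add.
apply: (@delay_expect_le n B B) => //; first exact: delay_expect_norm_le.
move=> k' s' k'P; rewrite delay_expectS; apply: sup_reward_super => //;
  exact: base_norm_le s.
Qed.

(* The expectation of the limsup of the rewards, as the limit of the expectations
   of the suprema of the rewards after time [n]. *)
Definition policy_value k s := limn (fun n => tail_value n k s).

Lemma tail_value_cvg k s : valid_policy k s -> tail_value n k s @[n --> \oo] -->
  policy_value k s.
Proof.
move=> kP; apply: nonincreasing_is_cvgn; first exact: tail_value_ni.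
exists (- B) => _ [N _ <-].
by have := tail_value_norm_le N kP; rewrite ler_norml => /andP[].
Qed.

Lemma policy_value_le_tail n k s : valid_policy k s ->
  policy_value k s <= tail_value n k s.
Proof.
move=> kP; apply: (@nonincreasing_cvgn_ge _ (fun n => tail_value n k s)).
  exact: tail_value_ni.
by apply/cvg_ex; eexists; exact: tail_value_cvg.
Qed.

Lemma policy_value_norm_le k s : valid_policy k s -> `|policy_value k s| <= B.
Proof. by move=> kP; apply: cvg_norm_le (tail_value_cvg kP) => n;
  exact: tail_value_norm_le. Qed.

Lemma policy_value_step k s : valid_policy k s ->
  policy_value k s = wsum (k [::]) (fun t => policy_value (after k t) t).
Proof.
move=> kP; have wS : tail_value n.+1 k s @[n --> \oo] --> policy_value k s.
  by rewrite (cvg_shiftS (fun n => tail_value n k s)); exact: tail_value_cvg.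
apply: cvg_uniq wS _; under eq_cvg do rewrite /tail_value delay_expectS.
apply: (@wsum_cvg _ _ _ _ _ B); first exact: valid_policy_weight kP.
  by move=> n t; apply: tail_value_norm_le; exact: valid_policy_after kP.
by move=> t; apply: tail_value_cvg; exact: valid_policy_after kP.
Qed.

End bounded.
End policies.

(** * Optimal policies and near-value transitions *)

Section optimal_value.
Context {R : realType} {S : countType} (M : mdp R S) (B : R).
Hypothesis rewardB : forall s t, `|clip_reward M s t| <= B - 1.
Implicit Types (s t : S) (d : S -> R) (k : @policy R S) (c e y : R).

Local Notation valid_dist := (valid_dist M).
Local Notation valid_policy := (valid_policy M).
Local Notation clip_reward := (clip_reward M).
Local Notation acc_expect := (acc_expect M).
Local Notation delay_expect := (delay_expect M).
Local Notation max_reward := (max_reward M).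
Local Notation sup_reward := (sup_reward M).
Local Notation tail_value := (tail_value M B).
Local Notation policy_value := (policy_value M B).

Definition default_dist s : S -> R :=
  if controlled M s then dirac_dist (xchoose (edge_succ M s)) else prob M s.

Lemma default_dist_valid s : valid_dist s (default_dist s).
Proof.
rewrite /default_dist; have [cs|ncs] := boolP (controlled M s); split => //.
- by apply: dist_dirac; exact: (xchooseP (edge_succ M s)).
- by rewrite cs.
- exact: prob_dist.
Qed.

Definition policy_values s :=
  [set policy_value k s | k in [set k | valid_policy k s]].

Definition opt_value s := sup (policy_values s).

Lemma policy_values_has_sup s : has_sup (policy_values s).
Proof.
split; first by exists (policy_value (fun u => default_dist (last s u)) s),
  (fun u => default_dist (last s u)) => // u; exact: default_dist_valid.
exists B => _ [k kP <-]; have := policy_value_norm_le rewardB kP.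
by rewrite ler_norml => /andP[].
Qed.

Lemma policy_value_le_opt k s : valid_policy k s ->
  policy_value k s <= opt_value s.
Proof. by move=> kP; apply: sup_upper_bound;
  [exact: policy_values_has_sup|exists k]. Qed.

Lemma opt_value_adherent s e : 0 < e -> exists k,
  valid_policy k s /\ opt_value s - e < policy_value k s.
Proof.
move=> e0; have [_ [k kP <-] ?] := sup_adherent e0 (policy_values_has_sup s).
by exists k.
Qed.

Lemma opt_value_norm_le s : `|opt_value s| <= B.
Proof.
rewrite ler_norml; apply/andP; split; last first.
  apply: ge_sup; first by have [] := policy_values_has_sup s.
  by move=> _ [k kP <-]; have := policy_value_norm_le rewardB kP;
    rewrite ler_norml => /andP[].
have [k [kP _]] := opt_value_adherent s ltr01.
apply: le_trans (policy_value_le_opt kP);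
  have := policy_value_norm_le rewardB kP.
by rewrite ler_norml => /andP[].
Qed.

Lemma opt_value_bdd : bdd opt_value. Proof. by exists B;
  exact: opt_value_norm_le. Qed.

(** Policies that are [e]-optimal from each successor, glued behind the first choice [d], form a
    single policy from [s]. *)
Lemma opt_value_super s d : valid_dist s d -> wsum d opt_value <= opt_value s.
Proof.
move=> dP; have [dd _] := dP; rewrite -subr_le0; apply/ler_addgt0Pl => e e0.
rewrite addr0.
have [kk kkP] := choice (fun t => opt_value_adherent t e0).
pose g : @policy R S := fun u => if u is t :: u' then kk t u' else d.
have gP : valid_policy g s by move=> [|t u] //=; exact: (kkP t).1.
have gV : wsum d (fun t => policy_value (kk t) t) <= opt_value s.
  by have := policy_value_le_opt gP; rewrite (policy_value_step rewardB gP).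
suff : wsum d opt_value - e <= wsum d (fun t => policy_value (kk t) t)
  by move=> ?; lra.
rewrite -[e in X in X <= _](wsum_cst e dd) -wsumB;
  [|exact: dist_weight dd|exact: opt_value_bdd|exact: bdd_cst].
apply: le_wsum_in; first exact: dist_weight dd.
- exact: (bddB opt_value_bdd (bdd_cst e)).
- by exists B => t; apply: policy_value_norm_le => //; exact: (kkP t).1.
- by move=> t _; exact: ltW (kkP t).2.
Qed.

Lemma opt_value_edge s t : controlled M s -> edge M s t ->
  opt_value t <= opt_value s.
Proof.
move=> cs st; rewrite -(wsum_dirac t opt_value); apply: opt_value_super; split.
  exact: dist_dirac.
by rewrite cs.
Qed.

Definition opt_policy k s := valid_policy k s /\ policy_value k s = opt_value s.

(** The value of [s] is the average of the values of the continuations, which is at most the average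
    of [opt_value], which is at most [opt_value s]. All are equal, and [wsum_eq_max] makes each
    continuation on the support optimal. *)
Lemma opt_policy_stepV k s : opt_policy k s ->
  wsum (k [::]) opt_value = opt_value s /\ forall t, 0 < k [::] t ->
    opt_policy (after k t) t.
Proof.
move=> [kP kw]; have kd := valid_policy_dist kP;
  have kwt := valid_policy_weight kP.
have bw : bdd (fun t => policy_value (after k t) t).
  by exists B => t; apply: policy_value_norm_le => //;
    exact: valid_policy_after kP.
have le1 : wsum (k [::]) (fun t => policy_value (after k t) t) <=
  wsum (k [::]) opt_value.
  apply: le_wsum_in => //; first exact: opt_value_bdd.
  by move=> t _; apply: policy_value_le_opt; exact: valid_policy_after kP.
have le2 : wsum (k [::]) opt_value <= opt_value s by apply: opt_value_super;
  exact: (kP [::]).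
move: kw; rewrite (policy_value_step rewardB kP) => kw; split; first
  by apply/eqP; rewrite eq_le le2 -kw le1.
move=> t kt; split; first exact: valid_policy_after kP.
apply/eqP; rewrite -subr_eq0; apply/eqP.
apply: (@wsum_eq_max _ _ _ _ (fun t => policy_value (after k t) t - opt_value t)
  0 kd) => //.
- exact: (bddB bw opt_value_bdd).
- by move=> u _; rewrite subr_le0; apply: policy_value_le_opt;
  exact: valid_policy_after kP.
- by rewrite wsumB //; [rewrite subr_ge0 kw|exact: opt_value_bdd].
Qed.

Lemma opt_policy_step k s t : opt_policy k s -> 0 < k [::] t ->
  opt_policy (after k t) t.
Proof. by move=> /opt_policy_stepV[_]; exact. Qed.

Lemma opt_policy_opt_value k s : opt_policy k s ->
  wsum (k [::]) opt_value = opt_value s.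
Proof. by move=> /opt_policy_stepV[]. Qed.

(** The controller could move to any successor, so none has a larger value; their average is the
    value of [s], which forces equality on the support. *)
Lemma opt_policy_controlled k s t : opt_policy k s -> controlled M s ->
  0 < k [::] t -> opt_value t = opt_value s.
Proof.
move=> kO cs; have [kP _] := kO; have kd := valid_policy_dist kP.
apply: (wsum_eq_max kd opt_value_bdd); last
  by rewrite (opt_policy_opt_value kO).
by move=> u /(dist_supp kd) su; exact: opt_value_edge.
Qed.

(* The reward is compared with the value of the target [t]: at a random state the
   value is preserved only on average over [t]. *)
Definition near_value e s t := opt_value t - e <= clip_reward s t.

Fixpoint miss e n k s : R :=
  if n is n'.+1 then
    wsum (k [::]) (fun t => if near_value e s t then 0
      else miss e n' (after k t) t)
  else 1.

Lemma miss_itv e n k s : valid_policy k s -> 0 <= miss e n k s <= 1.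
Proof.
elim: n k s => [|n IH] k s kP /=; first by rewrite ler01 lexx.
have bm : bdd (fun t => if near_value e s t then 0 else miss e n (after k t) t).
  apply: (@bdd_itv _ _ 0 1) => t; case: ifP => _; first by rewrite lexx ler01.
  by apply: IH; exact: valid_policy_after kP.
apply/andP; split.
  apply: (wsum_ge0 (valid_policy_weight kP) bm) => t _; case: ifP => // _.
  by have /andP[] := IH _ _ (valid_policy_after t kP).
apply: (wsum_le (valid_policy_dist kP) bm) => t _; case: ifP => // _.
by have /andP[] := IH _ _ (valid_policy_after t kP).
Qed.

Lemma miss_norm_le e n k s : valid_policy k s -> `|miss e n k s| <= 1.
Proof. by move=> /(miss_itv e n)/andP[m0 m1]; rewrite ger0_norm. Qed.

Lemma miss_bdd e n k s : valid_policy k s ->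
  bdd (fun t => if near_value e s t then 0 else miss e n (after k t) t).
Proof.
move=> kP; apply: (@bdd_itv _ _ 0 1) => t; case: ifP => _; first
  by rewrite lexx ler01.
by apply: miss_itv; exact: valid_policy_after kP.
Qed.

(** The right side ignores hits during the first [n] steps, which can only raise the probability of
    a miss. *)
Lemma miss_delay e n m k s : valid_policy k s ->
  miss e (n + m) k s <= delay_expect n (miss e m) k s.
Proof.
elim: n k s => [//|n IH] k s kP; rewrite addSn delay_expectS /=.
apply: le_wsum_in; first exact: valid_policy_weight kP.
- exact: miss_bdd.
- exists 1 => t; apply: (delay_expect_norm_le rewardB);
  last exact: valid_policy_after kP.
  by move=> ? ?; exact: miss_norm_le.
- move=> t _; have ktP := valid_policy_after t kP; apply: le_trans (IH _ _ ktP).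
  by case: ifP => // _; have /andP[] := miss_itv e (n + m) ktP.
Qed.

Lemma miss_le_eps e e' n k s : e <= e' -> valid_policy k s ->
  miss e' n k s <= miss e n k s.
Proof.
move=> ee'; elim: n k s => [//|n IH] k s kP /=.
apply: le_wsum_in; [exact: valid_policy_weight kP|exact: miss_bdd..|].
move=> t _; have ktP := valid_policy_after t kP;
  have /andP[m0 _] := miss_itv e n ktP.
rewrite /near_value; case: ifP => [_|/negbT]; first by case: ifP.
rewrite -ltNge => r; rewrite ifN; first exact: IH.
by rewrite -ltNge; lra.
Qed.

(* As long as no [e]-near transition is taken, either the value climbs above
   [c + e / 2], which contributes to the excess of the supremum over [c], or the
   rewards stay below [c - e / 2], which contributes to the deficit. *)
Lemma miss_claim e n k s c y : 0 < e -> opt_policy k s -> `|c| <= B ->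
  `|y| <= B ->
  c + e / 2 <= opt_value s \/ y <= c - e / 2 ->
  e / 2 * miss e n k s <= sup_reward k s c - c +
    (max_reward n k s (Num.max c y) - max_reward n k s y).
Proof.
move=> e0; elim: n k s y => [|n IH] k s y kO cB yB H.
  have [kP kw] := kO; rewrite /= mulr1; case: H => H.
    have : opt_value s <= sup_reward k s c.
      rewrite -kw; apply: le_trans (policy_value_le_tail rewardB 0 kP) _.
      rewrite /tail_value /delay_expect /= -(sup_reward_base rewardB kP);
        apply: sup_reward_le_acc => //.
        by rewrite normrN ger0_norm //; have := bound_ge1 rewardB s; lra.
      by move: cB; rewrite ler_norml => /andP[].
    by rewrite /max_reward /=; have : y <= Num.max c y
      by [rewrite le_max lexx orbT]; lra.
  have : c <= sup_reward k s c by exact: sup_reward_ge_acc cB.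
  by rewrite /max_reward /= max_l; lra.
have [kP kw] := kO.
have mB : `|Num.max c y| <= B by case: (leP c y).
have cQ : c <= sup_reward k s c by exact: sup_reward_ge_acc cB.
(* A high value is settled without induction: the supremum is on average at least the value, so the
   excess alone is at least [e / 2], while [miss] is at most [1]. *)
case: H => H.
  have VQ : opt_value s <= sup_reward k s c.
    rewrite -kw; apply: le_trans (policy_value_le_tail rewardB 0 kP) _.
    rewrite /tail_value /delay_expect /= -(sup_reward_base rewardB kP);
      apply: sup_reward_le_acc => //.
      by rewrite normrN ger0_norm //; have := bound_ge1 rewardB s; lra.
    by move: cB; rewrite ler_norml => /andP[].
  have : max_reward n.+1 k s y <= max_reward n.+1 k s (Num.max c y).
    by apply: (max_reward_le_acc rewardB) => //; rewrite le_max lexx orbT.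
  have := miss_itv e n.+1 kP; set m := miss _ _ _ _ => /andP[m0 m1].
  have : e / 2 * m <= e / 2 * 1 by rewrite ler_wpM2l // divr_ge0 // ltW.
  lra.
have kwt := valid_policy_weight kP; have kd := valid_policy_dist kP.
have bq y' : `|y'| <= B ->
  bdd (fun t => max_reward n (after k t) t (Num.max y' (clip_reward s t))).
  move=> y'B; exists B => t; apply: (max_reward_bounded rewardB);
    first exact: valid_policy_after kP.
  exact: acc_norm_le.
have bQ : bdd (fun t => sup_reward (after k t) t c).
  by exists B => t; apply: (sup_reward_bounded rewardB) => //;
    exact: valid_policy_after kP.
have bm := miss_bdd e n kP;
  have bc : bdd (fun _ : S => c : R) := @bdd_cst _ _ c.
apply: (@le_trans _ _ (wsum (k [::]) (fun t => sup_reward (after k t) t c - c +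
   (max_reward n (after k t) t (Num.max (Num.max c y) (clip_reward s t)) -
    max_reward n (after k t) t (Num.max y (clip_reward s t)))))); last first.
  rewrite wsumD //; [|exact: (bddB bQ bc)|exact: (bddB (bq _ mB) (bq _ yB))].
  rewrite !wsumB //; [|exact: bq..].
  by rewrite (wsum_cst c kd) lerD2r lerD2r; exact: sup_reward_super.
rewrite /= -wsumZ //; apply: le_wsum_in => //.
- exact: bddZ.
- by apply: bddD; apply: bddB => //; exact: bq.
move=> t kt; have ktO := opt_policy_step kO kt; have [ktP _] := ktO.
have ryB := acc_norm_le rewardB s t yB; rewrite -maxA.
(* Without a near transition the reward is below [opt_value t - e]. Hence either [opt_value t] is at
   least [c + e / 2], or the reward is below [c - e / 2] and the maximum stays low. After a near
   transition, both terms on the right are nonnegative. *)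
case: ifPn => [_|]; last first.
  rewrite /near_value -ltNge => rV; apply: IH => //.
  have [cV|Vc] := leP (c + e / 2) (opt_value t); [by left|right].
  by rewrite ge_max H /=; lra.
have := max_reward_le_acc rewardB n ktP ryB
  (_ : `|Num.max c (Num.max y (clip_reward s t))| <= B).
rewrite mulr0 le_max lexx orbT => /(_ _ isT).
have := sup_reward_ge_acc rewardB ktP cB.
move=> ? h; have : `|Num.max c (Num.max y (clip_reward s t))| <= B
  by case: (leP c _).
by move=> /h; lra.
Qed.

Lemma acc_bounded_noacc C (F : policy -> S -> R) :
  (forall k s, valid_policy k s -> `|F k s| <= C) ->
    acc_bounded M B C (fun k s _ => F k s).
Proof. by move=> FC k s y kP _; exact: FC. Qed.

Lemma bound_ge0 s : 0 <= B. Proof.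
  by rewrite (le_trans ler01) // (bound_ge1 rewardB s). Qed.

Lemma delay_expectD n C D F G k s :
  (forall k s, valid_policy k s -> `|F k s| <= C) ->
  (forall k s, valid_policy k s -> `|G k s| <= D) -> valid_policy k s ->
  delay_expect n (fun k s => F k s + G k s) k s = delay_expect n F k s +
    delay_expect n G k s.
Proof.
move=> FC GD kP.
apply: (acc_expectD rewardB n (acc_bounded_noacc FC) (acc_bounded_noacc GD) kP).
by rewrite normr0 (bound_ge0 s).
Qed.

Lemma delay_expectZ n C c F k s :
  (forall k s, valid_policy k s -> `|F k s| <= C) -> valid_policy k s ->
  delay_expect n (fun k s => c * F k s) k s = c * delay_expect n F k s.
Proof.
move=> FC kP; apply: (acc_expectZ rewardB n c (acc_bounded_noacc FC) kP).
by rewrite normr0 (bound_ge0 s).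
Qed.


Lemma cvg_ex_lt (u : nat -> R) (l e : R) : u n @[n --> \oo] --> l -> 0 < e ->
  exists n, `|l - u n| < e.
Proof.
move=> ul e0; have /cvgrPdist_lt/(_ _ e0)[n _ nP] := ul.
by exists n; apply: nP => /=.
Qed.

(** [miss_claim] is used at time [n + N], its level [c] being the maximum of the [N] rewards since
    time [n]. The excess over [c] and the deficit below it are small on average, since the limsup,
    the supremum after [n] and the maxima over both windows nearly agree in expectation. *)
Lemma opt_miss e k s delta : 0 < e -> opt_policy k s -> 0 < delta ->
  exists n, miss e n k s <= delta.
Proof.
move=> e0 kO d0.
(* With [e <= 1] and [c >= 1 - B], the start [- B] of the second window satisfies
   [- B <= c - e / 2], as [miss_claim] requires. *)
wlog e1 : e e0 / e <= 1.
  move=> H; have [/H|/ltW e1] := leP e 1; first exact.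
  have [n nP] := H 1 ltr01 (lexx _); exists n; apply: le_trans nP.
  by apply: miss_le_eps => //; case: kO.
have [kP kw] := kO; have LB := base_norm_le rewardB s.
have NB : `|- B| <= B by rewrite normrN ger0_norm // bound_ge0.
(* Three approximations within [x] are combined below, and [4 * x] is [e / 2 * delta]. *)
pose x := delta * e / 8; have x0 : 0 < x by rewrite divr_gt0 // mulr_gt0.
have [n nP] := cvg_ex_lt (tail_value_cvg rewardB kP) x0.
have wwn := policy_value_le_tail rewardB n kP.
pose qL N k s := max_reward N k s (1 - B);
  pose qB N k s := max_reward N k s (- B).
have bqL N k' s' : valid_policy k' s' -> `|qL N k' s'| <= B by move=> k'P;
  exact: max_reward_bounded.
have bqB N k' s' : valid_policy k' s' -> `|qB N k' s'| <= B by move=> k'P;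
  exact: max_reward_bounded.
have bQL k' s' : valid_policy k' s' -> `|sup_reward k' s' (1 - B)| <= B
  by move=> k'P; exact: sup_reward_bounded.
have [|N NP] := @cvg_ex_lt (fun N => delay_expect n (qL N) k s)
  (tail_value n k s) x _ x0.
  apply: (delay_expect_cvg rewardB (C := B)) => // k' s' k'P;
    exact: max_reward_cvg.
have [|m mP] := @cvg_ex_lt (fun m => delay_expect (n + N) (qB m) k s)
  (tail_value (n + N) k s) x _ x0.
  apply: (delay_expect_cvg rewardB (C := B)) => // k' s' k'P;
    rewrite -(sup_reward_base rewardB k'P).
  exact: max_reward_cvg.
have wwnN := policy_value_le_tail rewardB (n + N) kP.
have bmiss k' s' : valid_policy k' s' -> `|miss e m k' s'| <= 1
  by exact: miss_norm_le.
(* [qL] is the expectation of the level [c]. On the other side, [sup_reward] started at [c] averages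
   back to the supremum from [s'], and [max_reward m] started at [c] becomes [max_reward (N + m)]:
   two terms, each at most one supremum. *)
have main : forall k' s', opt_policy k' s' ->
    e / 2 * delay_expect N (miss e m) k' s' + qL N k' s' +
      delay_expect N (qB m) k' s' <=
    2 * sup_reward k' s' (1 - B).
  move=> k' s' k'O; have [k'P _] := k'O.
  have bid : acc_bounded M B B (fun _ _ y => y) by [].
  have bm : acc_bounded M B 1 (fun k s _ => miss e m k s) :=
    acc_bounded_noacc bmiss.
  have bqBm : acc_bounded M B B (fun k s _ => qB m k s) :=
    acc_bounded_noacc (bqB m).
  have bqm : acc_bounded M B B (max_reward m) := max_reward_bounded rewardB m.
  have bQ : acc_bounded M B B sup_reward := sup_reward_bounded rewardB.
  have Z0 : forall F, delay_expect N F k' s' =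
    acc_expect N (fun k s _ => F k s) k' s' (1 - B).
    by move=> F; exact: acc_expect_noacc.
  rewrite !Z0 -(acc_expectZ rewardB N _ bm) //.
  have bem : acc_bounded M B (`|e / 2| * 1) (fun k s _ => e / 2 * miss e m k s).
    move=> k1 s1 y1 k1P _; rewrite normrM ler_wpM2l //; exact: bmiss.
  rewrite /qL /max_reward -(acc_expectD rewardB N bem bid) //.
  have badd C D F G : acc_bounded M B C F -> acc_bounded M B D G ->
      acc_bounded M B (C + D) (fun k s y => F k s y + G k s y).
    move=> FC GD k1 s1 y1 k1P y1B.
    by rewrite (le_trans (ler_normD _ _)) // lerD ?FC ?GD.
  rewrite -(acc_expectD rewardB N (badd _ _ _ _ bem bid) bqBm) //.
  apply: (@le_trans _ _ (acc_expect N
    (fun k s y => sup_reward k s y + max_reward m k s y) k' s' (1 - B))).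
    apply: (@acc_expect_le_inv R S M B rewardB
      (fun k s y => opt_policy k s /\ 1 - B <= y <= B)
        N _ _ _ _ k' s' _ (badd _ _ _ _ (badd _ _ _ _ bem bid) bqBm)
          (badd _ _ _ _ bQ bqm)).
    - move=> k1 s1 y1 t [k1O /andP[Ly yB]] k1t; split;
      first exact: opt_policy_step k1O k1t.
      rewrite le_max Ly ge_max yB /=.
      by have := rewardB s1 t; rewrite ler_norml => ?; lra.
    - move=> k1 s1 y1 [[k1P _] ?]; split => //.
      by have := bound_ge0 s; rewrite ler_norml; lra.
    - move=> k1 s1 y1 [k1O y1L]; have [k1P _] := k1O.
      have y1B : `|y1| <= B by have := bound_ge0 s; rewrite ler_norml; lra.
      have := miss_claim m e0 k1O y1B NB; rewrite /qB max_l; last lra.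
      by move=> H; have := H (or_intror _); lra.
    - by split => //; have := bound_ge1 rewardB s; lra.
  rewrite (acc_expectD rewardB N bQ bqm) // (acc_expect_sup_reward rewardB)
    // -acc_expect_add.
  have := max_reward_le_sup rewardB (N + m) k'P LB; rewrite /max_reward; lra.
have bDm k' s' : valid_policy k' s' -> `|delay_expect N (miss e m) k' s'| <= 1
  by exact: (delay_expect_norm_le rewardB N bmiss).
have bDq k' s' : valid_policy k' s' -> `|delay_expect N (qB m) k' s'| <= B
  by exact: (delay_expect_norm_le rewardB N (bqB m)).
have beD k' s' : valid_policy k' s' ->
  `|e / 2 * delay_expect N (miss e m) k' s'| <= `|e / 2| * 1.
  by move=> ?; rewrite normrM ler_wpM2l // bDm.
have bs1 k' s' : valid_policy k' s' ->
  `|e / 2 * delay_expect N (miss e m) k' s' + qL N k' s'| <= `|e / 2| * 1 + B.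
  by move=> ?; rewrite (le_trans (ler_normD _ _)) // lerD ?beD ?bqL.
have bs2 k' s' : valid_policy k' s' ->
  `|e / 2 * delay_expect N (miss e m) k' s' + qL N k' s' +
   delay_expect N (qB m) k' s'| <= `|e / 2| * 1 + B + B.
  by move=> ?; rewrite (le_trans (ler_normD _ _)) // lerD ?bs1 ?bDq.
have b2Q k' s' : valid_policy k' s' -> `|2 * sup_reward k' s' (1 - B)| <= 2 * B.
  by move=> ?; rewrite normrM ger0_norm // ler_wpM2l // bQL.
have := delay_expect_le_inv rewardB n bs2 b2Q opt_policy_step
  (fun k s => @proj1 _ _) main kO.
rewrite (delay_expectD n bs1 bDq) // (delay_expectD n beD (bqL N)) //
  (delay_expectZ n _ bDm) // (delay_expectZ n _ bQL) //.
rewrite -!delay_expect_add -/(tail_value n) => fin; exists (n + N + m)%N.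
apply: le_trans (miss_delay e (n + N) m kP) _.
move: fin nP NP mP; rewrite !ltr_norml -/(tail_value n k s).
set D := delay_expect (n + N) (miss e m) k s;
  set E := delay_expect n (qL N) k s.
set F := delay_expect (n + N) (qB m) k s =>
  fin /andP[n1 n2] /andP[N1 N2] /andP[m1 m2].
have : e / 2 * D <= 4 * x by lra.
rewrite /x => H; rewrite -(ler_pM2l e0); lra.
Qed.

(** Optional stopping at the first near transition. A run without one in [n] steps costs at most
    [2 * B], since both the value and the supremum lie between [- B] and [B]. *)
Lemma value_miss_le_sup_reward (Inv : policy -> S -> Prop) e n k s y :
  (forall k s t, Inv k s -> 0 < k [::] t -> Inv (after k t) t) ->
  (forall k s, Inv k s -> valid_policy k s /\ wsum (k [::]) opt_value =
    opt_value s) ->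
  0 < e -> Inv k s -> `|y| <= B ->
    opt_value s - e - 2 * B * miss e n k s <= sup_reward k s y.
Proof.
move=> InvS InvP e0; elim: n k s y => [|n IH] k s y I yB;
  have [kP kV] := InvP _ _ I.
  have := sup_reward_bounded rewardB kP yB; have := opt_value_norm_le s;
    rewrite !ler_norml /=; lra.
have bm := miss_bdd e n kP; have kwt := valid_policy_weight kP;
  have kd := valid_policy_dist kP.
rewrite (sup_reward_step rewardB) // -kV /= -wsumZ //.
rewrite -[X in _ - X - _](wsum_cst e kd).
have bVe := bddB opt_value_bdd (@bdd_cst _ S e).
have bmB := bddZ (2 * B) bm.
rewrite -wsumB //; [|exact: opt_value_bdd|exact: bdd_cst]; rewrite -wsumB //.
apply: le_wsum_in => //; [exact: (bddB bVe bmB)|exact: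
  (sup_reward_bdd rewardB)|].
move=> t kt; have ktP := valid_policy_after t kP;
  have ryB := acc_norm_le rewardB s t yB.
case: ifPn => [tg|_]; last by apply: IH => //; exact: InvS I kt.
rewrite mulr0 subr0; apply: le_trans tg _.
by apply: le_trans (sup_reward_ge_acc rewardB ktP ryB);
  rewrite le_max lexx orbT.
Qed.

Lemma value_le_policy_value (Inv : policy -> S -> Prop) k s :
  (forall k s t, Inv k s -> 0 < k [::] t -> Inv (after k t) t) ->
  (forall k s, Inv k s -> valid_policy k s /\ wsum (k [::]) opt_value =
    opt_value s) -> Inv k s ->
  (forall n e delta, 0 < e -> 0 < delta ->
     exists m, delay_expect n (miss e m) k s <= delta) ->
  opt_value s <= policy_value k s.
Proof.
move=> InvS InvP I hit; have [kP _] := InvP _ _ I.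
suff H n : opt_value s <= tail_value n k s.
  apply: (cvg_le (u := fun=> opt_value s)) (tail_value_cvg rewardB kP) => //;
    exact: cvg_cst.
apply/ler_addgt0Pr => e e0; have e20 : 0 < e / 2 by lra.
(* Misses then cost at most [2 * B * (e / (4 * B))], that is [e / 2]; the other half is the
   tolerance of the target. *)
have B1 := bound_ge1 rewardB s; have d0 : 0 < e / (4 * B)
  by rewrite divr_gt0 //; lra.
have [m mP] := hit n _ _ e20 d0.
have bm k' s' : valid_policy k' s' -> `|miss (e / 2) m k' s'| <= 1
  by exact: miss_norm_le.
have bV k' s' : valid_policy k' s' -> `|opt_value s'| <= B by move=> _;
  exact: opt_value_norm_le.
have bQL k' s' : valid_policy k' s' -> `|sup_reward k' s' (1 - B)| <= B.
  by move=> k'P; apply: (sup_reward_bounded rewardB k'P);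
    exact: (base_norm_le rewardB s').
have bmm k' s' : valid_policy k' s' ->
  `|2 * B * miss (e / 2) m k' s'| <= `|2 * B| * 1.
  by move=> ?; rewrite normrM ler_wpM2l // bm.
have be k' s' : valid_policy k' s' -> `|e / 2| <= `|e / 2| by [].
have b1 k' s' : valid_policy k' s' ->
  `|sup_reward k' s' (1 - B) + 2 * B * miss (e / 2) m k' s'| <=
    B + `|2 * B| * 1.
  by move=> ?; rewrite (le_trans (ler_normD _ _)) // lerD ?bQL ?bmm.
have b2 k' s' : valid_policy k' s' ->
  `|sup_reward k' s' (1 - B) + 2 * B * miss (e / 2) m k' s' +
    e / 2| <= B + `|2 * B| * 1 + `|e / 2|.
  by move=> ?; rewrite (le_trans (ler_normD _ _)) // lerD ?b1.
have le : forall k' s', Inv k' s' -> opt_value s' <=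
    sup_reward k' s' (1 - B) + 2 * B * miss (e / 2) m k' s' + e / 2.
  move=> k' s' I'.
  have := value_miss_le_sup_reward m InvS InvP e20 I' (base_norm_le rewardB s');
    lra.
have := delay_expect_le_inv rewardB n bV b2 InvS (fun k s h => (InvP k s h).1)
  le I.
rewrite (delay_expectD n b1 be) // (delay_expectD n bQL bmm) //
  (delay_expectZ n _ bm) // -/(tail_value n k s).
have -> : delay_expect n (fun _ _ => e / 2) k s = e / 2
  by exact: acc_expect_cst.
have -> : delay_expect n (fun=> opt_value) k s = opt_value s.
  elim: n k s I {hit kP mP B1 d0 bm bmm b1 b2 le} => [//|n IH] k s I.
  rewrite delay_expectS; have [_ <-] := InvP _ _ I; apply: eq_wsum_in => t kt.
  have [kP _] := InvP _ _ I; have [k0 _ _] := valid_policy_dist kP.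
  by apply: IH; apply: (InvS _ _ _ I); rewrite lt_def kt k0.
have : 2 * B * delay_expect n (miss (e / 2) m) k s <= e / 2.
  rewrite [leRHS](_ : _ = 2 * B * (e / (4 * B))); last first.
    have : B != 0 by apply: lt0r_neq0; lra.
    by move=> ?; field.
  by rewrite ler_wpM2l //; lra.
lra.
Qed.

End optimal_value.

(** * Partially fixed memoryless choices *)

Section memoryless.
Context {R : realType} {S : countType} (M : mdp R S) (B : R).
Hypothesis rewardB : forall s t, `|clip_reward M s t| <= B - 1.
Implicit Types (s t x : S) (d : S -> R) (k : @policy R S) (c e y : R).
Implicit Types (a f : S -> S -> R) (D u : S -> R).

Local Notation valid_dist := (valid_dist M).
Local Notation opt_value := (opt_value M B).
Local Notation opt_policy := (opt_policy M B).
Local Notation near_value := (near_value M B).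

Definition attained s := exists k, opt_policy k s.

(** The conditions bind only at attained states: elsewhere every edge qualifies, so admissible
    choices exist everywhere, and yet plays from attained states remain among them. *)
Definition value_preserving s t :=
  [/\ edge M s t, attained s -> attained t & attained s -> controlled M s ->
  opt_value t = opt_value s].

Definition admissible s d := valid_dist s d /\ forall t, 0 < d t ->
  value_preserving s t.

Lemma admissible_dist s d : admissible s d -> is_dist (edge M s) d.
Proof. by move=> [[]]. Qed.

Lemma admissible_weight s d : admissible s d -> weight d.
Proof. by move=> /admissible_dist/dist_weight. Qed.

Lemma admissible_opt k s : opt_policy k s -> admissible s (k [::]).
Proof.
move=> kO; have [kP _] := kO; split; first exact: (kP [::]).
move=> t kt; split.
- exact: dist_supp (valid_policy_dist kP) kt.
- by move=> _; exists (after k t); exact: (opt_policy_step rewardB kO kt).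
- by move=> _ cs; exact: (opt_policy_controlled rewardB kO).
Qed.

Lemma admissible_ex s : exists d, admissible s d.
Proof.
have [[k kO]|nW] := pselect (attained s); first by exists (k [::]);
  exact: admissible_opt.
exists (default_dist M s); have := default_dist_valid M s => dP;
  split => // t dt.
by split => //; exact: dist_supp dP.1 dt.
Qed.

(** At a controlled state the equality holds term by term. At a random state [d] is forced, so the
    equality is borrowed from an optimal policy. *)
Lemma admissible_value s d : admissible s d -> attained s ->
  wsum d opt_value = opt_value s.
Proof.
move=> [[dd dr] dg] Ws; have [cs|ncs] := boolP (controlled M s).
  rewrite -[RHS](wsum_cst (opt_value s) dd); apply: eq_wsum_in => t dt.
  by have [|_ _ ->] := dg t _; rewrite // lt_def dt; case: dd => ->.
have [k kO] := Ws; have [kP _] := kO.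
by rewrite dr // -(opt_policy_opt_value rewardB kO); have [_ ->] := kP [::].
Qed.

(* Sub-kernels describe the part of the choices that is already fixed. *)
Definition subkernel a := forall s, weight (a s) /\ wsum (a s) (fun=> 1) <= 1.

Definition hit_or e u s t := if near_value e s t then 1 else u t.

(** Mass missing from [a s] counts as failure. This makes [hit] monotone in the subkernel, whatever
    is later done with the free probability. *)
Fixpoint hit e n a s : R :=
  if n is n'.+1 then wsum (a s) (hit_or e (hit e n' a) s) else 0.

Lemma hit_or_itv e u s t : (forall t, 0 <= u t <= 1) ->
  0 <= hit_or e u s t <= 1.
Proof. by move=> u01; rewrite /hit_or; case: ifP => // _; rewrite ler01 lexx.
  Qed.

Lemma hit_or_bdd e u s : (forall t, 0 <= u t <= 1) -> bdd (hit_or e u s).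
Proof. by move=> u01; apply: (@bdd_itv _ _ 0 1) => t; exact: hit_or_itv. Qed.

Lemma hit_or_le e u v s t : u t <= v t -> hit_or e u s t <= hit_or e v s t.
Proof. by rewrite /hit_or; case: ifP. Qed.

Lemma wsum_subkernel a s u : subkernel a -> (forall t, 0 <= u t <= 1) ->
  0 <= wsum (a s) u <= wsum (a s) (fun=> 1).
Proof.
move=> commitmentP u01; have [wa _] := commitmentP s.
have bu : bdd u by apply: (@bdd_itv _ _ 0 1).
rewrite wsum_ge0 //=; last by move=> t _; case/andP: (u01 t).
apply: le_wsum_in => //; first exact: bdd_cst.
by move=> t _; case/andP: (u01 t).
Qed.

Lemma hit_itv e n a s : subkernel a -> 0 <= hit e n a s <= 1.
Proof.
move=> commitmentP; elim: n s => [|n IH] s /=; first by rewrite lexx ler01.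
have [_ a1] := commitmentP s;
  have /andP[-> h] := wsum_subkernel s commitmentP (hit_or_itv e s ^~ IH).
exact: le_trans h a1.
Qed.

Lemma hit_le e n a a' s : subkernel a -> subkernel a' ->
  (forall s t, a s t <= a' s t) ->
  hit e n a s <= hit e n a' s.
Proof.
move=> commitmentP a'P aa'; elim: n s => [//|n IH] s /=.
have h01 t : 0 <= hit e n a t <= 1 by exact: hit_itv.
have h01' t : 0 <= hit e n a' t <= 1 by exact: hit_itv.
have [wa _] := commitmentP s; have [wa' _] := a'P s.
apply: (@le_trans _ _ (wsum (a s) (hit_or e (hit e n a') s))).
  apply: le_wsum_in => //; [exact: hit_or_bdd..|].
  by move=> t _; exact: hit_or_le.
apply: le_wsum_weight => //; [|exact: hit_or_bdd|].
  by move=> t; rewrite aa' andbT; case: wa.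
by move=> t; have /andP[] := hit_or_itv e s t h01'.
Qed.

Lemma hit_nd e n m a s : subkernel a -> (n <= m)%N ->
  hit e n a s <= hit e m a s.
Proof.
move=> commitmentP; elim: n m s => [|n IH] m s nm.
  by have /andP[] := hit_itv e m s commitmentP.
case: m nm => // m nm /=; have [wa _] := commitmentP s.
apply: le_wsum_in => //; [by apply: hit_or_bdd => ?; exact: hit_itv..|].
by move=> t _; apply: hit_or_le; exact: IH.
Qed.

Lemma hit_le_eps e e' n a s : subkernel a -> e <= e' ->
  hit e n a s <= hit e' n a s.
Proof.
move=> commitmentP ee'; elim: n s => [//|n IH] s /=;
  have [wa _] := commitmentP s.
apply: le_wsum_in => //; [by apply: hit_or_bdd => ?; exact: hit_itv..|].
move=> t _; rewrite /hit_or /near_value; case: ifP => [r|_]; last first.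
  by case: ifP => // _; have /andP[] := hit_itv e n t commitmentP.
by rewrite ifT //; lra.
Qed.

(** This allows some probability to remain free at almost no loss: [hit] over finitely many steps is
    continuous in the committed fractions, by dominated convergence at each step. *)
Lemma hit_cvg e n (a_ : nat -> S -> S -> R) a f (c_ : nat -> S -> R) D s :
  subkernel a -> (forall s, is_dist (edge M s) (f s)) ->
  (forall i s, 0 <= c_ i s <= D s) ->
  (forall s t, 0 <= a s t) -> subkernel (fun s t => a s t + D s * f s t) ->
  (forall s, c_ i s @[i --> \oo] --> D s) ->
  hit e n (fun s t => a s t + c_ i s * f s t) s @[i --> \oo] -->
  hit e n (fun s t => a s t + D s * f s t) s.
Proof.
move=> commitmentP fd cD a0 aDP ccvg.
have f0 s' t : 0 <= f s' t by case: (fd s').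
have D0 s' : 0 <= D s' by have /andP[h h'] := cD 0%N s'; exact: le_trans h h'.
have wf s' := dist_weight (fd s'); have wa s' := (commitmentP s').1.
have aiP i : subkernel (fun s t => a s t + c_ i s * f s t).
  move=> s'; have /andP[c0 c1] := cD i s'; have le t :
      0 <= a s' t + c_ i s' * f s' t <= a s' t + D s' * f s' t.
    by rewrite addr_ge0 ?mulr_ge0 // lerD2l ler_wpM2r.
  have [w1 m1] := aDP s'; split; first exact: weight_le le w1.
  by apply: le_trans m1; apply: le_wsum_weight => //; exact: bdd_cst.
have split_ c s' u : 0 <= c -> bdd u ->
    wsum (fun t => a s' t + c * f s' t) u = wsum (a s') u + c * wsum (f s') u.
  move=> c0 bu; rewrite wsumDd //; last exact: weightZ.
  by rewrite wsum_dl.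
elim: n s => [|n IH] s /=; first exact: cvg_cst.
have bg i : bdd (hit_or e (hit e n (fun s t => a s t + c_ i s * f s t)) s).
  by apply: hit_or_bdd => t; exact: hit_itv.
have bgD : bdd (hit_or e (hit e n (fun s t => a s t + D s * f s t)) s).
  by apply: hit_or_bdd => t; exact: hit_itv.
rewrite split_ //.
have c0 i : 0 <= c_ i s by case/andP: (cD i s).
under eq_cvg do rewrite (split_ _ _ _ (c0 _) (bg _)).
have gb i t : `|hit_or e (hit e n (fun s t => a s t + c_ i s * f s t)) s t| <=
  1.
  have /andP[? ?] : 0 <= hit_or e (hit e n (fun s t => a s t + c_ i s * f s t))
    s t <= 1.
    by apply: hit_or_itv => ?; exact: hit_itv.
  by rewrite ger0_norm.
have gc t : hit_or e (hit e n (fun s t => a s t + c_ i s * f s t)) s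
  t @[i --> \oo] -->
    hit_or e (hit e n (fun s t => a s t + D s * f s t)) s t.
  by rewrite /hit_or; case: ifP => _; [exact: cvg_cst|exact: IH].
apply: cvgD; first exact: wsum_cvg (wa s) gb gc.
by apply: cvgM => //; exact: wsum_cvg (wf s) gb gc.
Qed.

(* [a s] is the part of the choice at [s] already fixed, [D s] the probability that
   is still free; [D] is [1] outside a finite set. *)
Definition commitment a D := (forall s, [/\ weight (a s), 0 < D s <= 1,
    wsum (a s) (fun=> 1) = 1 - D s,
      (forall t, 0 < a s t -> value_preserving s t) &
    (~~ controlled M s -> forall t, a s t = (1 - D s) * prob M s t)]) /\
  exists K, forall s, D s < 1 -> (pickle s < K)%N.

Lemma commitment_subkernel a D : commitment a D -> subkernel a.
Proof.
move=> [H _] s; have [wa /andP[D0 _] -> _ _] := H s; split=> //.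
by rewrite gerBl ltW.
Qed.

Lemma commitment_mix a D f : commitment a D -> (forall s, admissible s (f s)) ->
  forall s, admissible s (fun t => a s t + D s * f s t).
Proof.
move=> [H _] fA s; have [wa /andP[D0 D1] am ag ar] := H s.
have [[fd fr] fg] := fA s; have [f0 fN _] := fd; have [a0 _] := wa.
have Df0 t : 0 <= D s * f s t by rewrite mulr_ge0 // ltW.
have wDf : weight (fun t => D s * f s t)
  by apply: weightZ (ltW D0) (dist_weight fd).
have gd t : 0 < a s t + D s * f s t -> value_preserving s t.
  move=> pos; have [at0|] := ltP 0 (a s t); first exact: ag.
  move=> at0; apply: fg; rewrite lt_def f0 andbT; apply: contraTneq pos => ->.
  by rewrite mulr0 addr0 -leNgt.
split => //; split; last first.
  move=> nc; apply/funext => t; rewrite ar // fr // -mulrDl subrK mul1r //.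
split.
- by move=> t; rewrite addr_ge0.
- move=> t nt; apply/eqP; rewrite eq_le addr_ge0 // andbT leNgt.
  by apply/negP => /gd[st _ _]; rewrite st in nt.
- transitivity (\esum_(t in [set: S]) ((a s t + D s * f s t) * 1)%:E)%E.
    by apply: eq_esum => t _; rewrite mulr1.
  rewrite -wsum_esum //; [|exact: weightD|exact: bdd_cst].
  rewrite wsumDd //; last exact: bdd_cst.
  rewrite am wsum_dl //; [|exact: dist_weight fd|exact: bdd_cst].
  by rewrite (wsum_cst 1 fd) mulr1 subrK.
Qed.

End memoryless.

(** * Reaching one target under a partial commitment *)

Section reach.
Context {R : realType} {S : countType} (M : mdp R S) (B : R).
Hypothesis rewardB : forall s t, `|clip_reward M s t| <= B - 1.
Implicit Types (s t x : S) (d v : S -> R) (k : @policy R S).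
Implicit Types (f : S -> S -> R) (eta : R).

Local Notation opt_policy := (opt_policy M B).
Local Notation miss := (miss M B).
Local Notation attained := (attained M B).
Local Notation admissible := (admissible M B).
Local Notation value_preserving := (value_preserving M B).
Local Notation commitment := (commitment M B).
Local Notation hit := (hit M B).
Local Notation hit_or := (hit_or M B).

Variables (a : S -> S -> R) (D : S -> R) (e : R).
Hypothesis aD : commitment a D.
Hypothesis e0 : 0 < e.

Definition best_hit v s := sup [set wsum d (hit_or e v s) | d in admissible s].

(** Value iteration for the best chance of hitting the [e]-target: the committed part is imposed,
    the free part is optimised over admissible choices, by a supremum that need not be attained. *)
Fixpoint reach_iter n s : R :=
  if n is n'.+1 then wsum (a s) (hit_or e (reach_iter n') s) +
    D s * best_hit (reach_iter n') s else 0.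

Lemma best_hit_has_sup v s : (forall t, 0 <= v t <= 1) ->
  has_sup [set wsum d (hit_or e v s) | d in admissible s].
Proof.
move=> v01; split.
  by have [d dA] := admissible_ex rewardB s; exists (wsum d (hit_or e v s)), d.
exists 1 => _ [d dA <-]; apply: (wsum_le (admissible_dist dA));
  first exact: hit_or_bdd.
by move=> t _; have /andP[] := hit_or_itv M B e s t v01.
Qed.

Lemma best_hit_ge v s d : (forall t, 0 <= v t <= 1) -> admissible s d ->
  wsum d (hit_or e v s) <= best_hit v s.
Proof. by move=> v01 dA; apply: sup_upper_bound;
  [exact: best_hit_has_sup|exists d]. Qed.

Lemma best_hit_itv v s : (forall t, 0 <= v t <= 1) -> 0 <= best_hit v s <= 1.
Proof.
move=> v01; apply/andP; split.
  have [d dA] := admissible_ex rewardB s; apply: le_trans (best_hit_ge v01 dA).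
  apply: (wsum_ge0 (admissible_weight dA)); first exact: hit_or_bdd.
  by move=> t _; have /andP[] := hit_or_itv M B e s t v01.
apply: ge_sup; first by have [] := best_hit_has_sup s v01.
move=> _ [d dA <-]; apply: (wsum_le (admissible_dist dA));
  first exact: hit_or_bdd.
by move=> t _; have /andP[] := hit_or_itv M B e s t v01.
Qed.

Lemma best_hit_le v v' s : (forall t, 0 <= v t <= 1) ->
  (forall t, 0 <= v' t <= 1) ->
  (forall t, v t <= v' t) -> best_hit v s <= best_hit v' s.
Proof.
move=> v01 v'01 vv'; apply: ge_sup; first by have [] := best_hit_has_sup s v01.
move=> _ [d dA <-]; apply: le_trans (best_hit_ge v'01 dA).
apply: le_wsum_in; [exact: admissible_weight dA|exact: hit_or_bdd..|].
by move=> t _; exact: hit_or_le.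
Qed.

Lemma commitmentP s : [/\ weight (a s), 0 < D s,
  D s <= 1 & wsum (a s) (fun=> 1) = 1 - D s].
Proof. by have [H _] := aD; have [? /andP[? ?] ? _ _] := H s. Qed.

Lemma reach_iter_itv n s : 0 <= reach_iter n s <= 1.
Proof.
elim: n s => [|n IH] s /=; first by rewrite lexx ler01.
have [wa D0 D1 am] := commitmentP s; have /andP[b0 b1] := best_hit_itv s IH.
have /andP[] := wsum_subkernel s (commitment_subkernel aD)
  (hit_or_itv M B e s ^~ IH).
rewrite am => h0 h1; have : D s * best_hit (reach_iter n) s <= D s * 1
  by rewrite ler_wpM2l // ltW.
have : 0 <= D s * best_hit (reach_iter n) s by rewrite mulr_ge0 // ltW.
lra.
Qed.

Lemma reach_iter_nd s : nondecreasing_seq (fun n => reach_iter n s).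
Proof.
apply/nondecreasing_seqP => n; elim: n s => [|n IH] s.
  by have /andP[] := reach_iter_itv 1 s.
have [wa D0 D1 am] := commitmentP s; rewrite /= -/(reach_iter n.+1);
  apply: lerD.
  apply: le_wsum_in => //; [by apply: hit_or_bdd => t;
    exact: reach_iter_itv..|].
  by move=> t _; exact/hit_or_le/IH.
rewrite ler_wpM2l //; first exact: ltW.
by apply: best_hit_le => t;
  [exact: reach_iter_itv|exact: reach_iter_itv|exact: IH].
Qed.

Definition reach_value s := limn (fun n => reach_iter n s).

Lemma reach_iter_cvg s : reach_iter n s @[n --> \oo] --> reach_value s.
Proof.
apply: nondecreasing_is_cvgn; first exact: reach_iter_nd.
by exists 1 => _ [n _ <-]; have /andP[] := reach_iter_itv n s.
Qed.

Lemma reach_value_itv s : 0 <= reach_value s <= 1.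
Proof.
apply/andP; split.
  apply: (@cvg_le _ (fun=> 0) (fun n => reach_iter n s));
    last exact: reach_iter_cvg.
    by move=> n; have /andP[] := reach_iter_itv n s.
  exact: cvg_cst.
apply: (@cvg_le _ (fun n => reach_iter n s) (fun=> 1)); last exact: cvg_cst.
  by move=> n; have /andP[] := reach_iter_itv n s.
exact: reach_iter_cvg.
Qed.

Lemma hit_or_reach_iter_cvg s t : hit_or e (reach_iter n) s t @[n --> \oo] -->
  hit_or e reach_value s t.
Proof. by rewrite /hit_or; case: ifP => _;
  [exact: cvg_cst|exact: reach_iter_cvg]. Qed.

Lemma reach_value_super s d : admissible s d ->
  wsum (a s) (hit_or e reach_value s) + D s * wsum d (hit_or e reach_value s) <=
    reach_value s.
Proof.
move=> dA; have [wa D0 D1 am] := commitmentP s; have wd := admissible_weight dA.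
have gb n t : `|hit_or e (reach_iter n) s t| <= 1.
  have /andP[? ?] : 0 <= hit_or e (reach_iter n) s t <= 1
    by apply: hit_or_itv => ?; exact: reach_iter_itv.
  by rewrite ger0_norm.
have c1 := wsum_cvg wa gb (@hit_or_reach_iter_cvg s);
  have c2 := wsum_cvg wd gb (@hit_or_reach_iter_cvg s).
have vS : reach_iter n.+1 s @[n --> \oo] --> reach_value s.
  by rewrite (cvg_shiftS (fun n => reach_iter n s)); exact: reach_iter_cvg.
apply: cvg_le (cvgD c1 (cvgM (cvg_cst (D s)) c2)) vS => n /=.
rewrite lerD2l ler_wpM2l //; first exact: ltW.
by apply: best_hit_ge => // t; exact: reach_iter_itv.
Qed.

(** The initial [1], an upper bound of all reaching values, serves as the minimum as long as no
    attained state with code below [K] falls short of it. *)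
Lemma reach_value_min K : exists m : R, [/\ 0 <= m <= 1,
  forall s, attained s -> (pickle s < K)%N -> m <= reach_value s &
  m = 1 \/ exists2 s, attained s & reach_value s = m].
Proof.
elim: K => [|K [m [/andP[m0 m1] mle mex]]].
  by exists 1; split; [rewrite ler01 lexx|move=> s _; rewrite ltn0|left].
have [[x [Wx xK xm]]|nx] :=
  pselect (exists x, [/\ attained x, pickle x = K & reach_value x < m]).
  exists (reach_value x); split; [exact: reach_value_itv| |by right; exists x].
  move=> s Ws; rewrite ltnS leq_eqVlt => /predU1P[sK|sK].
    have -> : s = x by apply: (pcan_inj pickleK_inv); rewrite sK xK.
    exact: lexx.
  by rewrite (le_trans (ltW xm)) // mle.
exists m; split => //; first by rewrite m0.
move=> s Ws; rewrite ltnS leq_eqVlt => /predU1P[sK|sK]; last exact: mle.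
by rewrite leNgt; apply/negP => sm; apply: nx; exists s.
Qed.

(* A minimum [m < 1] of the reaching probability over the finitely many constrained
   states would be its minimum overall, and the states attaining it would form a
   trap from which no target is ever hit. *)
Lemma reach_value_eq1 s : attained s -> reach_value s = 1.
Proof.
move=> Ws; have [_ [K DK]] := aD.
have [m [/andP[m0 m1] mle mex]] := reach_value_min K.
have gRb s' : bdd (hit_or e reach_value s') by apply: hit_or_bdd => t;
  exact: reach_value_itv.
(* An optimal policy is followed until the first constrained state, where [m] is guaranteed; the
   loss below [m] is at most the probability that it misses the target. *)
have key n k s' : opt_policy k s' -> m - miss e n k s' <= reach_value s'.
  elim: n k s' => [|n IH] k s' kO /=.
    by have /andP[r0 _] := reach_value_itv s'; lra.
  have [kP _] := kO; have [wa D0 D1 am] := commitmentP s'.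
  have [sK|Ks] := ltP (D s') 1.
    have mr : m <= reach_value s' by apply: mle; [exists k|exact: DK].
    by have /andP[] := miss_itv B e n.+1 kP; rewrite /=; lra.
  have D1' : D s' = 1 by apply/eqP; rewrite eq_le D1.
  apply: le_trans (reach_value_super (admissible_opt rewardB kO)).
  have : 0 <= wsum (a s') (hit_or e reach_value s').
    by have /andP[] := wsum_subkernel s' (commitment_subkernel aD)
      (hit_or_itv M B e s' ^~ reach_value_itv).
  rewrite D1' mul1r => ?; apply:
    (@le_trans _ _ (wsum (k [::]) (hit_or e reach_value s'))); last lra.
  have kd := valid_policy_dist kP; have wk := valid_policy_weight kP.
  rewrite -[m](wsum_cst m kd) -wsumB //; [|exact: bdd_cst|exact: miss_bdd].
  apply: le_wsum_in => //; first by apply: bddB;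
    [exact: bdd_cst|exact: miss_bdd].
  move=> t kt; rewrite /hit_or; case: ifP => _; first by rewrite subr0.
  by apply: IH; exact: (opt_policy_step rewardB kO kt).
have mr s' : attained s' -> m <= reach_value s'.
  move=> [k kO]; apply/ler_addgt0Pr => d d0.
  have [n nP] := opt_miss rewardB e0 kO d0.
  by have := key n k s' kO; lra.
have [m1'|] := eqVneq m 1.
  by apply/eqP; rewrite eq_le -{2}m1' mr // andbT;
    have /andP[] := reach_value_itv s.
move=> mN1; exfalso; have mlt1 : m < 1 by rewrite lt_neqAle mN1.
(* The committed part averages values at least [m], so the free part, of positive weight [D s'],
   averages at most [m] when it follows [k]. Its values are also at least [m], hence equal to [m] on
   the support. As [m < 1], no target is hit and the successor is minimal again. *)
have stuck n k s' : opt_policy k s' -> reach_value s' = m -> miss e n k s' = 1.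
  elim: n k s' => [//|n IH] k s' kO sm /=.
  have [kP _] := kO; have [wa D0 D1 am] := commitmentP s';
    have kd := valid_policy_dist kP.
  have Ws' : attained s' by exists k.
  have gm t : value_preserving s' t -> m <= hit_or e reach_value s' t.
    by move=> [_ /(_ Ws') Wt _]; rewrite /hit_or; case: ifP => _ //; exact: mr.
  have kg : wsum (k [::]) (hit_or e reach_value s') <= m.
    have := reach_value_super (admissible_opt rewardB kO); rewrite sm.
    have : (1 - D s') * m <= wsum (a s') (hit_or e reach_value s').
      rewrite -am mulrC -wsumZ //; last exact: bdd_cst.
      apply: le_wsum_in => //; first exact: (bddZ m (@bdd_cst _ S 1)).
      have [H _] := aD; have [_ _ _ ag _] := H s'.
      by move=> t /ag; rewrite mulr1; exact: gm.
    move=> h1 h2; rewrite -(ler_pM2l D0); lra.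
  have [_ kgood] := admissible_opt rewardB kO.
  have kmin t : 0 < k [::] t -> hit_or e reach_value s' t = m.
    move=> kt; apply/eqP; rewrite -eqr_opp; apply/eqP.
    apply: (@wsum_eq_max _ _ _ _ (fun t => - hit_or e reach_value s' t) (- m)
      kd) => //.
    - by have := bddZ (-1) (gRb s'); under eq_fun do rewrite mulN1r.
    - by move=> u /kgood/gm; rewrite lerN2.
    - have -> : wsum (k [::]) (fun t => - hit_or e reach_value s' t) =
          -1 * wsum (k [::]) (hit_or e reach_value s').
        rewrite -wsumZ //; last exact: valid_policy_weight kP.
        by apply: eq_wsum_in => ? _; rewrite mulN1r.
      by lra.
  rewrite -[RHS](wsum_cst 1 kd); apply: eq_wsum_in => t kt0.
  have kt : 0 < k [::] t by rewrite lt_def kt0; case: kd => ->.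
  have := kmin t kt; rewrite /hit_or; case: ifP => _ E; first
    by rewrite -E ltxx in mlt1.
  by apply: IH => //; exact: (opt_policy_step rewardB kO kt).
case: mex => [E|[x [k kO] xm]]; first by rewrite E eqxx in mN1.
have d0 : 0 < (1 / 2 : R) by lra.
have [n nP] := opt_miss rewardB e0 kO d0.
by move: nP; rewrite stuck //; lra.
Qed.

Lemma bernoulli_le n (h : R) : 0 <= h <= 1 -> 1 - n%:R * h <= (1 - h) ^+ n.
Proof.
move=> /andP[h0 h1]; elim: n => [|n IH]; first by rewrite mul0r subr0 expr0.
rewrite exprS; have h1' : 0 <= 1 - h by lra.
have := ler_wpM2l h1' IH; apply: le_trans.
rewrite -natr1; have : 0 <= n%:R * h * h by rewrite !mulr_ge0.
lra.
Qed.

(* Discounting: [l ^+ n * reach_iter n] are lower bounds on the [l]-discounted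
   value, so their supremum [dv] satisfies a Bellman inequality with contraction factor
   [l], which is what makes a memoryless choice nearly optimal. *)
Lemma memoryless_near_opt x eta : attained x -> 0 < eta -> exists f,
  (forall s, admissible s (f s)) /\
  exists n, 1 - eta < hit e n (fun s t => a s t + D s * f s t) x.
Proof.
move=> Wx eta0; wlog eta1 : eta eta0 / eta <= 1.
  move=> H; have [/H|/ltW e1] := leP eta 1; first exact.
  have [f [fA [n nP]]] := H 1 ltr01 (lexx _); exists f; split => //; exists n.
  by apply: le_lt_trans nP; lra.
(* Four losses of [h]: two factors [1 - h], from stopping at [n0] and from discounting, one term for
   suboptimal choices and one for the remainder [l ^+ n]. *)
pose h := eta / 4; have hE : h = eta / 4 by []; clearbody h.
have h0 : 0 < h by lra.
have h14 : h <= 1 / 4 by lra.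
have vx : reach_iter n x @[n --> \oo] --> (1 : R)
  by rewrite -(reach_value_eq1 Wx); exact: reach_iter_cvg.
have [n0 n0P] := cvg_ex_lt vx h0.
have [N [N1 n0N]] : exists N : R, 1 <= N /\ n0%:R <= N.
  by exists n0.+1%:R; rewrite ler1n ler_nat leqnSn.
have Np : 0 < N by lra.
(* The factor [l = 1 - hN] is so close to [1] that [n0] steps of discounting lose at most
   [n0 * hN <= h], by Bernoulli's inequality. *)
pose hN := h / N; have hN0 : 0 < hN by rewrite divr_gt0.
have hN1 : hN <= h by rewrite ler_pdivrMr // ler_peMr // ltW.
have n0hN : n0%:R * hN <= h
  by rewrite /hN mulrCA ler_piMr ?(ltW h0) // ler_pdivrMr // mul1r.
clearbody hN; pose l := 1 - hN; have lE : l = 1 - hN by []; clearbody l.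
have l01 : 0 < l < 1 by apply/andP; rewrite lE; split; lra.
have /andP[l0 l1] := l01.
have ln0 : 1 - h <= l ^+ n0.
  by rewrite lE; apply: le_trans (bernoulli_le n0 _); lra.
pose vs s := [set l ^+ n * reach_iter n s | n in [set: nat]].
have ln1 n : 0 <= l ^+ n <= 1 by rewrite exprn_ge0 ?exprn_ile1 // ltW.
have lv01 n s : 0 <= l ^+ n * reach_iter n s <= 1.
  have /andP[? ?] := ln1 n; have /andP[? ?] := reach_iter_itv n s.
  by rewrite mulr_ge0 //= mulr_ile1.
have vsup s : has_sup (vs s).
  split; first by exists (l ^+ 0 * reach_iter 0 s), 0%N.
  by exists 1 => _ [n _ <-]; have /andP[] := lv01 n s.
pose dv s := sup (vs s).
have dv_ge n s : l ^+ n * reach_iter n s <= dv s.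
  by apply: sup_upper_bound => //; exists n.
have dv01 s : 0 <= dv s <= 1.
  apply/andP; split; first by have := dv_ge 0%N s; rewrite /= mulr0.
  apply: ge_sup; first by have [] := vsup s.
  by move=> _ [n _ <-]; have /andP[] := lv01 n s.
(* An error [kappa] at every step, discounted by [l], sums to [kappa / (1 - l) = h]. *)
pose kappa := (1 - l) * h; have kE : kappa = (1 - l) * h by [];
  have k0 : 0 < kappa by rewrite mulr_gt0 // subr_gt0.
clearbody kappa.
have choose_f s : exists d, admissible s d /\
    dv s <= l * (wsum (a s) (hit_or e dv s) + D s * wsum d (hit_or e dv s)) +
      kappa.
  have [wa D0 D1 am] := commitmentP s; have k20 : 0 < kappa / 2 by lra.
  have wg0 v : (forall t, 0 <= v t <= 1) -> 0 <= wsum (a s) (hit_or e v s).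
    move=> v01.
    by have /andP[] := wsum_subkernel s (commitment_subkernel aD)
      (hit_or_itv M B e s ^~ v01).
  have [_ [[|n] _ <-] nP] := sup_adherent k20 (vsup s); rewrite -/(dv s) in nP.
    (* Index [0] contributes [0], so [dv s] is below [kappa / 2] and any admissible choice is good
       enough. *)
    have [d dA] := admissible_ex rewardB s; exists d; split => //.
    move: nP; rewrite /= mulr0 => nP.
    have : 0 <= wsum d (hit_or e dv s).
      apply: (wsum_ge0 (admissible_weight dA)); first exact: hit_or_bdd.
      by move=> t _; have /andP[] := hit_or_itv M B e s t dv01.
    move=> d0; have := wg0 dv dv01 => a0.
    have : 0 <= l * (wsum (a s) (hit_or e dv s) + D s * wsum d (hit_or e dv s)).
      by rewrite mulr_ge0 ?(ltW l0) // addr_ge0 // mulr_ge0 // ltW.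
    lra.
  have [_ [d dA <-] dP] := sup_adherent k20
    (best_hit_has_sup s (reach_iter_itv n)).
  exists d; split => //; move: nP;
    rewrite /= -/(best_hit (reach_iter n) s) in dP *.
  move=> nP; have wd := admissible_weight dA; have /andP[ln0' ln1'] := ln1 n.
  have gle t : l ^+ n * hit_or e (reach_iter n) s t <= hit_or e dv s t.
    by rewrite /hit_or; case: ifP => _; rewrite ?mulr1 ?dv_ge.
  have bv : bdd (hit_or e (reach_iter n) s) by apply: hit_or_bdd;
    exact: reach_iter_itv.
  have bd : bdd (hit_or e dv s) by apply: hit_or_bdd.
  have ha : l ^+ n * wsum (a s) (hit_or e (reach_iter n) s) <=
    wsum (a s) (hit_or e dv s).
    by rewrite -wsumZ //; apply: le_wsum_in => //; exact: bddZ.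
  have hd : l ^+ n * wsum d (hit_or e (reach_iter n) s) <=
    wsum d (hit_or e dv s).
    by rewrite -wsumZ //; apply: le_wsum_in => //; exact: bddZ.
  have hb : l ^+ n * best_hit (reach_iter n) s <= wsum d (hit_or e dv s) +
    kappa / 2.
    have : l ^+ n * best_hit (reach_iter n) s <=
      l ^+ n * (wsum d (hit_or e (reach_iter n) s) + kappa / 2).
      by rewrite ler_wpM2l //; lra.
    have : l ^+ n * (kappa / 2) <= kappa / 2 by rewrite ler_piMl // ltW.
    lra.
  have hD : D s * (l ^+ n * best_hit (reach_iter n) s) <=
    D s * wsum d (hit_or e dv s) + kappa / 2.
    have : D s * (l ^+ n * best_hit (reach_iter n) s) <=
      D s * (wsum d (hit_or e dv s) + kappa / 2).
      by rewrite ler_wpM2l // ltW.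
    have : D s * (kappa / 2) <= kappa / 2 by rewrite ler_piMl // ltW.
    lra.
  have : l * (l ^+ n * wsum (a s) (hit_or e (reach_iter n) s) +
    D s * (l ^+ n * best_hit (reach_iter n) s)) <=
      l * (wsum (a s) (hit_or e dv s) + D s * wsum d (hit_or e dv s) +
        kappa / 2).
    by rewrite ler_wpM2l ?(ltW l0) //; lra.
  have : l * (kappa / 2) <= kappa / 2 by rewrite ler_piMl // ltW.
  move: nP; rewrite exprS; lra.
have [f fP] := choice choose_f; have fA s := (fP s).1.
exists f; split => //.
pose phi s t := a s t + D s * f s t.
have phiA s : admissible s (phi s) by exact: commitment_mix.
have phiS : subkernel phi.
  move=> s; split; first exact: admissible_weight (phiA s).
  by rewrite (wsum_cst 1 (admissible_dist (phiA s))).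
have phi_wsum s u : bdd u -> wsum (phi s) u = wsum (a s) u + D s * wsum (f s) u.
  move=> bu; have [wa D0 D1 am] := commitmentP s;
    have wf := admissible_weight (fA s).
  rewrite wsumDd //; last exact: weightZ (ltW D0) wf.
  by rewrite wsum_dl //; case: wf.
have phi_hit n s : 0 <= hit e n phi s <= 1 by exact: hit_itv.
have main n s : dv s - h - l ^+ n <= hit e n phi s.
  elim: n s => [|n IH] s /=.
    by rewrite expr0; have /andP[_ ?] := dv01 s; lra.
  have [_ fs] := fP s; rewrite -phi_wsum in fs; last exact: hit_or_bdd.
  have wp := admissible_weight (phiA s); have pd := admissible_dist (phiA s).
  have bg : bdd (hit_or e (hit e n phi) s) by exact: hit_or_bdd.
  have /andP[ln0' _] := ln1 n.
  have : wsum (phi s) (hit_or e dv s) <=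
    wsum (phi s) (hit_or e (hit e n phi) s) + (h + l ^+ n).
    rewrite -[X in _ <= _ + X](wsum_cst (h + l ^+ n) pd) -wsumD //;
      last exact: bdd_cst.
    apply: le_wsum_in => //; [exact: hit_or_bdd|exact:
      (bddD bg (@bdd_cst _ S _))|].
    move=> t _; rewrite /hit_or; case: ifP => _; last by have := IH t; lra.
    by lra.
  move=> H; have := ler_wpM2l (ltW l0) H.
  have : l * wsum (phi s) (hit_or e (hit e n phi) s) <=
    wsum (phi s) (hit_or e (hit e n phi) s).
    rewrite ler_piMl ?(ltW l1) //; apply: wsum_ge0 => // t _.
    by have /andP[] := hit_or_itv M B e s t (phi_hit n).
  rewrite exprS kE in fs *; lra.
have [|n nP] := @cvg_ex_lt _ (fun n => l ^+ n) 0 h _ h0.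
  by apply: cvg_expr; rewrite ger0_norm // ltW.
exists n; have := main n x; have := dv_ge n0 x.
move: nP n0P; rewrite !ltr_norml => /andP[nP _] /andP[_ n0P].
have : (1 - h) * (1 - h) <= l ^+ n0 * reach_iter n0 x.
  by apply: ler_pM => //; lra.
have : 0 <= h * h by rewrite mulr_ge0 // ltW.
rewrite -/phi; lra.
Qed.

End reach.

(** * Successive commitments and their limit *)

Section limit_kernel.
Context {R : realType} {S : countType} (M : mdp R S) (B : R).
Hypothesis rewardB : forall s t, `|clip_reward M s t| <= B - 1.
Implicit Types (s t x : S) (d v : S -> R) (k : @policy R S).
Implicit Types (a f : S -> S -> R) (D : S -> R) (e eta : R).

Local Notation attained := (attained M B).
Local Notation admissible := (admissible M B).
Local Notation value_preserving := (value_preserving M B).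
Local Notation commitment := (commitment M B).
Local Notation hit := (hit M B).

Lemma admissible_exf : exists f, forall s, admissible s (f s).
Proof. by have [f fP] := choice (admissible_ex rewardB); exists f. Qed.

Lemma cvg_mul_onem_geometric (x : R) : x * (1 - 2^-1 ^+ i) @[i --> \oo] --> x.
Proof.
have h : `|2^-1 : R| < 1 by rewrite ger0_norm; lra.
have := @cvgM _ _ _ _ (fun=> x) (fun i => 1 - (2^-1 : R) ^+ i) x (1 - 0).
rewrite subr0 mulr1; apply; first exact: cvg_cst.
rewrite -[X in _ --> X](subr0 (1 : R)).
by apply: cvgB; [exact: cvg_cst|exact: cvg_expr].
Qed.

(** A near-optimal completion [f] is committed on the states of code below [i], up to the fraction
    [1 - 2^-1 ^+ i] of what is free. By [hit_cvg], a large [i] keeps the hitting probability above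
    [1 - eta]. Halving on the first [K0] states serves to exhaust the freedom in the limit. *)
Lemma commitment_extend a D x e eta K0 : commitment a D -> 0 < e -> 0 < eta ->
  exists (a' : S -> S -> R) (D' : S -> R),
    [/\ commitment a' D', forall s t, a s t <= a' s t,
    forall s, D' s <= D s, forall s, (pickle s < K0)%N -> D' s <= D s / 2 &
    attained x -> exists n, 1 - eta < hit e n a' x].
Proof.
move=> aD e0 eta0; have [H [K DK]] := aD.
have [f [fA fhit]] : exists f,
  (forall s, admissible s (f s)) /\ (attained x -> exists n,
    1 - eta < hit e n (fun s t => a s t + D s * f s t) x).
  have [Wx|nWx] := pselect (attained x).
    by have [f [? ?]] := memoryless_near_opt rewardB aD e0 Wx eta0; exists f.
  by have [f ?] := admissible_exf; exists f.
pose c_ (i : nat) s := if (pickle s < i)%N then D s * (1 - 2^-1 ^+ i) else 0.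
have D0 s : 0 < D s by have [_ /andP[]] := H s.
have D1 s : D s <= 1 by have [_ /andP[]] := H s.
have half i : 0 < (2^-1 : R) ^+ i <= 1.
  by rewrite exprn_gt0 ?exprn_ile1 ?invr_ge0 ?invf_le1 ?invr_gt0 // ler1n.
have cD i s : 0 <= c_ i s < D s.
  rewrite /c_; case: ifP => _; last by rewrite lexx D0.
  have /andP[h0 h1] := half i; rewrite mulr_ge0 ?subr_ge0 //; last exact: ltW.
  by rewrite gtr_pMr // gtrBl.
have ccvg s : c_ i s @[i --> \oo] --> D s.
  apply: (cvg_trans _ (@cvg_mul_onem_geometric (D s))); apply: near_eq_cvg.
  near=> i; rewrite /c_ ifT //; near: i.
  by exists (pickle s).+1 => // i /=.
pose a_ i s t := a s t + c_ i s * f s t; pose D_ i s := D s - c_ i s.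
have fd s := admissible_dist (fA s).
have f0 s t : 0 <= f s t by case: (fd s).
have a0 s t : 0 <= a s t by have [[a0 _] _ _ _ _] := H s.
have aS := commitment_subkernel aD.
have c0 i s : 0 <= c_ i s by case/andP: (cD i s).
have aiC i : commitment (a_ i) (D_ i).
  split; last first.
    exists (maxn K i) => s; rewrite /D_ /c_ leq_max.
    case: ifP => [_|_]; first by rewrite orbT.
    by rewrite subr0 => /DK ->.
  move=> s; have [wa _ am ag ar] := H s; have [_ cD'] := andP (cD i s).
  split.
  - by apply: weightD => //; apply: weightZ => //; exact: dist_weight (fd s).
  - by rewrite /D_ subr_gt0 cD' lerBlDr (le_trans (D1 s)) // lerDl.
  - rewrite /a_ wsumDd //; [|exact: weightZ
    (dist_weight (fd s))|exact: bdd_cst].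
    rewrite wsum_dl //; [|exact: dist_weight (fd s)|exact: bdd_cst].
    by rewrite am (wsum_cst 1 (fd s)) /D_ mulr1; lra.
  - move=> t; rewrite /a_; have [at0 _|] := ltP 0 (a s t); first exact: ag.
    move=> at0 pos; have [_ fg] := fA s; apply: fg; rewrite lt_def f0 andbT.
    by apply: contraTneq pos => ->; rewrite mulr0 addr0 -leNgt.
  - move=> nc t; rewrite /a_ ar //; have [[_ fr] _] := fA s.
    by rewrite fr // /D_; lra.
have aile i s t : a s t <= a_ i s t by rewrite lerDl mulr_ge0.
have Dile i s : D_ i s <= D s by rewrite gerBl.
have mixS : subkernel (fun s t => a s t + D s * f s t).
  move=> s; have dA := commitment_mix aD fA s; split;
    first exact: admissible_weight dA.
  by rewrite (wsum_cst 1 (admissible_dist dA)).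
have Dhalf i s : (0 < i)%N -> (pickle s < i)%N -> D_ i s <= D s / 2.
  move=> i0 si; rewrite /D_ /c_ si.
  have : D s * 2^-1 ^+ i <= D s * 2^-1.
    rewrite ler_wpM2l ?(ltW (D0 s)) // -[leRHS]expr1.
    by rewrite ler_wiXn2l // ?invr_ge0 ?invf_le1 // ler1n.
  lra.
have [Wx|nWx] := pselect (attained x); last first.
  exists (a_ K0.+1), (D_ K0.+1); split => // s sK.
  by apply: Dhalf => //; exact: ltnW.
have [n nP] := fhit Wx.
have hc : hit e n (a_ i) x @[i --> \oo] -->
  hit e n (fun s t => a s t + D s * f s t) x.
  apply: hit_cvg => // i s.
  by have /andP[-> /ltW ->] := cD i s.
have gap : 0 < hit e n (fun s t => a s t + D s * f s t) x - (1 - eta) by lra.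
have /cvgrPdist_lt/(_ _ gap)[i0 _ i0P] := hc.
pose i := maxn i0 K0.+1.
exists (a_ i), (D_ i); split => //.
  move=> s sK; apply: Dhalf; first by rewrite leq_max orbT.
  by rewrite leq_max ltnS (ltnW sK) orbT.
move=> _; exists n; have := i0P i (leq_maxl _ _).
by rewrite /= ltr_norml => /andP[_]; lra.
Unshelve. all: by end_near.
Qed.


Lemma wsum1_esum d : weight d ->
  (wsum d (fun=> 1))%:E = (\esum_(t in [set: S]) (d t)%:E)%E.
Proof.
move=> wd; rewrite wsum_esum //; last exact: bdd_cst.
by apply: eq_esum => t _; rewrite mulr1.
Qed.

(** A form of Fatou's lemma: finite partial sums pass to the limit. *)
Lemma weight_limit (d_ : nat -> S -> R) d :
  (forall j, weight (d_ j)) -> (forall j, wsum (d_ j) (fun=> 1) <= 1) ->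
  (forall t, d_ j t @[j --> \oo] --> d t) ->
  weight d /\ wsum d (fun=> 1) <= 1.
Proof.
move=> wd m1 dcvg; have d0 t : 0 <= d t.
  apply: (@cvg_le _ (fun=> 0) (fun j => d_ j t)) => //; last exact: cvg_cst.
  by move=> j; have [] := wd j.
have n0 h : (forall t, 0 <= h t) -> forall i,
  (0 <= (natext (h : S -> R) i)%:E)%E.
  by move=> h0 i; rewrite lee_fin /natext; case: pickle_inv => /=.
suff le1 : (\esum_(t in [set: S]) (d t)%:E <= 1)%E.
  have wdd : weight d by split=> //; apply: le_lt_trans le1 _; exact: ltry.
  by split=> //; rewrite -lee_fin wsum1_esum.
rewrite esum_natext //; apply: lime_le.
  by apply: is_cvg_nneseries => i _ _; exact: n0.
apply: nearW => n; rewrite sumEFin lee_fin.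
apply: (@cvg_le _ (fun j => \sum_(0 <= i < n) natext (d_ j) i) (fun=> 1));
  last exact: cvg_cst.
  move=> j; apply: le_trans (m1 j); rewrite -lee_fin wsum1_esum //.
  have [dj0 _] := wd j; rewrite esum_natext // -sumEFin.
  by apply: nneseries_lim_ge => i _ _; exact: n0.
elim: n => [|n IH].
  rewrite big_geq //; under eq_cvg do rewrite big_geq //; exact: cvg_cst.
rewrite big_nat_recr //=; under eq_cvg do rewrite big_nat_recr //=.
apply: cvgD => //; rewrite /natext; case: pickle_inv => [t|] /=;
  first exact: dcvg.
exact: cvg_cst.
Qed.

(** The mass [1 - D_ j s] tends to [1] and the choices increase, so the limit loses no probability.
    A transition of positive limit was committed at some stage, hence preserves values. At a random
    state, [(1 - D_ j s) * prob M s t] tends to [prob M s t]. *)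
Lemma commitment_limit (a_ : nat -> S -> S -> R) (D_ : nat -> S -> R) :
  (forall j, commitment (a_ j) (D_ j)) ->
  (forall s t, nondecreasing_seq (fun j => a_ j s t)) ->
  (forall s e, 0 < e -> exists j, D_ j s < e) ->
  exists f, (forall s, admissible s (f s)) /\ forall j s t, a_ j s t <= f s t.
Proof.
move=> aC a_nd D_0; pose f s t := limn (fun j => a_ j s t).
have wa j s : weight (a_ j s) by have [H _] := aC j; have [] := H s.
have am j s : wsum (a_ j s) (fun=> 1) = 1 - D_ j s.
  by have [H _] := aC j; have [] := H s.
have D0 j s : 0 < D_ j s by have [H _] := aC j; have [_ /andP[]] := H s.
have am1 j s : wsum (a_ j s) (fun=> 1) <= 1 by rewrite am gerBl ltW.
have ale1 j s t : a_ j s t <= 1.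
  apply: le_trans (am1 j s); rewrite -[leLHS]mulr1 -wsum_indic.
  apply: le_wsum_in => //; [|exact: bdd_cst|].
    by apply: (@bdd_itv _ _ 0 1) => u; case: eqP;
      rewrite ?mul1r ?mul0r lexx ler01.
  by move=> u _; case: eqP; rewrite ?mul1r ?mul0r.
have acvg s t : a_ j s t @[j --> \oo] --> f s t.
  by apply: nondecreasing_is_cvgn; [exact: a_nd|exists 1 => _ [j _ <-]].
have af j s t : a_ j s t <= f s t.
  apply: (@nondecreasing_cvgn_le _ (fun j => a_ j s t)); first exact: a_nd.
  by apply/cvg_ex; exists (f s t).
have fP s : weight (f s) /\ wsum (f s) (fun=> 1) <= 1.
  by apply: (@weight_limit (fun j => a_ j s)).
have wf s : weight (f s) := (fP s).1.
have f0 s t : 0 <= f s t by case: (wf s).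
have Dcvg s : D_ j s @[j --> \oo] --> 0.
  have D_ni : nonincreasing_seq (fun j => D_ j s).
    move=> i j ij; rewrite -lerN2 -(lerD2l 1) -!am; apply: le_wsum_weight => //.
    - by move=> t; rewrite a_nd // andbT; case: (wa i s).
    - exact: bdd_cst.
  apply/cvgrPdist_lt => e e0; have [j0 j0P] := D_0 s _ e0.
  exists j0 => // j /= j0j; rewrite sub0r normrN gtr0_norm //.
  by apply: le_lt_trans j0P; exact: D_ni.
exists f; split => // s.
have fg t : 0 < f s t -> value_preserving s t.
  move=> ft; have [j ja] : exists j, 0 < a_ j s t.
    apply: contrapT => /forallNP nj; move: ft; apply/negP; rewrite -leNgt.
    apply: (@cvg_le _ (fun j => a_ j s t) (fun=> 0)) => //; last exact: cvg_cst.
    by move=> j; rewrite leNgt; apply/negP; exact: nj.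
  by have [H _] := aC j; have [_ _ _ ag _] := H s; exact: ag.
split => //; split; last first.
  move=> nc; apply/funext => t; apply: cvg_uniq (acvg s t) _.
  have E j : a_ j s t = (1 - D_ j s) * prob M s t.
    by have [H _] := aC j; have [_ _ _ _ ->] := H s.
  have -> : (fun j => a_ j s t) = (fun j => (1 - D_ j s) * prob M s t)
    by apply/funext.
  have h : (1 - D_ j s) * prob M s t @[j --> \oo] --> (1 - 0) * prob M s t.
    by apply: cvgM; [apply: cvgB => //; exact: cvg_cst|exact: cvg_cst].
  by rewrite subr0 mul1r in h.
split => // [t nst|].
  apply/eqP; rewrite eq_le f0 andbT leNgt; apply/negP => /fg[st _ _].
  by rewrite st in nst.
rewrite -wsum1_esum //; congr EFin; apply/eqP; rewrite eq_le (fP s).2 /=.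
apply/ler_addgt0Pr => e e0; have [j jP] := D_0 s _ e0.
have : wsum (a_ j s) (fun=> 1) <= wsum (f s) (fun=> 1).
  apply: le_wsum_weight => //; last exact: bdd_cst.
  by move=> t; rewrite af andbT; case: (wa j s).
rewrite am; lra.
Qed.

(** Stage [j] treats the pair [(x, m)] coded by [j], with tolerance and failure probability both
    [m.+1%:R^-1]. One visit to each pair suffices, because [hit] only grows from the commitment to
    the limit kernel. *)
Lemma memoryless_hit : exists f, (forall s, admissible s (f s)) /\
  forall x e eta, attained x -> 0 < e -> 0 < eta -> exists n,
    1 - eta < hit e n f x.
Proof.
pose cm := {p : (S -> S -> R) * (S -> R) | commitment p.1 p.2}.
pose step_ok (pj : cm * nat) (p : cm) :=
    [/\ forall s t, (sval pj.1).1 s t <= (sval p).1 s t,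
      forall s, (sval p).2 s <= (sval pj.1).2 s,
      forall s, (pickle s < pj.2)%N -> (sval p).2 s <= (sval pj.1).2 s / 2 &
      forall x m, unpickle pj.2 = Some (x, m) -> attained x ->
        exists n, 1 - m.+1%:R^-1 < hit m.+1%:R^-1 n (sval p).1 x].
have /choice[nxt nxtP] pj : exists p, step_ok pj p.
  case: pj => -[[a D] aC] j; rewrite /step_ok /=.
  have pos (m : nat) : 0 < (m.+1%:R^-1 : R) by rewrite invr_gt0.
  case E : (unpickle j) => [[x m]|].
    have [a' [D' [a'C aa' DD' Dh hitP]]] :=
      commitment_extend x j aC (pos m) (pos m).
    by exists (exist _ (a', D') a'C); split => // y n [<- <-].
  (* A code of no pair must still halve the free probability; any state serves as a dummy, and
     without states the halving is vacuous. *)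
  have [[x _]|nS] := pselect (exists x : S, True).
    have [a' [D' [a'C aa' DD' Dh hitP]]] :=
      commitment_extend x j aC (pos 0%N) (pos 0%N).
    by exists (exist _ (a', D') a'C).
  by exists (exist _ (a, D) aC); split => // s; case: nS; exists s.
have init : commitment (fun _ _ => 0) (fun=> 1).
  split; last by exists 0%N => s; rewrite ltxx.
  move=> s; split => //.
  - split => //; rewrite esum1 //; exact: ltry.
  - by rewrite ltr01 lexx.
  - rewrite subrr (@eq_wsum_in _ _ _ (fun=> 1) (fun=> 0)); last by move=> t;
    rewrite eqxx.
    have w0 : weight (fun _ : S => 0 : R) by split => //; rewrite esum1 //;
      exact: ltry.
    set z := wsum _ _; have -> : z = 0 * z; last by rewrite mul0r.
    by rewrite /z -wsumZ //; [apply: eq_wsum_in => t;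
      rewrite eqxx|exact: bdd_cst].
  - by move=> t; rewrite ltxx.
  - by move=> _ t; rewrite subrr mul0r.
pose sq := fix sq j : cm := if j is j'.+1 then nxt (sq j', j')
  else exist _ (_, _) init.
pose a_ j := (sval (sq j)).1; pose D_ j := (sval (sq j)).2.
have aC j : commitment (a_ j) (D_ j) := svalP (sq j).
have aS s t j : a_ j s t <= a_ j.+1 s t by have [H _ _ _] := nxtP (sq j, j);
  exact: H.
have a_nd s t : nondecreasing_seq (fun j => a_ j s t)
  by apply/nondecreasing_seqP.
have D01 j s : 0 < D_ j s <= 1 by have [H _] := aC j; have [] := H s.
have D_0 s e : 0 < e -> exists j, D_ j s < e.
  (* From stage [(pickle s).+1] on, every stage halves the freedom at [s]. *)
  move=> e0; have half i : D_ ((pickle s).+1 + i)%N s <= 2^-1 ^+ i.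
    elim: i => [|i IH]; first by rewrite expr0;
      case/andP: (D01 ((pickle s).+1 + 0)%N s).
    have [_ _ H _] := nxtP (sq ((pickle s).+1 + i)%N, ((pickle s).+1 + i)%N).
    rewrite addnS; apply: le_trans (H s _) _; first by rewrite /= ltnS leq_addr.
    by rewrite exprSr ler_wpM2r ?invr_ge0.
  have h : `|2^-1 : R| < 1 by rewrite ger0_norm; lra.
  have [i iP] := @cvg_ex_lt _ (fun i => (2^-1 : R) ^+ i) 0 e (cvg_expr h) e0.
  exists ((pickle s).+1 + i)%N; apply: le_lt_trans (half i) _.
  by move: iP; rewrite sub0r normrN ger0_norm // exprn_ge0 // invr_ge0.
have [f [fA af]] := commitment_limit aC a_nd D_0.
have fS : subkernel f.
  move=> s; split; first exact: admissible_weight (fA s).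
  by rewrite (wsum_cst 1 (admissible_dist (fA s))).
exists f; split => // x e eta Wx e0 eta0.
have me0 : 0 < Num.min e eta by rewrite lt_min e0.
have [m mP] : exists m : nat, (m.+1%:R^-1 : R) < Num.min e eta.
  have [m mP] := @cvg_ex_lt _ (fun m => (m.+1%:R^-1 : R)) 0 _ (@cvg_harmonic R)
    me0.
  by exists m; move: mP; rewrite sub0r normrN ger0_norm // invr_ge0.
have [me meta] : m.+1%:R^-1 < e /\ m.+1%:R^-1 < eta.
  by move: mP; rewrite lt_min => /andP[].
have [_ _ _ H] := nxtP (sq (pickle (x, m)), pickle (x, m)).
have [n nP] := H x m (pickleK _) Wx; exists n.
apply: lt_le_trans (hit_le_eps M B n x fS (ltW me)).
apply: lt_le_trans (hit_le M B m.+1%:R^-1 n x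
  (commitment_subkernel (aC (pickle (x, m)).+1)) fS (af _)).
by apply: lt_trans nP; rewrite ltrD2l ltrN2.
Qed.

End limit_kernel.

(** * Markov policies *)

Section markov.
Context {R : realType} {S : countType} (M : mdp R S) (B : R).
Hypothesis rewardB : forall s t, `|clip_reward M s t| <= B - 1.
Implicit Types (s t x : S) (d v : S -> R) (k : @policy R S).
Implicit Types (f : S -> S -> R) (g : nat -> S -> S -> R) (e eta : R).

Local Notation valid_dist := (valid_dist M).
Local Notation valid_policy := (valid_policy M).
Local Notation opt_value := (opt_value M B).
Local Notation policy_value := (policy_value M B).
Local Notation near_value := (near_value M B).
Local Notation miss := (miss M B).
Local Notation delay_expect := (delay_expect M).
Local Notation attained := (attained M B).
Local Notation admissible := (admissible M B).
Local Notation hit := (hit M B).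
Local Notation hit_or := (hit_or M B).

(** [i] is the absolute time at [s], so that [after] only advances the clock. *)
Definition markov_policy g i s : @policy R S := fun u =>
  g (i + size u)%N (last s u).

Lemma after_markov g i s t :
  after (markov_policy g i s) t = markov_policy g i.+1 t.
Proof. by apply/funext => u; rewrite /markov_policy /after /= addSnnS. Qed.

Lemma markov_policy0 g i s : markov_policy g i s [::] = g i s.
Proof. by rewrite /markov_policy /= addn0. Qed.

Fixpoint markov_expect n g i s (F : S -> R) : R :=
  if n is n'.+1 then wsum (g i s) (fun t => markov_expect n' g i.+1 t F)
    else F s.

Lemma delay_expect_markov n F g i s : delay_expect n F (markov_policy g i s) s =
  markov_expect n g i s (fun t => F (markov_policy g (i + n)%N t) t).
Proof.
elim: n i s => [|n IH] i s; first by rewrite addn0.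
rewrite delay_expectS markov_policy0 /=; apply: eq_wsum_in => t _.
by rewrite after_markov IH addSnnS.
Qed.

Lemma eq_markov_expect n g g' i s F : (forall j, (j < i + n)%N -> g j = g' j) ->
  markov_expect n g i s F = markov_expect n g' i s F.
Proof.
elim: n i s => [//|n IH] i s gg' /=; rewrite gg' ?addnS ?ltnS ?leq_addr //.
by apply: eq_wsum_in => t _; apply: IH => j; rewrite addSnnS; exact: gg'.
Qed.

Lemma admissible_attained s d t : admissible s d -> attained s -> 0 < d t ->
  attained t.
Proof. by move=> [_ dg] Ws /dg[_ /(_ Ws)]. Qed.

Section time_dependent.
Variable g : nat -> S -> S -> R.
Hypothesis gA : forall i s, admissible s (g i s).

Lemma markov_expect_norm_le n i s F C : (forall t, `|F t| <= C) ->
  `|markov_expect n g i s F| <= C.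
Proof.
move=> FC; elim: n i s => [//|n IH] i s /=.
exact: (wsum_norm_le (admissible_dist (gA i s))).
Qed.

Lemma markov_expect_le n i s F G C : (forall t, `|F t| <= C) ->
  (forall t, `|G t| <= C) ->
  (forall t, attained t -> F t <= G t) -> attained s ->
    markov_expect n g i s F <= markov_expect n g i s G.
Proof.
move=> FC GC FG; elim: n i s => [|n IH] i s Ws /=; first exact: FG.
apply: le_wsum_in; first exact: admissible_weight (gA i s).
- by exists C => t; exact: markov_expect_norm_le.
- by exists C => t; exact: markov_expect_norm_le.
- by move=> t gt; apply: IH; exact: admissible_attained (gA i s) Ws gt.
Qed.

Lemma markov_expect_cvg n i s (F_ : nat -> S -> R) F C :
  (forall j t, `|F_ j t| <= C) ->
  (forall t, attained t -> F_ j t @[j --> \oo] --> F t) -> attained s ->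
  markov_expect n g i s (F_ j) @[j --> \oo] --> markov_expect n g i s F.
Proof.
move=> FC FF; elim: n i s => [|n IH] i s Ws /=; first exact: FF.
apply: (@wsum_cvg_in _ _ _ _ _ C); first exact: admissible_weight (gA i s).
  by move=> j t; exact: markov_expect_norm_le.
by move=> t gt; apply: IH; exact: admissible_attained (gA i s) Ws gt.
Qed.

Lemma markov_expect_cst n i s c : markov_expect n g i s (fun=> c) = c.
Proof.
elim: n i s => [//|n IH] i s /=.
rewrite -[RHS](wsum_cst c (admissible_dist (gA i s))); apply: eq_wsum_in => t _.
exact: IH.
Qed.

Lemma markov_policy_valid i s : valid_policy (markov_policy g i s) s.
Proof. by move=> u; have [] := gA (i + size u)%N (last s u). Qed.

Lemma value_le_markov_policy s : attained s ->
  (forall n e delta, 0 < e -> 0 < delta -> exists m,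
    delay_expect n (miss e m) (markov_policy g 0 s) s <= delta) ->
  opt_value s <= policy_value (markov_policy g 0 s) s.
Proof.
move=> Ws H.
apply: (@value_le_policy_value _ _ _ _ rewardB
  (fun k s => attained s /\ exists i, k = markov_policy g i s)) => //.
- move=> k s' t [Ws' [i ->]]; rewrite markov_policy0 => gt; split.
    exact: admissible_attained (gA i s') Ws' gt.
  by exists i.+1; rewrite after_markov.
- move=> k s' [Ws' [i ->]]; split; first exact: markov_policy_valid.
  by rewrite markov_policy0; exact: (admissible_value rewardB (gA i s') Ws').
- by split=> //; exists 0%N.
Qed.

End time_dependent.

(** * Optimality of the memoryless kernel and its derandomisation *)

Section from_memoryless.
Variable f : S -> S -> R.
Hypothesis fA : forall s, admissible s (f s).
Hypothesis fhit : forall x e eta, attained x -> 0 < e -> 0 < eta ->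
  exists n, 1 - eta < hit e n f x.

Let fS : subkernel f.
Proof.
move=> s; split; first exact: admissible_weight (fA s).
by rewrite (wsum_cst 1 (admissible_dist (fA s))).
Qed.

Let hit01 e n s : 0 <= hit e n f s <= 1.
Proof. exact: hit_itv. Qed.

Lemma hit_cvg_one e s : 0 < e -> attained s -> hit e n f s @[n --> \oo] -->
  (1 : R).
Proof.
move=> e0 Ws; apply/cvgrPdist_lt => eta eta0; have [n nP] := fhit Ws e0 eta0.
exists n => // m /= nm; have := hit_nd M B e s fS nm.
have /andP[h0 h1] := hit01 e m s; rewrite ger0_norm; lra.
Qed.

Definition lack e n s := 1 - hit e n f s.

Lemma lack_norm e n s : `|lack e n s| <= 1.
Proof. by have /andP[? ?] := hit01 e n s; rewrite /lack ger0_norm; lra. Qed.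

Lemma lack_cvg e s : 0 < e -> attained s -> lack e n s @[n --> \oo] --> (0 : R).
Proof.
move=> e0 Ws; rewrite -(subrr 1); apply: cvgB; first exact: cvg_cst.
exact: hit_cvg_one.
Qed.

Lemma wsum_lack e n s d : is_dist (edge M s) d ->
  wsum d (fun t => if near_value e s t then 0 else lack e n t) =
  1 - wsum d (hit_or e (hit e n f) s).
Proof.
move=> dd; rewrite -[X in X - _](wsum_cst 1 dd) -wsumB.
- by apply: eq_wsum_in => t _; rewrite /hit_or; case: ifP => _; rewrite ?subrr.
- exact: dist_weight dd.
- exact: bdd_cst.
- by apply: hit_or_bdd => ?; exact: hit01.
Qed.

Lemma miss_lack e n i s :
  miss e n (markov_policy (fun=> f) i s) s = lack e n s.
Proof.
elim: n i s => [|n IH] i s; first by rewrite /lack /= subr0.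
rewrite /= markov_policy0 /lack /= -wsum_lack;
  last exact: admissible_dist (fA s).
by apply: eq_wsum_in => t _; rewrite after_markov IH.
Qed.

Lemma value_le_memoryless s : attained s ->
  opt_value s <= policy_value (markov_policy (fun=> f) 0 s) s.
Proof.
move=> Ws; have gA (i : nat) s' : admissible s' ((fun=> f) i s') by exact: fA.
apply: (value_le_markov_policy gA Ws) => n e delta e0 d0.
have [|m mP] := @cvg_ex_lt _ (fun m => markov_expect n (fun=> f) 0 s (lack e m))
  0 delta _ d0.
  rewrite -(markov_expect_cst gA n 0 s 0).
  apply: (@markov_expect_cvg _ gA _ _ _ _ _ 1) => // [j t|t Wt];
    first exact: lack_norm.
  exact: lack_cvg.
exists m; rewrite delay_expect_markov; move: mP; rewrite sub0r normrN => mP.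
apply: le_trans (ltW mP); apply: le_trans (ler_norm _).
rewrite le_eqVlt; apply/orP; left; apply/eqP; congr markov_expect.
by apply/funext => t; exact: miss_lack.
Qed.

(** The triple holds the tolerance, the number of steps left after the present one, and the state.
    Picking the successor in the support of [f] keeps the choice admissible; at a random state [f]
    itself is kept. *)
Lemma det_choice (ems : R * nat * S) : exists d, [/\ admissible ems.2 d,
    controlled M ems.2 -> exists t, d = dirac_dist t &
    wsum d (fun t => if near_value ems.1.1 ems.2 t then 0
      else lack ems.1.1 ems.1.2 t)
      <= lack ems.1.1 ems.1.2.+1 ems.2].
Proof.
case: ems => -[e m] s /=; have fd := admissible_dist (fA s).
have [cs|ncs] := boolP (controlled M s); last first.
  by exists (f s); split => //; rewrite wsum_lack.
have bg : bdd (hit_or e (hit e m f) s) by apply: hit_or_bdd => ?; exact: hit01.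
have [t [ft fle]] := wsum_ex_ge fd bg.
have [_ fg] := fA s; have gt := fg t ft; have [st _ _] := gt.
have dd := @dist_dirac R _ _ _ st.
exists (dirac_dist t); split; [|by exists t|].
- split; first by split=> //; rewrite cs.
  by move=> u; rewrite /dirac_dist; case: eqP => [->|]; rewrite ?ltxx.
- by rewrite wsum_lack // wsum_dirac /lack lerD2l lerN2.
Qed.

(** [i + r - j.+1] is the number of steps of the phase left after step [j]. Each choice is at least
    as good as [f] when [f] is followed afterwards, and replacing this continuation by the later
    choices only helps, so losses do not accumulate. *)
Lemma miss_det (dd : R * nat * S -> S -> R) g e r i s :
  (forall ems, [/\ admissible ems.2 (dd ems), controlled M ems.2 -> exists t,
    dd ems = dirac_dist t &
    wsum (dd ems) (fun t => if near_value ems.1.1 ems.2 t then 0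
      else lack ems.1.1 ems.1.2 t)
      <= lack ems.1.1 ems.1.2.+1 ems.2]) ->
  (forall i s, admissible s (g i s)) ->
  (forall j s, (i <= j < i + r)%N -> g j s = dd (e, (i + r - j.+1)%N, s)) ->
  miss e r (markov_policy g i s) s <= lack e r s.
Proof.
move=> ddP gA; elim: r i s => [|r IH] i s gE /=; first
  by rewrite /lack /= subr0.
have gd : g i s = dd (e, r, s).
  rewrite gE ?leqnn ?addnS ?ltnS ?leq_addr //.
  by congr (dd (_, _, _)); lia.
have [dA _ dle] := ddP (e, r, s); rewrite markov_policy0 gd.
apply: le_trans dle; rewrite /=; apply: le_wsum_in;
  first exact: admissible_weight dA.
- have := miss_bdd B e r (markov_policy_valid gA i s).
  by [].
- exists 1 => t; case: ifP => _; first by rewrite normr0 ler01.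
  exact: lack_norm.
- move=> t _; case: ifP => // _; rewrite after_markov; apply: IH => j s' jr.
  rewrite gE; last by lia.
  by congr (dd (_, _, _)); lia.
Qed.

(** The end of a phase is chosen so that [lack], averaged over the law of the state at its start, is
    small. Dominated convergence provides it, since [lack] tends to [0] at each attained state; the
    phases thus depend on [s]. *)
Lemma value_le_det_markov s : attained s -> exists g,
  [/\ forall i s, valid_dist s (g i s),
  forall i s, controlled M s -> exists t, g i s = dirac_dist t &
  opt_value s <= policy_value (markov_policy g 0 s) s].
Proof.
move=> Ws; have [dd ddP] := choice det_choice.
pose ph := {p : (nat -> S -> S -> R) * nat |
  forall i s, admissible s (p.1 i s) /\
    (controlled M s -> exists t, p.1 i s = dirac_dist t)}.
pose eps (j : nat) : R := j.+1%:R^-1.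
have eps0 j : 0 < eps j by rewrite invr_gt0.
pose step_ok (pj : ph * nat) (p : ph) := let g := (sval pj.1).1 in
  let N := (sval pj.1).2 in let N' := (sval p).2 in
  [/\ (N < N')%N, forall i, (i < N)%N -> (sval p).1 i = g i,
    forall i s, (N <= i)%N -> (sval p).1 i s = dd (eps pj.2, (N' - i.+1)%N, s) &
    markov_expect N g 0 s (lack (eps pj.2) (N' - N)) <= eps pj.2].
have /choice[nxt nxtP] pj : exists p, step_ok pj p.
  case: pj => -[[g N] gP] j; rewrite /step_ok /=.
  have gA i s' : admissible s' (g i s') by have [] := gP i s'.
  have c : markov_expect N g 0 s (lack (eps j) r) @[r --> \oo] --> (0 : R).
    rewrite -(markov_expect_cst gA N 0 s 0).
    apply: (@markov_expect_cvg _ gA _ _ _ _ _ 1) => // [? ?|t Wt];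
      first exact: lack_norm.
    exact: lack_cvg.
  have /cvgrPdist_lt/(_ _ (eps0 j))[r0 _ rP] := c.
  (* From the end of the phase on, the truncated subtraction gives [0]: these choices are
     placeholders that the next phase replaces. *)
  pose g' i s := if (i < N)%N then g i s
    else dd (eps j, (N + r0.+1 - i.+1)%N, s).
  have g'P i s' : admissible s' (g' i s') /\
      (controlled M s' -> exists t, g' i s' = dirac_dist t).
    rewrite /g'; case: ifP => _; first exact: gP.
    by have [] := ddP (eps j, (N + r0.+1 - i.+1)%N, s').
  exists (exist _ (g', (N + r0.+1)%N) g'P); split => /=.
  - by lia.
  - by move=> i iN; apply/funext => s'; rewrite /g' iN.
  - by move=> i s' Ni; rewrite /g' ltnNge Ni.
  - have := rP r0.+1 (leqnSn _); rewrite /= sub0r normrN => /ltW.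
    have -> : (N + r0.+1 - N = r0.+1)%N by lia.
    by apply: le_trans; exact: ler_norm.
have init (i : nat) s' : admissible s' (dd (1, 0%N, s')) /\
    (controlled M s' -> exists t, dd (1, 0%N, s') = dirac_dist t).
  by have [] := ddP (1, 0%N, s').
pose sq := fix sq j : ph :=
  if j is j'.+1 then nxt (sq j', j')
    else exist _ (fun _ s => dd (1, 0%N, s), 0%N) init.
pose G j := (sval (sq j)).1; pose N j := (sval (sq j)).2.
have GP j i s' : admissible s' (G j i s') /\
  (controlled M s' -> exists t, G j i s' = dirac_dist t).
  exact: (svalP (sq j)).
have NS j : (N j < N j.+1)%N by have [] := nxtP (sq j, j).
have Nj j : (j <= N j)%N by elim: j => // j IH; exact: leq_ltn_trans IH (NS j).
have N_nd : {homo N : j l / (j <= l)%N >-> (j <= l)%N}.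
  by apply: homo_leq => // [? ? ?|j]; [exact: leq_trans|exact: ltnW (NS j)].
have Gstab j l i : (j <= l)%N -> (i < N j)%N -> G l i = G j i.
  elim: l => [|l IH]; first by rewrite leqn0 => /eqP ->.
  rewrite leq_eqVlt => /predU1P[->//|]; rewrite ltnS => jl ij.
  rewrite -(IH jl ij); have [_ H _ _] := nxtP (sq l, l).
  by apply: H; exact: leq_trans ij (N_nd _ _ jl).
(* Diagonal choice: time [i] is settled from stage [i.+1] on, because [N i.+1] exceeds [i]. *)
pose g i := G i.+1 i.
have gG j i : (i < N j)%N -> g i = G j i.
  move=> ij; rewrite /g; have [ji|ij'] := leqP j i.+1; first exact: Gstab.
  by rewrite (@Gstab i.+1 j) ?(ltnW ij') //; exact: Nj.
have gA i s' : admissible s' (g i s') by have [] := GP i.+1 i s'.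
exists g; split; first by move=> i s'; have [] := gA i s'.
  by move=> i s' cs; have [_] := GP i.+1 i s'; exact.
apply: (value_le_markov_policy gA Ws) => n e delta e0 d0.
have me0 : 0 < Num.min e delta by rewrite lt_min e0.
have /cvgrPdist_lt/(_ _ me0)[j0 _ j0P] := @cvg_harmonic R.
(* [j0] brings the tolerance of the phase below [e] and [delta]; [n <= j] ensures that the phase
   starts no earlier than time [n]. *)
pose j := maxn j0 n; have nj : (n <= j)%N by rewrite leq_maxr.
have := j0P j (leq_maxl _ _); rewrite /= sub0r normrN ger0_norm ?invr_ge0 //.
rewrite lt_min -/(eps j) => /andP[ee ed].
have nN : (n <= N j)%N by exact: leq_trans nj (Nj j).
pose r := (N j.+1 - N j)%N; exists (N j - n + r)%N.
have bm e' m k' s' : valid_policy k' s' -> `|miss e' m k' s'| <= 1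
  by exact: miss_norm_le.
have kP : valid_policy (markov_policy g 0 s) s by exact: markov_policy_valid.
apply: (@le_trans _ _ (delay_expect n (delay_expect (N j - n) (miss (eps j) r))
  (markov_policy g 0 s) s)).
  apply: (delay_expect_le rewardB n (C := 1) (D := 1)) => //.
  - by move=> k' s'; exact: bm.
  - by move=> k' s' k'P; apply: (delay_expect_norm_le rewardB) => // ? ?;
    exact: bm.
  - move=> k' s' k'P; apply: le_trans (miss_delay rewardB _ _ _ k'P).
    by apply: miss_le_eps => //; exact: ltW.
rewrite -delay_expect_add subnKC // delay_expect_markov add0n;
  apply: le_trans (ltW ed).
have [_ _ Hphase Hlack] := nxtP (sq j, j).
apply: le_trans Hlack; rewrite -/(N j) -/(G j) -/(sq j.+1) -/(N j.+1) -/r /=.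
rewrite -(@eq_markov_expect (N j) g (G j)); last by move=> i;
  rewrite add0n => /gG ->.
apply: (@markov_expect_le g gA _ _ _ _ _ 1) => //.
- by move=> t; apply: bm; exact: markov_policy_valid.
- by move=> t; exact: lack_norm.
move=> t Wt; apply: (@miss_det dd g (eps j) r (N j) t ddP gA) =>
  i s' /andP[Ni iN].
have Njr : (N j + r = N j.+1)%N by rewrite subnKC // ltnW.
by rewrite Njr in iN *; rewrite (gG j.+1) //; exact: Hphase.
Qed.

End from_memoryless.

End markov.

(** * Integrals over runs *)

Section word_expectation.
Context {R : realType} {S : countType} (M : mdp R S).
Implicit Types (s t x : S) (d v : S -> R) (k : @policy R S).
Implicit Types (G : seq S -> R) (C c y : R).

Local Notation valid_policy := (valid_policy M).

Fixpoint word_expect n k G : R :=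
  if n is n'.+1 then
    wsum (k [::]) (fun t => word_expect n' (after k t) (fun u => G (t :: u)))
  else G [::].

Fixpoint word_prob k u : R :=
  if u is t :: u' then k [::] t * word_prob (after k t) u' else 1.

Lemma word_expect_norm_le n k s G C : valid_policy k s ->
  (forall u, `|G u| <= C) -> `|word_expect n k G| <= C.
Proof.
elim: n k s G => [|n IH] k s G kP GC /=; first exact: GC.
by apply: (wsum_norm_le (valid_policy_dist kP)) => t;
  apply: IH (valid_policy_after t kP) _.
Qed.

Lemma word_expect_ge0 n k s G : valid_policy k s ->
  (exists C, forall u, `|G u| <= C) ->
  (forall u, 0 <= G u) -> 0 <= word_expect n k G.
Proof.
move=> + [C]; elim: n k s G => [|n IH] k s G kP GC G0 /=; first exact: G0.
apply: wsum_ge0 (valid_policy_weight kP) _ _; last by move=> t _;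
  apply: IH (valid_policy_after t kP) _ _.
by exists C => t; apply: word_expect_norm_le (valid_policy_after t kP) _.
Qed.

Lemma word_expect_addr n k s G C c : valid_policy k s ->
  (forall u, `|G u| <= C) ->
  word_expect n k (fun u => G u + c) = word_expect n k G + c.
Proof.
elim: n k s G => [//|n IH] k s G kP GC /=.
rewrite -[c in RHS](wsum_cst c (valid_policy_dist kP)) -wsumD.
- by apply: eq_wsum_in => t _; apply: IH (valid_policy_after t kP) _.
- exact: valid_policy_weight kP.
- by exists C => t; apply: word_expect_norm_le (valid_policy_after t kP) _.
- exact: bdd_cst.
Qed.

Lemma word_expectZ n k s G C c : valid_policy k s -> (forall u, `|G u| <= C) ->
  word_expect n k (fun u => c * G u) = c * word_expect n k G.
Proof.
elim: n k s G => [//|n IH] k s G kP GC /=; rewrite -wsumZ.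
- by apply: eq_wsum_in => t _; apply: IH (valid_policy_after t kP) _.
- exact: valid_policy_weight kP.
- by exists C => t; apply: word_expect_norm_le (valid_policy_after t kP) _.
Qed.

Lemma word_prob_ge0 k s u : valid_policy k s -> 0 <= word_prob k u.
Proof.
elim: u k s => [//|t u IH] k s kP /=; have [k0 _ _] := valid_policy_dist kP.
by rewrite mulr_ge0 //; exact: IH (valid_policy_after t kP).
Qed.

Lemma word_expect_esum n k s G C : valid_policy k s ->
  (forall u, 0 <= G u <= C) ->
  (word_expect n k G)%:E = (\esum_(u in [set u | size u = n])
    (word_prob k u * G u)%:E)%E.
Proof.
elim: n k s G C => [|n IH] k s G C kP GC /=.
  rewrite (_ : [set u | _] = [set [::]]); last first.
    by apply/seteqP; split => [u /size0nil ->//|u ->].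
  rewrite esum_set1 /= ?mul1r //.
  by rewrite lee_fin; have /andP[] := GC [::].
have GN u : `|G u| <= C by have /andP[? ?] := GC u; rewrite ger0_norm.
have G0 u : 0 <= G u by have /andP[] := GC u.
rewrite wsum_esum; [|exact: valid_policy_weight kP| |].
- have [k0 _ _] := valid_policy_dist kP.
  transitivity (\esum_(t in [set: S]) \esum_(u in [set u | size u = n])
     (word_prob (after k t) u * (k [::] t * G (t :: u)))%:E)%E.
    apply: eq_esum => t _; rewrite
      -(word_expectZ _ _ (valid_policy_after t kP) (fun u => GN (t :: u))).
    apply: (IH _ t _ (k [::] t * C)); first exact: valid_policy_after kP.
    move=> u; have /andP[g0 gC] := GC (t :: u).
    by rewrite mulr_ge0 //= ler_wpM2l.
  rewrite esum_esum; last first.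
    move=> t u _ _; rewrite lee_fin !mulr_ge0 //.
    exact: word_prob_ge0 (valid_policy_after t kP).
  rewrite (@reindex_esum _ _ _ ([set: S] `*`` (fun=> [set u | size u = n]))
    [set u | size u = n.+1] (fun tu => tu.1 :: tu.2)).
    by apply: eq_esum => -[t u] _ /=; rewrite mulrCA mulrA.
  split.
  - by move=> [t u] [_ /= <-].
  - by move=> [t u] [t' u'] _ _ /= [-> ->].
  - by move=> [|t u] //= [su]; exists (t, u).
- by exists C => t; apply: word_expect_norm_le (valid_policy_after t kP) _.
- by move=> t; apply: word_expect_ge0 (valid_policy_after t kP) _ _ => //;
  exists C.
Qed.

Fixpoint running_max y s u : R :=
  if u is t :: u' then running_max (Num.max y (clip_reward M s t)) t u' else y.

Lemma max_reward_word N k s y : max_reward M N k s y =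
  word_expect N k (running_max y s).
Proof.
rewrite /max_reward; elim: N k s y => [//|N IH] k s y /=.
by apply: eq_wsum_in => t _; exact: IH.
Qed.

Lemma delay_expect_word n N k s y : delay_expect M n
  (fun k s => max_reward M N k s y) k s =
  word_expect (n + N) k (fun u => running_max y (last s (take n u)) (drop n u)).
Proof.
elim: n k s => [|n IH] k s.
  rewrite /delay_expect /= max_reward_word; congr word_expect;
    apply/funext => u; by rewrite take0 drop0.
by rewrite delay_expectS addSn /=; apply: eq_wsum_in => t _; exact: IH.
Qed.

Lemma eq_word_expect_size n k G G' : (forall u, size u = n -> G u = G' u) ->
  word_expect n k G = word_expect n k G'.
Proof.
elim: n k G G' => [|n IH] k G G' GG' /=; first exact: GG'.
by apply: eq_wsum_in => t _; apply: IH => u su; apply: GG'; rewrite /= su.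
Qed.

Lemma mkseqS (T : Type) (x : nat -> T) n :
  mkseq x n.+1 = x 0%N :: mkseq (fun i => x i.+1) n.
Proof. by rewrite /mkseq /= -(addn0 1%N) iotaDl -map_comp. Qed.

(** Upper bounds characterise the maximum, and absolute times [m] match the indexing of [esups];
    later comparisons of maxima reduce to inclusions of intervals. *)
Lemma running_max_le (x : nat -> S) y c N n :
  running_max y (x n) (mkseq (fun i => x (n + i).+1) N) <= c <->
  y <= c /\ forall m, (n <= m < n + N)%N -> clip_reward M (x m) (x m.+1) <= c.
Proof.
elim: N n y => [|N IH] n y.
  by split => [/= ->|[]//]; split => // m; lia.
rewrite mkseqS addn0 /= (_ : (fun i => _) = fun i => x (n.+1 + i).+1);
  last first.
  by apply/funext => i; rewrite addnS.
rewrite IH ge_max; split.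
  move=> [/andP[yc rc] H]; split => // m mN; have [->//|mn] := eqVneq m n.
  by apply: H; lia.
move=> [yc H]; rewrite yc H ?leqnn ?addnS ?ltnS ?leq_addr //; split => // m mN.
by apply: H; lia.
Qed.

End word_expectation.

Section run_integral.
Context {R : realType} {S : countType} (M : mdp R S) (s0 : S).
Variables (P : probability (runs s0) R) (k : @policy R S).
Hypothesis PE : forall u, P (cylinder (s0 :: u)) = (word_prob k u)%:E.
Hypothesis kP : valid_policy M k s0.
Implicit Types (H : seq S -> R).

Lemma measurable_prefix n H :
  measurable_fun [set: runs s0] (fun x : runs s0 => H (mkseq x n)).
Proof.
move=> _ Y _; rewrite setTI.
pose F i : set (runs s0) := if (unpickle i : option (seq S)) is Some v then
  if (size v == n) && `[< Y (H v) >] then cylinder v else set0 else set0.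
rewrite [X in measurable X](_ : _ = \bigcup_i F i).
  apply: bigcupT_measurable => i; rewrite /F; case: unpickle => [v|//].
  by case: ifP => // _; exact: measurable_cylinder.
apply/seteqP; split => x /=.
  move=> Yx; exists (pickle (mkseq x n)) => //.
  rewrite /F pickleK size_mkseq eqxx /= asboolT //.
  by rewrite /cylinder /= size_mkseq.
move=> [i _]; rewrite /F; case: unpickle => [v|//].
case: ifP => // /andP[/eqP sv /asboolP Yv]; rewrite /cylinder /= sv => ->.
exact: Yv.
Qed.

Lemma measurable_step (r : S -> S -> R) m :
  measurable_fun [set: runs s0] (fun x : runs s0 => (r (x m) (x m.+1))%:E).
Proof.
apply/measurable_EFinP.
have := @measurable_prefix m.+2 (fun v => r (nth s0 v m) (nth s0 v m.+1)).
rewrite (_ : (fun x : runs s0 => _) = (fun x : runs s0 => r (x m) (x m.+1))) //.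
by apply/funext => x; rewrite !nth_mkseq.
Qed.

Lemma measure_cylinder_neq t u : t != s0 -> P (cylinder (t :: u)) = 0%E.
Proof.
move=> ts; have mC v : measurable (cylinder v : set (runs s0))
  by exact: measurable_cylinder.
have P0 : P (~` cylinder [:: s0]) = 0%E.
  have := probability_setC P (mC [:: s0]).
  by rewrite PE /= subee.
apply: subset_measure0 P0; [exact: mC|apply: measurableC; exact: mC|].
by move=> x xt [xs]; case: xt => [xt _]; rewrite -xt xs eqxx in ts.
Qed.

(** The cylinders of words of length [n.+1] form a countable partition on which the integrand is
    constant; those not starting at [s0] have measure [0]. *)
Lemma ge0_integral_prefix n H C : (forall v, 0 <= H v <= C) ->
  (\int[P]_x (H (mkseq x n.+1))%:E)%E =
    (word_expect n k (fun u => H (s0 :: u)))%:E.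
Proof.
move=> HC; have H0 v : 0 <= H v by have /andP[] := HC v.
pose F i : set (runs s0) := if (pickle_inv i : option (seq S)) is Some v then
  if size v == n.+1 then cylinder v else set0 else set0.
have mF i : measurable (F i).
  rewrite /F; case: pickle_inv => [v|]; last exact: measurable0.
  by case: ifP => _; [exact: measurable_cylinder|exact: measurable0].
have FE i (x : runs s0) : F i x -> pickle_inv i = Some (mkseq x n.+1).
  rewrite /F; case: pickle_inv => [v|//]; case: ifP => // /eqP sv.
  by rewrite /cylinder /= sv => ->.
have FT : \bigcup_i F i = [set: runs s0].
  apply/seteqP; split => // x _; exists (pickle (mkseq x n.+1)) => //.
  have sx : size (mkseq x n.+1) = n.+1 by exact: size_mkseq.
  rewrite /F pickleK_inv ifT; last exact/eqP.
  by change (mkseq x (size (mkseq x n.+1)) = mkseq x n.+1); rewrite sx.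
have tF : trivIset setT F.
  move=> i j _ _ [x [/FE xi /FE xj]].
  have := @pickle_invK (seq S) i; rewrite xi /= => <-.
  by have := @pickle_invK (seq S) j; rewrite xj.
pose h v := if size v == n.+1 then H v * fine (P (cylinder v)) else 0.
have h0 v : 0 <= h v.
  by rewrite /h; case: ifP => // _; rewrite mulr_ge0 // fine_ge0.
have /measurable_EFinP mH := measurable_prefix n.+1 H.
rewrite -FT ge0_integral_bigcup //; [|by rewrite FT|].
- transitivity (\sum_(i <oo) (natext h i)%:E)%E.
    apply: eq_eseriesr => i _; rewrite /natext /F.
    case: pickle_inv => [v|] /=; last by rewrite integral_set0.
    rewrite /h; case: ifPn => [/eqP sv|_]; last by rewrite integral_set0.
    transitivity (\int[P]_(x in cylinder v) (cst (H v)%:E) x)%E.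
      by apply: eq_integral => x; rewrite inE /cylinder /= sv => ->.
    rewrite integral_cst; last exact: measurable_cylinder.
    by rewrite EFinM fineK // fin_num_measure //; exact: measurable_cylinder.
  rewrite -esum_natext // (word_expect_esum n kP (fun u => HC (s0 :: u))).
  transitivity (\esum_(u in [set u | size u = n]) (h (s0 :: u))%:E)%E;
    last first.
    by apply: eq_esum => u /= su; rewrite /h /= su eqxx PE /= mulrC.
  rewrite -(esum_image [set u | size u = n] (cons s0) (fun v => (h v)%:E));
    last first.
    by move=> u v _ _ [].
  rewrite [RHS]esum_mkcond; apply: eq_esum => v _.
  case: ifPn => // /negP; rewrite inE => nv; rewrite /h.
  case: eqP => // sv; case: v sv nv => [//|t u] /= [su] nv.
  have [ts|ts] := eqVneq t s0; first by exfalso; apply: nv; exists u => //;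
    rewrite ts.
  by rewrite measure_cylinder_neq //= mulr0.
- by move=> x _; rewrite lee_fin.
Qed.

Lemma integral_prefix n H C : (forall v, `|H v| <= C) ->
  (\int[P]_x (H (mkseq x n.+1))%:E)%E =
    (word_expect n k (fun u => H (s0 :: u)))%:E.
Proof.
move=> HC; have mH := measurable_prefix n.+1 H.
(* Adding [C] reduces to the nonnegative case; the constant is cancelled on both sides at the
   end. *)
have H2 v : 0 <= H v + C <= 2 * C.
  by have := HC v; rewrite ler_norml => /andP[? ?]; lra.
have := ge0_integral_prefix n H2.
rewrite (word_expect_addr n C kP (fun u => HC (s0 :: u))).
have iH : P.-integrable setT
  (fun policy_value : runs s0 => (H (mkseq policy_value n.+1))%:E).
  apply: (@le_integrable _ _ _ P _ measurableT _ (cst C%:E)).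
  - exact/measurable_EFinP.
  - by move=> x _ /=; rewrite lee_fin (le_trans (HC _)) // ler_norm.
  - exact: finite_measure_integrable_cst.
under eq_integral do rewrite EFinD.
rewrite integralD //; last exact: finite_measure_integrable_cst.
rewrite integral_cst // [X in (_ * X)%E]probability_setT mule1 EFinD.
have fH := integrable_fin_num measurableT iH.
by rewrite -(fineK fH) -!EFinD => -[/addIr ->].
Qed.

Variable B : R.
Hypothesis rewardB : forall s t, `|clip_reward M s t| <= B - 1.

Let X (x : nat -> S) m := clip_reward M (x m) (x m.+1).
Let Y n N (x : nat -> S) : R :=
  running_max M (1 - B) (x n) (mkseq (fun i => x (n + i).+1) N).

Lemma Y_bound n N x : `|Y n N x| <= B.
Proof.
have B1 := bound_ge1 rewardB s0; rewrite ler_norml; apply/andP; split.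
  rewrite (@le_trans _ _ (1 - B)) //; first lra.
  by have /running_max_le[] := lexx (Y n N x).
apply/running_max_le; split; first lra.
by move=> m _; have := rewardB (x m) (x m.+1); rewrite ler_norml => /andP[_];
  lra.
Qed.

(** The start [1 - B] lies below every reward, so it does not affect the supremum. *)
Lemma Y_esups n x :
  (Y n N x)%:E @[N --> \oo] --> esups (fun m => (X x m)%:E) n.
Proof.
have Y_nd : {homo (fun N => (Y n N x)%:E) : i j / (i <= j)%N >-> (i <= j)%E}.
  move=> i j ij; rewrite lee_fin; apply/running_max_le.
  have /running_max_le[? H] := lexx (Y n j x); split => // m mi; apply: H; lia.
suff -> : esups (fun m => (X x m)%:E) n =
  ereal_sup (range (fun N => (Y n N x)%:E)).
  exact: ereal_nondecreasing_cvgn.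
apply/eqP; rewrite eq_le; apply/andP; split.
  apply: ge_ereal_sup => _ [m /= nm <-].
  apply: (@le_trans _ _ (Y n (m - n).+1 x)%:E); last by apply: ereal_sup_ubound;
    exists (m - n).+1.
  rewrite lee_fin; have /running_max_le[_ H] := lexx (Y n (m - n).+1 x).
  by apply: H; lia.
apply: ge_ereal_sup => _ [N _ <-].
have XE m : (n <= m)%N -> ((X x m)%:E <= esups (fun m => (X x m)%:E) n)%E.
  by move=> nm; apply: ereal_sup_ubound; exists m.
move: XE; case: (esups _ _) => [c XE|_|XE]; last 2 first.
- by rewrite leey.
- by have := XE n (leqnn n).
rewrite lee_fin; apply/running_max_le; split.
  have := XE n (leqnn n); rewrite lee_fin; apply: le_trans.
  by have := rewardB (x n) (x n.+1); rewrite ler_norml /X; lra.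
by move=> m /andP[nm _]; have := XE m nm; rewrite lee_fin.
Qed.

Lemma Y_prefix n N : exists H, (forall v, `|H v| <= B) /\
  (forall x : nat -> S, Y n N x = H (mkseq x (n + N).+1)) /\
  forall u, size u = (n + N)%N ->
    H (s0 :: u) = running_max M (1 - B) (last s0 (take n u)) (drop n u).
Proof.
have mk (v : seq S) (j : nat) : mkseq (nth s0 v) (size v) = v
  by exact: mkseq_nth.
exists (fun v => Y n N (nth s0 v)); split; first by move=> v; exact: Y_bound.
split=> [x|u su]; rewrite /Y.
  congr running_max; first by rewrite nth_mkseq // ltnS leq_addr.
  apply/eq_in_map => i; rewrite mem_iota add0n => /andP[_ iN].
  by rewrite nth_mkseq //; lia.
congr running_max.
  have nu : (n <= size u)%N by rewrite su leq_addr.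
  case: n su nu => [|n] su nu /=; first by rewrite take0.
  by rewrite (last_nth s0) size_take_min (minn_idPl nu) /= nth_take.
apply: (@eq_from_nth _ s0); first by rewrite size_mkseq size_drop su addKn.
by move=> i; rewrite size_mkseq => iN; rewrite nth_mkseq // nth_drop.
Qed.

Lemma integral_Y n N : (\int[P]_x (Y n N x)%:E)%E =
  (delay_expect M n (fun k s => max_reward M N k s (1 - B)) k s0)%:E.
Proof.
have [H [HB [YH HE]]] := Y_prefix n N.
under eq_integral do rewrite YH.
rewrite (integral_prefix _ HB) delay_expect_word; congr EFin;
  exact: eq_word_expect_size.
Qed.

Lemma measurable_Y n N :
  measurable_fun [set: runs s0] (fun x : runs s0 => (Y n N x)%:E).
Proof.
have [H [_ [YH _]]] := Y_prefix n N.
apply/measurable_EFinP; have := measurable_prefix (n + N).+1 H.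
rewrite (_ : (fun x : runs s0 => H (mkseq x (n + N).+1)) = Y n N) //.
by apply/funext => x; rewrite YH.
Qed.

Lemma integral_esups n : (\int[P]_x esups (fun m => (X x m)%:E) n)%E =
  (tail_value M B n k s0)%:E.
Proof.
have iB : P.-integrable setT (EFin \o cst B).
  exact: finite_measure_integrable_cst.
have [] := @dominated_convergence _ _ _ P setT measurableT
  (fun N (x : runs s0) => (Y n N x)%:E)
  (fun x => esups (fun m => (X x m)%:E) n) (EFin \o cst B) (measurable_Y n).
- by apply: measurable_fun_esups => m; exact: measurable_step.
- by apply: aeW => x _; exact: Y_esups.
- exact: iB.
- by apply: aeW => x N _; rewrite /= lee_fin; exact: Y_bound.
move=> _ _; under eq_fun do rewrite integral_Y.
move=> H; apply: (@cvg_unique _ (@ereal_hausdorff R) _ _ _ _ H).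
apply: cvg_EFin; first exact: nearW.
rewrite /comp /=; apply: (@delay_expect_cvg _ _ _ _ rewardB n B) => //.
  by move=> N k' s' k'P; apply: max_reward_bounded => //;
    exact: (base_norm_le rewardB s').
by move=> k' s' k'P; apply: max_reward_cvg => //;
  exact: (base_norm_le rewardB s').
Qed.

(** Dominated convergence in [n], after the one in [N] in [integral_esups], mirrors the two limits
    that define [policy_value]. *)
Lemma integral_limn_esup : (\int[P]_x limn_esup (fun m => (X x m)%:E))%E =
  (policy_value M B k s0)%:E.
Proof.
have iB : P.-integrable setT (EFin \o cst B).
  exact: finite_measure_integrable_cst.
have mX m := measurable_step (clip_reward M) m.
have [] := @dominated_convergence _ _ _ P setT measurableT
  (fun n (x : runs s0) => esups (fun m => (X x m)%:E) n)
  (fun x => limn_esup (fun m => (X x m)%:E)) (EFin \o cst B).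
- by move=> n; exact: measurable_fun_esups.
- exact: measurable_fun_limn_esup.
- by apply: aeW => x _; rewrite limn_esup_lim; exact: is_cvg_esups.
- exact: iB.
- apply: aeW => x n _; have YE := @Y_esups n x.
  have YB N : (- B%:E <= (Y n N x)%:E <= B%:E)%E.
    by rewrite -EFinN !lee_fin -ler_norml; exact: Y_bound.
  have : (- B%:E <= esups (fun m => (X x m)%:E) n <= B%:E)%E; last first.
    by rewrite /=; case: (esups _ _) => [r|/andP[]|/andP[]] //=;
      rewrite !lee_fin -ler_norml.
  rewrite -(cvg_lim _ YE) //; apply/andP; split.
    by apply: lime_ge; [apply/cvg_ex; eexists; exact: YE|apply: nearW => N;
      case/andP: (YB N)].
  by apply: lime_le; [apply/cvg_ex; eexists; exact: YE|apply: nearW => N;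
    case/andP: (YB N)].
move=> _ _; under eq_fun do rewrite integral_esups.
move=> H; apply: (@cvg_unique _ (@ereal_hausdorff R) _ _ _ _ H).
by apply: cvg_EFin; [exact: nearW|exact: tail_value_cvg].
Qed.

End run_integral.

(** * Strategies and policies *)

Section strategies.
Context {R : realType} {S : countType} (M : mdp R S).

(** Agreement on cylinders is enough for [integral_limn_esup]; clipping changes nothing, since
    almost every sequence follows edges. *)
Lemma strategy_value (B : R) (sigma : strategy M) (k : @policy R S) s0 :
  (forall s t, `|clip_reward M s t| <= B - 1) -> valid_policy M k s0 ->
  (forall u, path_prob sigma [::] s0 u = word_prob k u) ->
  payoff sigma s0 = (policy_value M B k s0)%:E.
Proof.
move=> rewardB kP pk; have PE u : run_measure sigma s0 (cylinder (s0 :: u)) =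
  (word_prob k u)%:E.
  by rewrite run_measure_cylinder pk.
rewrite -(integral_limn_esup PE kP rewardB) /payoff.
apply: ae_eq_integral => //.
- by apply: measurable_fun_limn_esup => m;
  exact: (@measurable_step _ _ s0 (reward M)).
- by apply: measurable_fun_limn_esup => m;
  exact: (@measurable_step _ _ s0 (clip_reward M)).
- have := run_measure_runs sigma s0; apply: filterS => x [_ xe] _ /=.
  by congr limn_esup; apply/funext => m; rewrite /clip_reward xe.
Qed.

Lemma sorted_rcons_belast s0 u : sorted (edge M)
  (rcons (belast s0 u) (last s0 u)) =
  path (edge M) s0 u.
Proof. by rewrite -lastI. Qed.

(** A strategy yields distributions only after genuine paths; the default makes the policy valid
    after all words, and words off the paths have probability [0]. *)
Definition policy_of (sigma : strategy M) s0 : @policy R S := fun u =>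
  if path (edge M) s0 u then step sigma (belast s0 u) (last s0 u)
  else default_dist M (last s0 u).

Lemma policy_of_valid sigma s0 : valid_policy M (policy_of sigma s0) s0.
Proof.
move=> u; rewrite /policy_of; case: ifP => pu; last exact: default_dist_valid.
split; first by apply: step_dist; rewrite sorted_rcons_belast.
by rewrite /step => /negbTE ->.
Qed.

Lemma path_prob_policy_of sigma s0 u :
  path_prob sigma [::] s0 u = word_prob (policy_of sigma s0) u.
Proof.
suff H v : path (edge M) s0 v ->
    path_prob sigma (belast s0 v) (last s0 v) u =
    word_prob (fun u' => policy_of sigma s0 (v ++ u')) u.
  by have := H [::] isT.
elim: u v => [//|t u IH] v pv /=.
rewrite cats0 {1}/policy_of pv.
have [vt|nvt] := boolP (edge M (last s0 v) t).
  congr (_ * _); have := IH (rcons v t).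
  rewrite rcons_path pv vt belast_rcons last_rcons => /(_ isT).
  rewrite -lastI => ->; congr word_prob; apply/funext => u'.
  by rewrite /after /= cat_rcons.
have [_ dN _] : is_dist (edge M (last s0 v))
  (step sigma (belast s0 v) (last s0 v)).
  by apply: step_dist; rewrite sorted_rcons_belast.
by rewrite dN // !mul0r.
Qed.

(** A strategy must also answer to histories from other start states, where a default is used.
    [head s h] is the first state of [rcons h s], even for empty [h]. *)
Lemma strategy_of_policy (k : @policy R S) s0 (kP : valid_policy M k s0) :
  exists sigma : strategy M,
  forall u, path_prob sigma [::] s0 u = word_prob k u.
Proof.
pose c h s : S -> R := if head s h == s0 then k (behead (rcons h s))
  else default_dist M s.
have cP h s : history M h s -> is_dist (edge M s) (c h s).
  move=> _; rewrite /c; case: ifP => hs; last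
    by have [] := default_dist_valid M s.
  have [] := kP (behead (rcons h s)); case: h hs => [|x h] /=; first
    by move=> /eqP <-.
  by rewrite last_rcons.
exists (Strategy cP) => u.
suff H v : path_prob (Strategy cP) (belast s0 v) (last s0 v) u =
    word_prob (fun u' => k (v ++ u')) u.
  exact: (H [::]).
elim: u v => [//|t u IH] v /=; have := IH (rcons v t).
rewrite belast_rcons last_rcons -lastI => ->; rewrite cats0; congr (_ * _);
  last first.
  by congr word_prob; apply/funext => u'; rewrite /after /= cat_rcons.
have [_ kr] := kP v; rewrite /step /=; case: ifPn => [_|/kr -> //].
rewrite /c -lastI /= (_ : head _ _ = s0) ?eqxx //.
by case: v {IH kr}.
Qed.

Lemma markov_strategy (g : nat -> S -> S -> R) s0 :
  (forall i s, valid_dist M s (g i s)) ->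
  exists sigma : strategy M, (forall h s, sigma h s = g (size h) s) /\
    forall u, path_prob sigma [::] s0 u = word_prob (markov_policy g 0 s0) u.
Proof.
move=> gP; have cP h s : history M h s -> is_dist (edge M s) (g (size h) s).
  by move=> _; have [] := gP (size h) s.
exists (Strategy cP); split => // u.
suff H h s : path_prob (Strategy cP) h s u =
  word_prob (markov_policy g (size h) s) u.
  exact: H.
elim: u h s => [//|t u IH] h s /=;
  rewrite IH size_rcons after_markov markov_policy0.
by congr (_ * _); rewrite /step /=; case: ifPn => // /(gP (size h) s).2 ->.
Qed.

End strategies.

Theorem theorem34 (R : realType) (S : countType) (M : mdp R S) (s0 : S)
    (M_bounded : bounded_rewards M) :
  (exists sigma : strategy M, is_optimal sigma s0) ->
  (exists sigma : strategy M, is_memoryless sigma /\ is_optimal sigma s0) /\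
  (exists sigma : strategy M,
     [/\ is_deterministic sigma, is_markov sigma & is_optimal sigma s0]).
Proof.
(* [B + 1] becomes the bound of the preceding sections, which ask for rewards within the bound minus
   [1]. *)
have [B [bound_ge0 rewardB]] : exists B : R, 0 <= B /\ forall s t,
  `|clip_reward M s t| <= B + 1 - 1.
  have [B HB] := M_bounded; exists `|B|; split => // s t.
  rewrite addrK /clip_reward; case: ifP => [/HB|_]; last by rewrite normr0.
  by move=> h; apply: le_trans h (ler_norm _).
have payoff_le (sigma : strategy M) :
  (payoff sigma s0 <= (opt_value M (B + 1) s0)%:E)%E.
  rewrite (strategy_value rewardB (policy_of_valid sigma s0)
    (path_prob_policy_of sigma s0)).
  by rewrite lee_fin; apply: policy_value_le_opt => //; exact: policy_of_valid.
have value_le : (mdp_value M s0 <= (opt_value M (B + 1) s0)%:E)%E.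
  by apply: ge_ereal_sup => _ [sigma _ <-].
have le_optimal (sigma : strategy M) :
  ((opt_value M (B + 1) s0)%:E <= payoff sigma s0)%E ->
    is_optimal sigma s0.
  move=> h; apply/eqP; rewrite eq_le; apply/andP; split.
    by apply: ereal_sup_ubound; exists sigma.
  exact: le_trans value_le h.
move=> [sigma opt_sigma].
(* Every policy from [s0] is realised by a strategy, so none beats the given optimal one; the policy
   read off the latter attains [opt_value]. *)
have Ws0 : attained M (B + 1) s0.
  exists (policy_of sigma s0); split; first exact: policy_of_valid.
  apply/eqP; rewrite eq_le policy_value_le_opt //=; last exact: policy_of_valid.
  apply: ge_sup; first by have [] := policy_values_has_sup rewardB s0.
  move=> _ [k kP <-]; rewrite -lee_fin.
  rewrite -(strategy_value rewardB (policy_of_valid sigma s0)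
    (path_prob_policy_of sigma s0)).
  have [tau tauP] := strategy_of_policy kP.
  rewrite -(strategy_value rewardB kP tauP) opt_sigma.
  by apply: ereal_sup_ubound; exists tau.
have [f [fA fhit]] := memoryless_hit rewardB; split.
  have fP (i : nat) s : valid_dist M s (f s) by have [] := fA s.
  have [tau [tauE tauP]] := markov_strategy s0 fP.
  exists tau; split; first by move=> h h' s _ _ t; rewrite !tauE.
  apply: le_optimal; rewrite (strategy_value rewardB _ tauP); last first.
    by apply: markov_policy_valid => i s; exact: fA.
  by rewrite lee_fin; exact: value_le_memoryless.
have [g [gP gdet gV]] := value_le_det_markov rewardB fA fhit Ws0.
have [tau [tauE tauP]] := markov_strategy s0 gP.
exists tau; split.
- move=> h s /andP[_ cs]; have [t gt] := gdet (size h) s cs.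
  by exists t => u; rewrite tauE gt.
- by move=> h h' s _ _ hh' t; rewrite !tauE hh'.
- apply: le_optimal; rewrite (strategy_value rewardB _ tauP) ?lee_fin //.
  by move=> u; exact: gP.
Qed.
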